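(* Let the uplink (UL) satellite network share spectrum with the downlink (DL) terrestrial network. For $R_{\min}^{\mathrm{u_s|s}}\le r\le R_{\max}^{\mathrm{u_s|s}}$ and $\|\mathbf u_1^{\mathrm s}-\mathbf x_1\|=r$, define the aggregated interference plus noise power $$I_{\mathrm{up}}^{\mathrm{dn}}(r)=\sum_{\mathbf u_\ell^{\mathrm s}\in\Phi_{\mathrm{u_s}}\cap(\mathcal A_{\mathrm{u_s|s}}\setminus\mathcal A_{\mathrm{u_s|s}}(r))}G_\ell^{\mathrm{u_s|s}}P_{\mathrm{u_s}}H_\ell^{\mathrm s}\|\mathbf u_\ell^{\mathrm s}-\mathbf x_1\|^{-\alpha_{\mathrm s}}+\sum_{\mathbf b_m\in\Phi_{\mathrm b}\cap\mathcal A_{\mathrm{b|s}}}G^{\mathrm{b|s}}P_{\mathrm b}H_m^{\mathrm s}\|\mathbf b_m-\mathbf x_1\|^{-\alpha_{\mathrm s}}+\sigma^2 .$$ Then, for $s\ge0$, its conditional Laplace transform $\mathbb E\bigl[e^{-sI_{\mathrm{up}}^{\mathrm{dn}}(r)}\,\big|\,\|\mathbf u_1^{\mathrm s}-\mathbf x_1\|=r,\ \Phi_{\mathrm{u_s}}(\mathcal A_{\mathrm{u_s|s}})\ge1\bigr]$ equals $$\exp\Biggl(-s\sigma^2-2\pi\tilde\lambda_{\mathrm{u_s|s}}\int_r^{R_{\max}^{\mathrm{u_s|s}}}\Bigl[1-\sum_{z=0}^{m_{\mathrm s}-1}\frac{\zeta(z)\Gamma(z+1)}{(\beta-c+sG_\ell^{\mathrm{u_s|s}}P_{\mathrm{u_s}}v^{-\alpha_{\mathrm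 s}})^{z+1}}\Bigr]v\,\mathrm dv$$ $$-2\pi\tilde\lambda_{\mathrm{b|s}}\int_{R_{\min}^{\mathrm{b|s}}}^{R_{\psi'}^{\mathrm{b|s}}}\Bigl[1-\sum_{i=0}^{m_{\mathrm s}-1}\frac{\zeta(i)\Gamma(i+1)}{(\beta-c+sG^{\mathrm{b_L|s}}P_{\mathrm b}w^{-\alpha_{\mathrm s}})^{i+1}}\Bigr]w\,\mathrm dw-2\pi\tilde\lambda_{\mathrm{b|s}}\int_{R_{\psi'}^{\mathrm{b|s}}}^{R_{\max}^{\mathrm{b|s}}}\Bigl[1-\sum_{i=0}^{m_{\mathrm s}-1}\frac{\zeta(i)\Gamma(i+1)}{(\beta-c+sG^{\mathrm{b_H|s}}P_{\mathrm b}u^{-\alpha_{\mathrm s}})^{i+1}}\Bigr]u\,\mathrm du\Biggr),$$ where $G_\ell^{\mathrm{u_s|s}}$ denotes the common (side-lobe) gain of all interfering satellite users ($\ell\neq1$).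
   Context: Geometry. All nodes lie on spheres centered at the origin of $\mathbb{R}^3$. Satellites lie on the sphere of radius $R_{\mathrm s}$; satellite users and terrestrial base stations (BSs) lie on spheres of radii $R_{\mathrm{u_s}},R_{\mathrm b}<R_{\mathrm s}$. $\Phi_{\mathrm{u_s}}=\{\mathbf u_\ell^{\mathrm s}\}$ and $\Phi_{\mathrm b}=\{\mathbf b_m\}$ are independent homogeneous Poisson point processes on the respective spheres with densities $\lambda_{\mathrm{u_s}},\lambda_{\mathrm b}>0$ (per unit area). The typical satellite is fixed at $\mathbf x_1=(0,0,R_{\mathrm s})$. The visible angle is $\theta_{\mathrm s}\in(0,\pi/2)$ with $R_{\mathrm s}\sin\theta_{\mathrm s}\le R_o$ for $o\in\{\mathrm{u_s},\mathrm b\}$. For such $o$ put $$R_{\min}^{o|\mathrm s}=R_{\mathrm s}-R_o,\quad R_{\max}^{o|\mathrm s}=R_{\mathrm s}\cos\theta_{\mathrm s}-\sqrt{R_o^2-R_{\mathrm s}^2\sin^2\theta_{\mathrm s}},\quad\tilde\lambda_{o|\mathrm s}=\lambda_o\frac{R_o}{R_{\mathrm s}}.$$ The visible cap $\mathcal A_{o|\mathrm s}$ is the set of points of the sphere of radius $R_o$ at distance at most $R_{\max}^{o|\mathrm s}$ from $\mathbf x_1$; $\mathcal A_{o|\mathrm s}(r)$ is the set of those at distance at most $r$. $\mathbf u_1^{\mathrm s}$ is the visible satellite user nearest to $\mathbf x_1$. Gains. With carrier frequency $f_c$, speed of light $c_0$ and positive lobe gains: $G_\ell^{\mathrm{u_s|s}}=G_{\mathrm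 s}^{\mathrm{side}}G_{\mathrm{u_s}}^{\mathrm{side}}(c_0/4\pi f_c)^2$ for $\ell\ne1$; $G^{\mathrm{b_L|s}}=G_{\mathrm s}^{\mathrm{side}}G_{\mathrm{b_L}}^{\mathrm{side}}(c_0/4\pi f_c)^2$; $G^{\mathrm{b_H|s}}=G_{\mathrm s}^{\mathrm{side}}G_{\mathrm{b_H}}^{\mathrm{side}}(c_0/4\pi f_c)^2$. The gain $G^{\mathrm{b|s}}$ of a BS equals $G^{\mathrm{b_H|s}}$ if the elevation angle $\psi$ of $\mathbf x_1$ above the local horizontal plane at the BS satisfies $\psi_1^{\mathrm{th}}<\psi\le\psi_2^{\mathrm{th}}$, and $G^{\mathrm{b_L|s}}$ if $\psi>\psi_2^{\mathrm{th}}$. It is assumed that $\psi_1^{\mathrm{th}}<\cos^{-1}\bigl(\tfrac{R_{\mathrm s}}{R_{\mathrm b}}\sin\theta_{\mathrm s}\bigr)\le\psi_2^{\mathrm{th}}\le\pi/2$ (so every visible BS has $\psi>\psi_1^{\mathrm{th}}$). The distance to $\mathbf x_1$ of a BS seeing it at elevation $\psi_2^{\mathrm{th}}$ is $R_{\psi'}^{\mathrm{b|s}}=\sqrt{R_{\mathrm s}^2-R_{\mathrm b}^2\cos^2\psi_2^{\mathrm{th}}}-R_{\mathrm b}\sin\psi_2^{\mathrm{th}}\in[R_{\min}^{\mathrm{b|s}},R_{\max}^{\mathrm{b|s}}]$. Fading. All fading powers $H^{\mathrm s}$ (for satellite users and BSs) are i.i.d. and independent of the point processes; $\sqrt{H^{\mathrm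 s}}$ is Shadowed-Rician with density $$\Bigl(\tfrac{2bm_{\mathrm s}}{2bm_{\mathrm s}+\Omega}\Bigr)^{m_{\mathrm s}}\tfrac{x}{b}\,e^{-x^2/(2b)}\,{}_1F_1\Bigl(m_{\mathrm s};1;\tfrac{\Omega x^2}{2b(2bm_{\mathrm s}+\Omega)}\Bigr),\quad x>0,$$ with $b,\Omega>0$, $m_{\mathrm s}$ a positive integer, ${}_1F_1$ the confluent hypergeometric function. Constants: $\beta=\frac1{2b}$, $c=\frac{\Omega}{2b(2bm_{\mathrm s}+\Omega)}$, $\zeta(z)=\bigl(\frac{2bm_{\mathrm s}}{2bm_{\mathrm s}+\Omega}\bigr)^{m_{\mathrm s}}\frac{\beta(-1)^z(1-m_{\mathrm s})_z c^z}{(z!)^2}$, with $(x)_z=x(x+1)\cdots(x+z-1)$ and $(x)_0=1$. $P_{\mathrm{u_s}},P_{\mathrm b}>0$ are transmit powers, $\sigma^2>0$ the noise power, $\alpha_{\mathrm s}>0$ the path-loss exponent. *)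

(* Defs.v *)
From mathcomp Require Export all_boot all_order all_algebra.
From mathcomp Require Export all_classical all_reals all_analysis.
Export Order.TTheory GRing.Theory Num.Theory.
Export numFieldNormedType.Exports.

Set Implicit Arguments.
Unset Strict Implicit.
Unset Printing Implicit Defensive.

Local Open Scope classical_set_scope.
Local Open Scope ring_scope.

(** * Geometry *)

(* The norm which R * R * R carries in the library is the sup norm, hence the
   explicit Euclidean structure. *)
Notation point R := (R * R * R)%type.

Definition dot {R : realType} (x y : point R) : R :=
  x.1.1 * y.1.1 + x.1.2 * y.1.2 + x.2 * y.2.

Definition enorm {R : realType} (x : point R) : R := Num.sqrt (dot x x).

Definition edist {R : realType} (x y : point R) : R := enorm (x - y).

Definition sphere {R : realType} (rho : R) : set (point R) :=
  [set x | enorm x = rho].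

Definition spherical {R : realType} (rho t p : R) : point R :=
  (rho * (sin t * cos p), rho * (sin t * sin p), rho * cos t).

(* Surface area of the part of A lying on the sphere of radius rho, with area
   element rho^2 sin t dt dp. *)
Definition sphere_area {R : realType} (rho : R) (A : set (point R)) : \bar R :=
  \int[@lebesgue_measure R]_(p in `[0%R, (2 * pi)%R])
    \int[@lebesgue_measure R]_(t in `[0%R, pi])
      (\1_A (spherical rho t p) * (rho ^+ 2 * sin t))%:E.

Definition sat {R : realType} (Rs : R) : point R := (0, 0, Rs).

Definition Rmin {R : realType} (Rs Ro : R) : R := Rs - Ro.

Definition Rmax {R : realType} (Rs theta Ro : R) : R :=
  Rs * cos theta - Num.sqrt (Ro ^+ 2 - Rs ^+ 2 * sin theta ^+ 2).

Definition cap {R : realType} (Rs Ro r : R) : set (point R) :=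
  sphere Ro `&` [set x | edist x (sat Rs) <= r].

Definition visible_cap {R : realType} (Rs theta Ro : R) : set (point R) :=
  cap Rs Ro (Rmax Rs theta Ro).

(* Angle between x - y and the plane orthogonal to y. *)
Definition elevation {R : realType} (y x : point R) : R :=
  asin (dot y (x - y) / (enorm y * enorm (x - y))).

Definition Rpsi {R : realType} (Rs Rb psi : R) : R :=
  Num.sqrt (Rs ^+ 2 - Rb ^+ 2 * cos psi ^+ 2) - Rb * sin psi.

(** * Gains *)

Definition link_gain {R : realType} (fc c0 Gtx Grx : R) : R :=
  Gtx * Grx * (c0 / (4 * pi * fc)) ^+ 2.

(* The gain is only prescribed for psi1 < elevation; the value 0 below this
   threshold concerns no visible base station when
   psi1 < acos (Rs / Rb * sin theta). *)
Definition bs_gain {R : realType} (Rs psi1 psi2 GL GH : R) (y : point R) : R :=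
  let psi := elevation y (sat Rs) in
  if psi2 < psi then GL else if psi1 < psi then GH else 0.

(** * Special functions and the Shadowed-Rician law *)

Definition pochhammer {R : realType} (x : R) (n : nat) : R :=
  \prod_(i < n) (x + i%:R).

Definition hyp1F1 {R : realType} (a b x : R) : R :=
  limn (series (fun n => pochhammer a n / pochhammer b n * (x ^+ n / n`!%:R))).

Definition Gamma {R : realType} (x : R) : R :=
  \int[@lebesgue_measure R]_(t in `]0%R, +oo[) (t `^ (x - 1) * expR (- t)).

Definition SR_pdf {R : realType} (b Om : R) (m : nat) (x : R) : R :=
  (2 * b * m%:R / (2 * b * m%:R + Om)) ^+ m * (x / b)
  * expR (- (x ^+ 2 / (2 * b)))
  * hyp1F1 m%:R 1 (Om * x ^+ 2 / (2 * b * (2 * b * m%:R + Om))).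

Definition SR_beta {R : realType} (b : R) : R := 1 / (2 * b).

Definition SR_c {R : realType} (b Om : R) (m : nat) : R :=
  Om / (2 * b * (2 * b * m%:R + Om)).

Definition SR_zeta {R : realType} (b Om : R) (m z : nat) : R :=
  (2 * b * m%:R / (2 * b * m%:R + Om)) ^+ m
  * (SR_beta b * (-1) ^+ z * pochhammer (1 - m%:R) z * SR_c b Om m ^+ z
     / (z`!%:R) ^+ 2).

(** * Probability *)

Definition mutually_independent {d} {T : measurableType d} {R : realType}
    (P : probability T R) (I : choiceType) (F : I -> set (set T)) : Prop :=
  forall (s : seq I) (A : I -> set T), uniq s ->
    (forall i, i \in s -> F i (A i)) ->
    P (\bigcap_(i in [set` s]) A i) = (\prod_(i <- s) P (A i))%E.

(* A finite random configuration is a random finite list of points, in an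
   arbitrary order. *)
Definition point_event {T : Type} {R : realType} (Phi : T -> seq (point R))
    (i : nat) (B : set (point R)) : set T :=
  [set w | (i < size (Phi w))%N /\ B (Phi w)`_i].

Definition sigma_config {T : Type} {R : realType} (Phi : T -> seq (point R)) :
    set (set T) :=
  <<s [set E | exists i B, measurable B /\ E = point_event Phi i B] >>.

Definition sigma_var {T : Type} {R : realType} (X : T -> R) : set (set T) :=
  preimage_set_system setT X measurable.

Definition nb_points {T : Type} {R : realType} (Phi : T -> seq (point R))
    (B : set (point R)) (w : T) : nat :=
  count (fun x => x \in B) (Phi w).

(* Unlike the library's poisson_pmf, this is also the Poisson law (Dirac mass
   at 0) for the mean mu = 0. *)
Definition poisson_weight {R : realType} (mu : R) (k : nat) : R :=
  expR (- mu) * mu ^+ k / k`!%:R.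

Definition homogeneous_PPP {d} {T : measurableType d} {R : realType}
    (P : probability T R) (rho lambda : R) (Phi : T -> seq (point R)) : Prop :=
  [/\ forall i B, measurable B -> measurable (point_event Phi i B),
      forall w x, x \in Phi w -> sphere rho x
    & forall (n : nat) (B : 'I_n -> set (point R)) (k : 'I_n -> nat),
        (forall j, measurable (B j)) -> trivIset setT B ->
        P [set w | forall j, nb_points Phi (B j) w = k j] =
        (\prod_(j < n)
           poisson_weight (lambda * fine (sphere_area rho (B j))) (k j))%:E].

Definition has_SR_root {d} {T : measurableType d} {R : realType}
    (P : probability T R) (b Om : R) (m : nat) (H : T -> R) : Prop :=
  forall B : set R, measurable B ->
    P [set w | B (Num.sqrt (H w))] =
    (\int[@lebesgue_measure R]_(x in B `&` `]0%R, +oo[) (SR_pdf b Om m x)%:E)%E.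

(* The four families of random objects of the network, indexed by
   (true, None) for the satellite users, (false, None) for the base stations,
   and (true, Some i), (false, Some i) for the fading powers attached to the
   i-th point of the respective configuration. *)
Definition network_sources {T : Type} {R : realType}
    (Phi_us Phi_b : T -> seq (point R)) (H_us H_b : nat -> T -> R)
    (k : bool * option nat) : set (set T) :=
  match k with
  | (true, None) => sigma_config Phi_us
  | (false, None) => sigma_config Phi_b
  | (true, Some i) => sigma_var (H_us i)
  | (false, Some i) => sigma_var (H_b i)
  end.

(* u w is unconstrained when no point of Phi w lies in A. *)
Definition nearest_point {T : Type} {R : realType} (Phi : T -> seq (point R))
    (A : set (point R)) (x : point R) (u : T -> point R) : Prop :=
  forall w, (1 <= nb_points Phi A w)%N ->
    [/\ u w \in Phi w, A (u w)
      & forall y, y \in Phi w -> A y -> edist (u w) x <= edist y x].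

(* g r = E[X | D = r, E] for every r in S. The last clause is the defining
   property of a version of the conditional expectation given D under
   P( . | E), on the event that D lies in S, with the common factor 1 / P E
   cancelled. It determines g only up to a null set of the law of D, so that a
   value at each single r is meaningful through continuity: when that law
   charges every nonempty relatively open subset of S, there is at most one
   such g on S. *)
Definition conditional_expectation {d} {T : measurableType d} {R : realType}
    (P : probability T R) (X D : T -> R) (E : set T) (S : set R) (g : R -> R) :
    Prop :=
  [/\ (0 < P E)%E,
      P.-integrable (E `&` D @^-1` S) (EFin \o X),
      {within S, continuous g},
      P.-integrable (E `&` D @^-1` S) (EFin \o (g \o D))
    & forall B, measurable B -> B `<=` S ->
        (\int[P]_(w in E `&` D @^-1` B) (X w)%:E =
         \int[P]_(w in E `&` D @^-1` B) (g (D w))%:E)%E].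

(** * Interference *)

(* H_us i and H_b j are the fading powers of the i-th satellite user and of the
   j-th base station; G_us is the gain of all interfering satellite users. *)
Definition interference {T : Type} {R : realType}
    (Rs Rus Rb theta G_us P_us : R) (G_b : point R -> R) (P_b sigma2 alpha : R)
    (Phi_us Phi_b : T -> seq (point R)) (H_us H_b : nat -> T -> R)
    (r : R) (w : T) : R :=
  \sum_(i < size (Phi_us w) |
          (Phi_us w)`_i \in visible_cap Rs theta Rus `\` cap Rs Rus r)
     G_us * P_us * H_us i w * edist (Phi_us w)`_i (sat Rs) `^ (- alpha)
  + \sum_(j < size (Phi_b w) | (Phi_b w)`_j \in visible_cap Rs theta Rb)
     G_b (Phi_b w)`_j * P_b * H_b j w * edist (Phi_b w)`_j (sat Rs) `^ (- alpha)
  + sigma2.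

(* The finite sum is E[exp (- s G Ptx H v^(-alpha))], H being the fading power. *)
Definition exponent_term {R : realType} (b Om : R) (m : nat)
    (s G Ptx alpha lo hi : R) : R :=
  \int[@lebesgue_measure R]_(v in `[lo, hi])
    ((1 - \sum_(0 <= z < m)
            SR_zeta b Om m z * Gamma (z%:R + 1)
            / (SR_beta b - SR_c b Om m + s * G * Ptx * v `^ (- alpha)) ^+ z.+1)
     * v).

(* Main.v *)
Require Import Defs.
From mathcomp Require Import measurable_realfun.
From mathcomp Require Import ring lra.
Import HBNNSimple.

Set Implicit Arguments.
Unset Strict Implicit.
Unset Printing Implicit Defensive.

Local Open Scope classical_set_scope.
Local Open Scope ring_scope.

(* Round the distances to the satellite up to a finite grid. A configuration
   then takes countably many values, so the independent fading powers can be
   integrated out on each of them: this replaces exp(- a H) by its mean L(a) at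
   each interferer. By the spherical cap area pi (rho / Rs) (r^2 - (Rs - rho)^2),
   the numbers of points in the grid cells are independent Poisson variables
   with means proportional to the integrals of v over the cells. The cell of the
   nearest user depends only on the cells up to it, hence is independent of the
   counts beyond it, whose generating functions give the exponential of a
   Riemann sum. As the mesh tends to 0, this yields the identity on the events
   D >= t, and a pi-lambda argument extends it to the Borel events of D. The mean
   L(a) is explicit because Kummer's transformation turns 1F1(m; 1; .) into a
   polynomial times an exponential. *)

(** * Independence and expectations of products *)

(** Fading powers are attached to points by their position in the list. The discretized
    configuration is therefore the ordered list of cells: its entries determine the coefficients of
    the fading powers, and only afterwards is it reduced to Poisson counts. Distances are rounded up
    because the gain of a base station jumps at the distance [Rpsi], where it is only right
    continuous. A user interferes at stage n if its cell is strictly beyond that of the nearest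
    user; users sharing that cell are neglected, and in the limit this leaves exactly the strict
    condition on distances. Independence is available for events only: events of the sources for the
    fading, fibres of the cell counts for the Poisson part. A single induction, exchanging
    indicators for bounded functions one factor at a time, serves both cases without product
    measures or conditional laws. The prescribed law is that of [Num.sqrt H], so the computation is
    carried out with [Num.sqrt H ^+ 2], which equals H almost surely. Measurability of the distance
    to the nearest user and of the interference is obtained from the discretizations, of which they
    are pointwise limits. *)

Lemma prod01 {R : numDomainType} (I : Type) (s : seq I) (F : I -> R) :
  (forall i, 0 <= F i <= 1) -> 0 <= \prod_(i <- s) F i <= 1.
Proof.
move=> F01; elim: s => [|i s /andP[? ?]]; first by rewrite big_nil ler01 lexx.
by have /andP[? ?] := F01 i; rewrite big_cons mulr_ge0//= mulr_ile1.
Qed.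

Lemma measurable_sqrt (R : realType) : measurable_fun setT (@Num.sqrt R).
Proof. by apply: nondecreasing_measurable => // u v uv; exact: ler_wsqrtr. Qed.

(** * Integration against a measure with a density along a map *)

Section transfer.
Local Open Scope ereal_scope.

(** It is used with phi a random variable and W an independent weight, and with phi the identity and
    W a density. As nu is known only on sets, f is reached through simple functions. *)
Lemma ge0_integral_transfer d1 d2 (X : measurableType d1) (Y : measurableType d2)
    (R : realType) (mu : {measure set X -> \bar R})
    (nu : {measure set Y -> \bar R}) (phi : X -> Y) (W : X -> R) :
  measurable_fun setT phi -> measurable_fun setT W -> (forall x, (0 <= W x)%R) ->
  (forall B, measurable B -> nu B = \int[mu]_(x in phi @^-1` B) (W x)%:E) ->
  forall f : Y -> \bar R, measurable_fun setT f -> (forall y, 0 <= f y) ->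
  \int[nu]_y f y = \int[mu]_x (f (phi x) * (W x)%:E).
Proof.
move=> mphi mW W0 nuE f mf f0.
pose h := nnsfun_approx measurableT mf.
have mphiI B : measurable B -> measurable (phi @^-1` B).
  by move=> mB; rewrite -(setTI (_ @^-1` _)); exact: mphi.
have mhphi n : measurable_fun setT (h n \o phi).
  by apply: measurableT_comp.
have -> : \int[nu]_x f x = lim (\int[nu]_x (EFin \o h n) x @[n --> \oo]).
  have fE x : f x = lim ((EFin \o h n) x @[n --> \oo]).
    by apply/esym/cvg_lim => //; exact: cvg_nnsfun_approx.
  under eq_integral => x _ do rewrite fE.
  apply: monotone_convergence => //.
  - by move=> n; apply/measurable_EFinP.
  - by move=> n x _; rewrite lee_fin.
  - by move=> x _ a b ab; rewrite lee_fin; exact/lefP/nd_nnsfun_approx.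
have -> : \int[mu]_x (f (phi x) * (W x)%:E) =
    lim (\int[mu]_x (((h n (phi x)) * W x)%:E) @[n --> \oo]).
  have fg x : f (phi x) * (W x)%:E = lim (((h n (phi x)) * W x)%:E @[n --> \oo]).
    apply/esym/cvg_lim => //; under eq_fun do rewrite EFinM.
    by apply: cvgeZr => //; exact: (cvg_nnsfun_approx measurableT mf _ I).
  under eq_integral => x _ do rewrite fg.
  apply: monotone_convergence => //.
  - by move=> n; apply/measurable_EFinP; apply: measurable_funM => //; exact: mhphi.
  - by move=> n x _; rewrite lee_fin mulr_ge0.
  - move=> x _ a b ab; rewrite lee_fin ler_wpM2r//.
    exact/lefP/nd_nnsfun_approx.
suff suf n : \int[nu]_x (EFin \o h n) x = \int[mu]_x (h n (phi x) * W x)%:E.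
  by under eq_fun do rewrite suf.
have mi r : measurable_fun setT (fun x => (r * \1_(h n @^-1` [set r]) (phi x) * W x)%:E).
  apply/measurable_EFinP; apply: measurable_funM => //; apply: measurable_funM => //.
  by apply: measurableT_comp => //; exact: measurable_indic.
transitivity (\int[nu]_x
   (\sum_(y \in range (h n)) (y * \1_(h n @^-1` [set y]) x)%:E)).
  by apply: eq_integral => t tE; rewrite /= fimfunE -fsumEFin.
transitivity (\int[mu]_x
   (\sum_(y \in range (h n)) (y * \1_(h n @^-1` [set y]) (phi x) * W x)%:E)); last first.
  apply: eq_integral => t tE; rewrite /= fsumEFin// fimfunE.
  by rewrite fsbig_finite// [in RHS]fsbig_finite// mulr_suml.
rewrite !ge0_integral_fsum//; last 3 first.
- move=> r x _; have := nnfun_muleindic_ge0 (h n) r (phi x); rewrite !lee_fin.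
  by move=> ?; rewrite mulr_ge0.
- by move=> r; apply/measurable_EFinP/measurable_funM.
- by move=> r x _; exact: nnfun_muleindic_ge0.
apply: eq_fsbigr => r rhn; have mB : measurable (h n @^-1` [set r]) by [].
have r0 : (0 <= r)%R by move: rhn; rewrite inE => -[y _ <-].
rewrite integralZl_indic_nnsfun// integral_indic// setIT nuE//.
transitivity (\int[mu]_x (r%:E * (\1_(phi @^-1` (h n @^-1` [set r])) x * W x)%:E)).
  rewrite ge0_integralZl//; last 2 first.
  - by apply/measurable_EFinP/measurable_funM => //; apply: measurable_indic; apply: mphiI.
  - by move=> x _; rewrite lee_fin mulr_ge0.
  congr (_ * _); rewrite integral_mkcond; apply: eq_integral => x _.
  rewrite patchE indicE; case: ifPn => _; first by rewrite mul1r.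
  by rewrite mul0r.
apply: eq_integral => x _; rewrite -EFinM mulrA; congr (_ * _)%:E.
Qed.

End transfer.

(** * From independent events to products of bounded functions *)

Section independence.
Context {d} {T : measurableType d} {R : realType} (P : probability T R).

Definition unit_valued (Y : T -> R) : Prop := forall w, 0 <= Y w <= 1.

(* Independence of Y from a weight W with mean c need only be tested on the
   events of A. *)
Definition transfers (A : set (set T)) (Y : T -> R) : Prop :=
  [/\ measurable_fun setT Y, unit_valued Y &
   forall (W : T -> R) (c : R), measurable_fun setT W -> unit_valued W -> 0 <= c ->
    (forall B, A B -> (\int[P]_w (\1_B w * W w)%:E = P B * c%:E)%E) ->
    (\int[P]_w (Y w * W w)%:E = (\int[P]_w (Y w)%:E) * c%:E)%E].

Lemma indic_unit (A : set T) : unit_valued (\1_A).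
Proof. by move=> w; rewrite indicE ler0n lern1 leq_b1. Qed.

Lemma transfers_indic (A : set (set T)) B : measurable B -> A B ->
  transfers A (\1_B).
Proof.
move=> mB AB; split; [exact: measurable_indic|exact: indic_unit|].
by move=> W c _ _ _ /(_ _ AB) ->; rewrite integral_indic// setIT.
Qed.

(** By the test on events, c times the law of H is the set function sending B to the integral of W
    over the event that H lies in B. This multiple of a pushforward is already a measure, and
    [ge0_integral_transfer] passes from sets to f. *)
Lemma transfers_comp d' (Y : measurableType d') (H : T -> Y) (f : Y -> R) (A : set (set T)) :
  measurable_fun setT H -> measurable_fun setT f ->
  (forall y, 0 <= f y <= 1) ->
  (forall B, measurable B -> A (H @^-1` B)) ->
  transfers A (f \o H).
Proof.
move=> mH mf f01 AH; split; [exact: measurableT_comp|by move=> w; exact: f01|].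
move=> W c mW W01 c0 AW.
have f0 y : 0 <= f y by case/andP: (f01 y).
have W0 y : 0 <= W y by case/andP: (W01 y).
pose nu0 : {measure set Y -> \bar R} := mscale (NngNum c0) (pushforward P H).
pose nu := nu0 mH.
have nuE B : measurable B -> nu B = (\int[P]_(w in H @^-1` B) (W w)%:E)%E.
  move=> mB; transitivity (c%:E * P (H @^-1` B))%E; first by [].
  rewrite muleC -AW; last exact: AH.
  rewrite [RHS]integral_mkcond; apply: eq_integral => x _.
  rewrite patchE indicE; case: ifPn => _; first by rewrite mul1r.
  by rewrite mul0r.
have E1 : (\int[nu]_y (f y)%:E = \int[P]_w ((f (H w))%:E * (W w)%:E))%E.
  have mEf : measurable_fun setT (EFin \o f) by exact/measurable_EFinP.
  by rewrite (ge0_integral_transfer mH mW W0 nuE mEf)// => y; rewrite lee_fin.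
under eq_integral do rewrite EFinM.
rewrite -E1 /nu /nu0 ge0_integral_mscale//=; last 2 first.
- exact/measurable_EFinP.
- by move=> y _; rewrite lee_fin.
rewrite muleC; congr (_ * _)%E.
rewrite ge0_integral_pushforward//=; last by move=> y _; rewrite lee_fin.
exact/measurable_EFinP.
Qed.

Lemma integral_fibers (N : T -> nat) (f : T -> R) :
  (forall k, measurable (N @^-1` [set k])) ->
  measurable_fun setT f -> (forall w, 0 <= f w) ->
  (\int[P]_w (f w)%:E = \sum_(k <oo) \int[P]_w (\1_(N @^-1` [set k]) w * f w)%:E)%E.
Proof.
move=> mN mf f0.
have <- : \bigcup_k (N @^-1` [set k]) = setT.
  by apply/seteqP; split => // w _; exists (N w).
rewrite ge0_integral_bigcup//; last 3 first.
- by apply/measurable_EFinP; apply: measurable_funS mf.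
- by move=> w _; rewrite lee_fin.
- by apply/trivIsetP => i j _ _ /eqP ij; rewrite -preimage_setI set1I; case: ifPn; rewrite ?preimage_set0// inE => /= /ij.
apply: eq_eseriesr => k _; rewrite integral_mkcond [RHS]integral_mkcond.
apply: eq_integral => x _; rewrite !patchE !indicE.
case: ifPn => _; last by case: ifPn; rewrite ?mul0r.
rewrite mem_set ?mul1r//; by exists (N x).
Qed.

Lemma measurable_fibers d' (Y : measurableType d') (N : T -> nat) (f : T -> Y) (D : set T) :
  measurable D ->
  (forall k, measurable (N @^-1` [set k])) ->
  (forall k, measurable_fun (D `&` N @^-1` [set k]) f) -> measurable_fun D f.
Proof.
move=> mD mN mf.
have -> : D = \bigcup_k (D `&` N @^-1` [set k]).
  by apply/seteqP; split => [w Dw|w [k _ []//]]; exists (N w).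
apply/measurable_fun_bigcup => // k; exact: measurableI.
Qed.

Lemma measurable_discrete d' (Y : measurableType d') (N : T -> nat) (f : nat -> Y) :
  (forall k, measurable (N @^-1` [set k])) -> measurable_fun setT (f \o N).
Proof.
move=> mN; apply: (@measurable_fibers _ _ N) => // k.
rewrite setTI; apply: (eq_measurable_fun (cst (f k))) => [w|]; last exact: measurable_cst.
by rewrite inE /= => <-.
Qed.

(** The fibres suffice as test events because [f \o N] is a countable combination of their
    indicators. For the cell counts they are the only events whose joint probabilities the Poisson
    hypothesis gives directly. *)
Lemma transfers_discrete (N : T -> nat) (f : nat -> R) (A : set (set T)) :
  (forall k, measurable (N @^-1` [set k])) ->
  (forall y, 0 <= f y <= 1) ->
  (forall k, A (N @^-1` [set k])) ->
  transfers A (f \o N).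
Proof.
move=> mN f01 AN.
have mf : measurable_fun setT (f \o N) by exact: measurable_discrete.
split => //; first by move=> w; exact: f01.
move=> W c mW W01 c0 AW.
have f0 y : 0 <= f y by case/andP: (f01 y).
have W0 y : 0 <= W y by case/andP: (W01 y).
rewrite (@integral_fibers N (fun w => (f \o N) w * W w))//; last 2 first.
- exact: measurable_funM.
- by move=> w; rewrite mulr_ge0 ?f0.
rewrite (@integral_fibers N (f \o N))//; last by move=> w; exact: f0.
rewrite muleC -nneseriesZl//; last first.
  by move=> k _; apply: integral_ge0 => w _; rewrite lee_fin mulr_ge0// ?f0.
apply: eq_eseriesr => k _.
have E (V : T -> R) : (forall w, 0 <= V w) -> measurable_fun setT V ->
  (\int[P]_x (\1_(N @^-1` [set k]) x * (f (N x) * V x))%:E =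
  (f k)%:E * \int[P]_x (\1_(N @^-1` [set k]) x * V x)%:E)%E.
  move=> V0 mV; rewrite -ge0_integralZl//; last 3 first.
  - by apply/measurable_EFinP; apply: measurable_funM => //; exact: measurable_indic.
  - by move=> w _; rewrite lee_fin mulr_ge0.
  - by rewrite lee_fin.
  apply: eq_integral => w _; rewrite -EFinM indicE mulrCA.
  by case: (boolP (w \in _)); rewrite ?mul0r ?mulr0// inE /= => ->.
rewrite /= E// AW//.
transitivity (c%:E * ((f k)%:E * P (N @^-1` [set k])))%E; first by rewrite muleA [RHS]muleC.
congr (_ * _)%E; rewrite -[X in P X]setIT -integral_indic//.
rewrite -[X in (_ * X)%E](_ : \int[P]_x (\1_(N @^-1` [set k]) x * 1)%:E = _)%E; last first.
  by apply: eq_integral => w _; rewrite mulr1.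
by rewrite -(E (cst 1))//; apply: eq_integral => w _; rewrite mulr1.
Qed.

Lemma indic_bigcap_seq (I : choiceType) (s : seq I) (B : I -> set T) w :
  \1_(\bigcap_(i in [set` s]) B i) w = \prod_(i <- s) \1_(B i) w :> R.
Proof.
rewrite bigcap_seq; elim: s => [|i s IH]; first by rewrite !big_nil indicT.
by rewrite !big_cons indicI/= IH.
Qed.

(** Factorization is assumed for the whole list s and not for its sublists, so the families [A i]
    may fail to contain the whole space. Accordingly no factor is ever dropped: each one is an
    indicator or a function. *)
Lemma integral_prod_transfers (I : choiceType) (s : seq I) (A : I -> set (set T))
    (Y : I -> T -> R) (e : I -> R) :
  uniq s -> (forall i B, A i B -> measurable B) ->
  (forall i, transfers (A i) (Y i)) ->
  (forall i, \int[P]_w (Y i w)%:E = (e i)%:E)%E ->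
  (forall B : I -> set T, (forall i, i \in s -> A i (B i)) ->
    P (\bigcap_(i in [set` s]) B i) = (\prod_(i <- s) P (B i))%E) ->
  (\int[P]_w (\prod_(i <- s) Y i w)%:E = (\prod_(i <- s) e i)%:E)%E.
Proof.
move=> us mA trY eY indep.
have e0 i : 0 <= e i.
  by rewrite -lee_fin -eY integral_ge0// => w _; rewrite lee_fin; case: (trY i) => _ /(_ w) /andP[].
have mY i : measurable_fun setT (Y i) by case: (trY i).
have uY i : unit_valued (Y i) by case: (trY i).
(* Functions on s1, indicators on s2. The case of empty s1 is the assumed factorization; the
   induction step turns one indicator into a function, the remaining factors playing the role of the
   weight W, of mean c. *)
suff : forall s1 s2 (B : I -> set T), perm_eq (s1 ++ s2) s ->
  (forall i, i \in s2 -> A i (B i)) ->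
  (\int[P]_w (\prod_(i <- s1) Y i w * \prod_(i <- s2) \1_(B i) w)%:E
   = (\prod_(i <- s1) e i * \prod_(i <- s2) fine (P (B i)))%:E)%E.
  move=> /(_ s [::] (fun=> set0)); rewrite cats0 perm_refl => /(_ isT).
  under eq_integral do rewrite big_nil mulr1.
  by rewrite big_nil mulr1; apply.
elim=> [|i s1 IH] s2 B /=.
  move=> s2s AB; rewrite big_nil mul1r.
  under eq_integral do rewrite big_nil mul1r.
  have s2E i : (i \in s2) = (i \in s) by exact: perm_mem.
  have mB : measurable (\bigcap_(i in [set` s2]) B i).
    by rewrite bigcap_seq big_seq; apply: bigsetI_measurable => i is2; exact/mA/AB.
  transitivity (\int[P]_w (\1_(\bigcap_(i in [set` s2]) B i) w)%:E)%E.
    by apply: eq_integral => w _; rewrite indic_bigcap_seq.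
  rewrite integral_indic// setIT.
  rewrite (_ : [set` s2] = [set` s]); last by apply/seteqP; split => j /=; rewrite s2E.
  transitivity (P (\bigcap_(i in [set` s]) B i)); first by [].
  rewrite indep; last by move=> j; rewrite -s2E; exact: AB.
  rewrite -(perm_big _ s2s)/= -prodEFin.
  by apply: eq_big_seq => j js; rewrite fineK// fin_num_measure//; exact/mA/AB.
move=> s2s AB; rewrite big_cons -mulrA.
pose c := \prod_(j <- s1) e j * \prod_(i <- s2) fine (P (B i)).
case: (trY i) => _ _ /(_ (fun w => \prod_(j <- s1) Y j w * \prod_(i <- s2) \1_(B i) w) c).
rewrite eY -EFinM => <-.
- by apply: eq_integral => w _; rewrite big_cons mulrA.
- apply: measurable_funM; first exact: measurable_prod.
  rewrite (_ : (fun x => _) = \1_(\bigcap_(j in [set` s2]) B j)); last first.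
    by apply/funext => x; rewrite indic_bigcap_seq.
  apply: measurable_indic; rewrite bigcap_seq big_seq.
  by apply: bigsetI_measurable => j js; exact/mA/AB.
- move=> w.
  have /andP[? ?] := prod01 s1 (fun i => uY i w).
  have /andP[? ?] := prod01 s2 (fun i => indic_unit (B i) w).
  by rewrite mulr_ge0// mulr_ile1.
- by rewrite /c mulr_ge0// prodr_ge0// => j _; rewrite fine_ge0.
move=> C AC.
(* Since s has no repetition, inserting the test event C at i leaves the events of s2 unchanged, and
   the induction hypothesis applies with i moved to s2. *)
pose B' j := if j == i then C else B j.
have us' : uniq (i :: s1 ++ s2) by rewrite (perm_uniq s2s).
have B'i j : j \in s2 -> B' j = B j.
  move=> js; rewrite /B'; case: eqP => // ji; move: us' => /= /andP[].
  by rewrite mem_cat -ji js orbT.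
have B'ii : B' i = C by rewrite /B' eqxx.
have pe : perm_eq (s1 ++ (i :: s2)) s.
  by rewrite (perm_trans _ s2s)// perm_catC /= perm_cons perm_catC.
have AB' j : j \in i :: s2 -> A j (B' j).
  by rewrite inE => /predU1P[->|js]; [rewrite B'ii|rewrite B'i//; exact: AB].
have IHC := IH _ _ pe AB'.
transitivity (\int[P]_x (\prod_(j <- s1) Y j x * \prod_(j <- (i :: s2)) \1_(B' j) x)%:E)%E.
  apply: eq_integral => w _; rewrite big_cons B'ii mulrCA; congr (_ * (_ * _))%:E.
  by apply: eq_big_seq => j /B'i ->.
rewrite IHC big_cons B'ii -[P C]fineK ?fin_num_measure//; last exact: mA AC.
rewrite -EFinM mulrCA /c; congr (_ * (_ * _))%:E.
by apply: eq_big_seq => j /B'i ->.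
Qed.

End independence.

(** * Spherical geometry *)

Section geometry.
Context {R : realType}.
Implicit Types (Rs rho r t p a b : R) (x y : point R).

Lemma measurable_edist_sat Rs :
  measurable_fun setT (fun x : point R => edist x (sat Rs)).
Proof.
have m11 : measurable_fun setT (fun x : point R => x.1.1).
  by apply: measurableT_comp; exact: measurable_fst.
have m12 : measurable_fun setT (fun x : point R => x.1.2).
  by apply: measurableT_comp; [exact: measurable_snd|exact: measurable_fst].
have m2 : measurable_fun setT (fun x : point R => x.2) by exact: measurable_snd.
rewrite /edist /enorm /dot /sat /=.
apply: measurableT_comp => /=; first exact: measurable_sqrt.
by repeat (apply: measurable_funD || apply: measurable_funM || apply: measurable_funB) => //=;
  apply: measurable_funB.
Qed.

Lemma edist_ge0 x y : 0 <= edist x y.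
Proof. exact: sqrtr_ge0. Qed.

Lemma dot_edist Rs rho x : enorm x = rho ->
  edist x (sat Rs) ^+ 2 = rho ^+ 2 + Rs ^+ 2 - 2 * Rs * x.2.
Proof.
have dge y : 0 <= dot y y by rewrite /dot -!expr2 !addr_ge0 ?sqr_ge0.
move=> <-; rewrite /edist /enorm !sqr_sqrtr// /dot /sat/=; ring.
Qed.

Lemma sat_coord_bound rho x : enorm x = rho -> `|x.2| <= rho.
Proof.
move=> <-; rewrite /enorm -(sqrtr_sqr x.2) ler_wsqrtr// /dot -!expr2.
by rewrite lerDr addr_ge0 ?sqr_ge0.
Qed.

Lemma edist_ge_Rmin Rs rho x : 0 < Rs -> rho < Rs -> enorm x = rho ->
  Rmin Rs rho <= edist x (sat Rs).
Proof.
move=> Rs0 rhoRs xr; have /ler_normlP[_ x2] := sat_coord_bound xr.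
rewrite /Rmin -(ler_pXn2r (n:=2))// ?nnegrE ?edist_ge0//; last by lra.
rewrite (dot_edist Rs xr); nra.
Qed.

Lemma enorm_spherical rho t p : 0 <= rho -> enorm (spherical rho t p) = rho.
Proof.
move=> rho0; rewrite /enorm /dot /spherical/=.
rewrite (_ : _ + _ + _ = rho ^+ 2 * ((cos p ^+ 2 + sin p ^+ 2) * sin t ^+ 2 + cos t ^+ 2)); last by ring.
by rewrite cos2Dsin2 mul1r addrC cos2Dsin2 mulr1 sqrtr_sqr ger0_norm.
Qed.

Lemma edist_spherical_le Rs rho t p r : 0 < rho -> 0 < Rs -> 0 <= r ->
  (edist (spherical rho t p) (sat Rs) <= r) =
  ((rho ^+ 2 + Rs ^+ 2 - r ^+ 2) / (2 * rho * Rs) <= cos t).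
Proof.
move=> rho0 Rs0 r0.
rewrite -(ler_pXn2r (n:=2))// ?nnegrE ?edist_ge0//.
rewrite (dot_edist Rs (enorm_spherical t p (ltW rho0)))/=.
rewrite ler_pdivrMr ?mulr_gt0//; apply/idP/idP; nra.
Qed.

Lemma measurable_sin : measurable_fun setT (@sin R).
Proof. by apply: continuous_measurable_fun; exact: continuous_sin. Qed.

Lemma integral_sin a b : a <= b ->
  (\int[@lebesgue_measure R]_(t in `]a, b]) (sin t)%:E = (cos a - cos b)%:E)%E.
Proof.
rewrite le_eqVlt => /predU1P[->|ab].
  by rewrite set_itvoc0 integral_set0 subrr.
rewrite integral_itv_obnd_cbnd; last first.
  by apply/measurable_EFinP/measurable_funTS; exact: measurable_sin.
rewrite (@continuous_FTC2 _ _ (fun t => - cos t))//.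
- by rewrite -EFinB opprK addrC.
- by apply: continuous_subspaceT => t; exact: continuous_sin.
- split => [t _| |].
  + exact: derivableN.
  + by apply: cvg_at_right_filter; apply: cvgN; exact: continuous_cos.
  + by apply: cvg_at_left_filter; apply: cvgN; exact: continuous_cos.
- by move=> t _; rewrite derive1E deriveN// derive_val opprK.
Qed.

(** The pole t = 0 is a null set; excluding it lets the set of points at minimal distance, which is
    the pole alone, be treated as the empty zone a = b = 0. *)
Lemma sphere_area_zone rho (B : set (point R)) a b :
  0 <= a -> a <= b -> b <= pi ->
  (forall t p, 0 < t <= pi -> B (spherical rho t p) <-> a < t <= b) ->
  sphere_area rho B = (2 * pi * (rho ^+ 2 * (cos a - cos b)))%:E.
Proof.
move=> a0 ab bpi BE; rewrite /sphere_area.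
transitivity (\int[@lebesgue_measure R]_(p in `[0%R, (2 * pi)%R])
   (rho ^+ 2 * (cos a - cos b))%:E)%E; last first.
  rewrite integral_cst//= lebesgue_measure_itv/= lte_fin ifT ?mulr_gt0 ?pi_gt0//.
  by rewrite -EFinD -EFinM subr0 mulrC.
apply: eq_integral => p _.
have E t : t \in `]0%R, pi]%classic ->
    (\1_B (spherical rho t p) * (rho ^+ 2 * sin t))%:E =
    (\1_(`]a, b]%classic : set R) t * (rho ^+ 2 * sin t))%:E.
  rewrite inE/= in_itv/= => /(BE t p) tB; congr (_ * _)%:E.
  rewrite !indicE; congr ((nat_of_bool _)%:R); apply/idP/idP; rewrite !inE/= in_itv/=.
  - by move/tB.
  - by move=> h; apply/tB.
have mf : measurable_fun setT (fun t : R => (\1_(`]a, b]%classic : set R) t * (rho ^+ 2 * sin t))%:E).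
  apply/measurable_EFinP; apply: measurable_funM; first exact: measurable_indic.
  by apply: measurable_funM => //; exact: measurable_sin.
rewrite -integral_itv_obnd_cbnd; last first.
  apply: (eq_measurable_fun (fun t : R => (\1_(`]a, b]%classic : set R) t * (rho ^+ 2 * sin t))%:E)).
    by move=> t tI; rewrite E.
  exact: measurable_funTS.
transitivity (\int[@lebesgue_measure R]_(t in `]0%R, pi])
    (\1_(`]a, b]%classic : set R) t * (rho ^+ 2 * sin t))%:E)%E.
  by apply: eq_integral => t /E.
transitivity (\int[@lebesgue_measure R]_(t in `]a, b]) ((rho ^+ 2)%:E * (sin t)%:E))%E.
  rewrite [LHS]integral_mkcond [RHS]integral_mkcond; apply: eq_integral => t _.
  rewrite !patchE indicE; case: (boolP (t \in `]a, b]%classic)) => tab.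
    rewrite mem_set ?mul1r ?EFinM//=.
    move: tab; rewrite inE/= !in_itv/= => /andP[at_ tb].
    by rewrite (le_lt_trans a0 at_) (le_trans tb bpi).
  by rewrite mul0r; case: ifPn.
rewrite ge0_integralZl//=.
- by rewrite integral_sin.
- by apply/measurable_EFinP/measurable_funTS; exact: measurable_sin.
- move=> t; rewrite in_itv/= => /andP[at_ tb]; rewrite lee_fin sin_ge0_pi//.
  by rewrite (le_trans a0 (ltW at_)) (le_trans tb bpi).
- by rewrite lee_fin sqr_ge0.
Qed.

(** Cosine of the polar angle of the points of the sphere at distance r from the satellite, by the
    law of cosines. *)
Let C Rs rho r := (rho ^+ 2 + Rs ^+ 2 - r ^+ 2) / (2 * rho * Rs).

Lemma C_itv Rs rho r : 0 < rho -> rho < Rs -> Rmin Rs rho <= r <= Rs + rho ->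
  C Rs rho r \in `[(-1), 1].
Proof.
move=> rho0 rhoRs; rewrite /Rmin => /andP[r1 r2]; have Rs0 : 0 < Rs by lra.
rewrite in_itv/= /C ler_pdivlMr ?ler_pdivrMr ?mulr_gt0//; apply/andP; split; nra.
Qed.

Lemma edist_spherical_le_acos Rs rho t p r : 0 < rho -> rho < Rs ->
  Rmin Rs rho <= r <= Rs + rho -> 0 <= t <= pi ->
  (edist (spherical rho t p) (sat Rs) <= r) = (t <= acos (C Rs rho r)).
Proof.
move=> rho0 rhoRs rI tI; have Rs0 : 0 < Rs by lra.
have CI := C_itv rho0 rhoRs rI.
have CI' : -1 <= C Rs rho r <= 1 by move: CI; rewrite in_itv.
rewrite edist_spherical_le//; last by case/andP: rI; rewrite /Rmin; lra.
rewrite -/(C Rs rho r) -[C Rs rho r in LHS](acosK CI).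
by rewrite leNgt ltr_cos ?in_itv//= ?acos_ge0 ?acos_lepi// -leNgt.
Qed.

(** By Archimedes the area of a zone is linear in the cosine of the polar angle, and this cosine is
    affine in the squared distance. *)
Lemma sphere_area_ring Rs rho a b : 0 < rho -> rho < Rs ->
  Rmin Rs rho <= a -> a <= b -> b <= Rs + rho ->
  sphere_area rho [set x | a < edist x (sat Rs) <= b] =
  (pi * (rho / Rs) * (b ^+ 2 - a ^+ 2))%:E.
Proof.
move=> rho0 rhoRs la ab br; have Rs0 : 0 < Rs by lra.
have aI : Rmin Rs rho <= a <= Rs + rho by rewrite la (le_trans ab br).
have bI : Rmin Rs rho <= b <= Rs + rho by rewrite br (le_trans la ab).
have := C_itv rho0 rhoRs aI; have := C_itv rho0 rhoRs bI; rewrite !in_itv/= => CbI CaI.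
have ac : acos (C Rs rho a) <= acos (C Rs rho b).
  rewrite leNgt -(@ltr_cos R) ?in_itv/= ?acos_ge0 ?acos_lepi// !acosK ?in_itv//= -leNgt.
  rewrite /C ler_pM2r ?invr_gt0 ?mulr_gt0//.
  move: la; rewrite /Rmin => la; nra.
rewrite (@sphere_area_zone rho _ (acos (C Rs rho a)) (acos (C Rs rho b))) ?acos_ge0 ?acos_lepi//.
  by rewrite !acosK ?in_itv//= /C; congr EFin; field; rewrite !gt_eqF.
move=> t p /andP[t0 tpi].
have tI : 0 <= t <= pi by rewrite tpi ltW.
by rewrite /= (edist_spherical_le_acos p _ _ bI)// ltNge (edist_spherical_le_acos p _ _ aI)// -ltNge.
Qed.

Lemma sphere_area_Rmin Rs rho : 0 < rho -> rho < Rs ->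
  sphere_area rho [set x | edist x (sat Rs) <= Rmin Rs rho] = 0%E.
Proof.
move=> rho0 rhoRs; have Rs0 : 0 < Rs by lra.
rewrite (@sphere_area_zone rho _ 0 0) ?pi_ge0//; first by rewrite subrr !mulr0.
move=> t p /andP[t0 tpi].
have tI : 0 <= t <= pi by rewrite tpi ltW.
have rI : Rmin Rs rho <= Rmin Rs rho <= Rs + rho by rewrite /Rmin; lra.
rewrite /= (edist_spherical_le_acos p _ _ rI)// (_ : C _ _ _ = 1) ?acos1.
  by split => [|/andP[]]; rewrite leNgt t0.
by rewrite /C /Rmin; field; rewrite !gt_eqF.
Qed.

Lemma Rmin_lt_Rmax Rs theta rho : 0 < Rs -> rho < Rs ->
  0 < theta < pi / 2 -> Rs * sin theta <= rho ->
  Rmin Rs rho < Rmax Rs theta rho.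
Proof.
move=> Rs0 rhoRs /andP[th0 thpi] thrho.
have s0 : 0 < sin theta by rewrite sin_gt0_pihalf// th0.
have c0 : 0 < cos theta.
  rewrite cos_gt0_pihalf// thpi andbT (lt_trans _ th0)// oppr_lt0 divr_gt0 ?pi_gt0//.
have sc := cos2Dsin2 theta.
have c1 : cos theta < 1 by nra.
have sc1 : 1 < sin theta + cos theta by nra.
rewrite /Rmin /Rmax.
suff : Num.sqrt (rho ^+ 2 - Rs ^+ 2 * sin theta ^+ 2) < rho - Rs * (1 - cos theta) by lra.
(* Follows from [Rs * sin theta <= rho] and [1 < sin theta + cos theta]; this sign permits comparing
   the square root through squares. *)
have h0 : 0 < rho - Rs * (1 - cos theta) by nra.
rewrite -(ger0_norm (ltW h0)) -sqrtr_sqr ltr_sqrt ?exprn_gt0//.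
(* Twice this product is the difference of the two squares. *)
have : 0 < Rs * (1 - cos theta) * (Rs - rho) by rewrite !mulr_gt0// subr_gt0.
rewrite sin2cos2; nra.
Qed.

Lemma Rmax_le Rs theta rho : 0 < Rs -> 0 < rho -> Rmax Rs theta rho <= Rs + rho.
Proof.
move=> Rs0 rho0; rewrite /Rmax.
have := sqrtr_ge0 (rho ^+ 2 - Rs ^+ 2 * sin theta ^+ 2).
have := cos_le1 theta; nra.
Qed.

(** [Rpsi] is the positive root of this quadratic, which expresses the law of cosines in the
    triangle of centre, station and satellite, with angle pi / 2 + psi at the station. *)
Lemma lt_Rpsi Rs rho psi v : 0 < rho -> rho < Rs -> 0 <= sin psi -> 0 < v ->
  (v < Rpsi Rs rho psi) = (v ^+ 2 + 2 * rho * v * sin psi + rho ^+ 2 - Rs ^+ 2 < 0).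
Proof.
move=> rho0 rhoRs s0 v0; rewrite /Rpsi ltrBrDr cos2sin2.
have h : 0 <= v + rho * sin psi by rewrite addr_ge0 ?mulr_ge0// ltW.
have X0 : 0 < Rs ^+ 2 - rho ^+ 2 * (1 - sin psi ^+ 2) by nra.
rewrite -{1}(ger0_norm h) -sqrtr_sqr ltr_sqrt//; apply/idP/idP; nra.
Qed.

Lemma le_Rpsi Rs rho psi v : 0 < rho -> rho < Rs -> 0 <= sin psi -> 0 < v ->
  (v <= Rpsi Rs rho psi) = (v ^+ 2 + 2 * rho * v * sin psi + rho ^+ 2 - Rs ^+ 2 <= 0).
Proof.
move=> rho0 rhoRs s0 v0; rewrite /Rpsi lerBrDr cos2sin2.
have h : 0 <= v + rho * sin psi by rewrite addr_ge0 ?mulr_ge0// ltW.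
have X0 : 0 < Rs ^+ 2 - rho ^+ 2 * (1 - sin psi ^+ 2) by nra.
rewrite -{1}(ger0_norm h) -sqrtr_sqr ler_psqrt ?nnegrE ?sqr_ge0 ?(ltW X0)//; apply/idP/idP; nra.
Qed.

Lemma Rmin_le_Rpsi Rs rho psi : 0 < rho -> rho < Rs -> 0 <= sin psi ->
  Rmin Rs rho <= Rpsi Rs rho psi.
Proof.
move=> rho0 rhoRs s0; rewrite le_Rpsi// /Rmin; last by lra.
have : 0 <= rho * (Rs - rho) * (1 - sin psi).
  by rewrite !mulr_ge0 ?subr_ge0 ?sin_le1// ltW.
nra.
Qed.

(** The quadratic of [le_Rpsi] increases with the sine, so its positive root decreases. *)
Lemma le_Rpsi_sin Rs rho psi1 psi2 : 0 < rho -> rho < Rs -> 0 <= sin psi1 ->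
  sin psi1 <= sin psi2 -> Rpsi Rs rho psi2 <= Rpsi Rs rho psi1.
Proof.
move=> rho0 rhoRs s1 s12; have s2 := le_trans s1 s12.
have v0 : 0 < Rpsi Rs rho psi2.
  by apply: lt_le_trans (Rmin_le_Rpsi rho0 rhoRs s2); rewrite /Rmin; lra.
have h2 := lexx (Rpsi Rs rho psi2); rewrite [X in is_true X]le_Rpsi// in h2.
rewrite le_Rpsi//; have : 0 <= rho * Rpsi Rs rho psi2 * (sin psi2 - sin psi1).
  by rewrite mulr_ge0 ?subr_ge0// mulr_ge0// ltW.
nra.
Qed.

(** By the law of sines, this is the elevation at which a station on the edge of the visible cap
    sees the satellite. It links the condition on the elevation thresholds to visibility. *)
Lemma Rpsi_acos Rs theta rho : 0 < rho -> 0 < Rs -> 0 <= cos theta ->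
  0 <= sin theta -> Rs * sin theta <= rho ->
  Rpsi Rs rho (acos (Rs / rho * sin theta)) = Rmax Rs theta rho.
Proof.
move=> rho0 Rs0 c0 s0 srho.
have q0 : 0 <= Rs / rho * sin theta by rewrite mulr_ge0// divr_ge0// ltW.
have q1 : Rs / rho * sin theta <= 1 by rewrite mulrAC ler_pdivrMr// mul1r.
have qI : -1 <= Rs / rho * sin theta <= 1 by rewrite q1 andbT (le_trans _ q0)// lerN10.
rewrite /Rpsi /Rmax acosK ?in_itv// sin_acos//; congr (_ - _).
  rewrite (_ : _ - _ = (Rs * cos theta) ^+ 2) ?sqrtr_sqr ?ger0_norm ?mulr_ge0 ?(ltW Rs0)//.
  by rewrite [in RHS]exprMn cos2sin2; field; rewrite gt_eqF.
rewrite -{1}(ger0_norm (ltW rho0)) -sqrtr_sqr -sqrtrM ?sqr_ge0//.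
by congr Num.sqrt; field; rewrite gt_eqF.
Qed.

(** The bounds on S are triangle inequalities; they are recorded because [asin] is a right inverse
    of [sin] only on [-1, 1]. *)
Lemma sin_elevation Rs rho x (v := edist x (sat Rs)) :
  0 < rho -> rho < Rs -> enorm x = rho -> 0 < v ->
  let S := (Rs ^+ 2 - rho ^+ 2 - v ^+ 2) / (2 * rho * v) in
  elevation x (sat Rs) = asin S /\ -1 <= S <= 1.
Proof.
move=> rho0 rhoRs xr v0 S; split.
  have vE := dot_edist Rs xr.
  rewrite /elevation; congr asin.
  have -> : enorm (sat Rs - x) = v.
    by rewrite /v /edist /enorm /dot /=; congr Num.sqrt; ring.
  have rE : dot x x = rho ^+ 2.
    by rewrite -xr /enorm sqr_sqrtr// /dot -!expr2 !addr_ge0 ?sqr_ge0.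
  have -> : dot x (sat Rs - x) = (Rs ^+ 2 - rho ^+ 2 - v ^+ 2) / 2.
    by rewrite /v vE -rE /dot /sat/=; field.
  by rewrite xr /S; field; rewrite !gt_eqF.
have vE := dot_edist Rs xr.
have /ler_normlP[x2 x2'] := sat_coord_bound xr.
have v1 : Rs - rho <= v by exact: edist_ge_Rmin (lt_trans rho0 rhoRs) rhoRs xr.
have v2 : v <= Rs + rho.
  rewrite -(ler_pXn2r (n:=2))// ?nnegrE ?(ltW v0)//; last by lra.
  rewrite vE; nra.
rewrite /S ler_pdivlMr ?ler_pdivrMr ?mulr_gt0//; apply/andP; split; nra.
Qed.

Lemma lt_elevation Rs rho psi x (v := edist x (sat Rs)) :
  0 < rho -> rho < Rs -> 0 <= psi <= pi / 2 -> enorm x = rho -> 0 < v ->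
  (psi < elevation x (sat Rs)) = (v < Rpsi Rs rho psi).
Proof.
move=> rho0 rhoRs /andP[p0 ppi] xr v0; have [-> SI] := sin_elevation rho0 rhoRs xr v0.
rewrite -/v in SI *; set S := _ / _ in SI *.
have pi0 := pi_gt0 R.
have s0 : 0 <= sin psi by apply: sin_ge0_pi; lra.
rewrite -[LHS](@ltr_sin R); last 2 first.
- by rewrite in_itv/= ppi andbT; lra.
- by rewrite in_itv/= asin_geNpi2// asin_lepi2.
rewrite asinK ?in_itv// lt_Rpsi// /S ltr_pdivlMr ?mulr_gt0//; apply/idP/idP; nra.
Qed.

(** The strict form decides the gain at the threshold [psi2]; the weak one is for visibility, since
    the visible cap contains its edge. *)
Lemma le_elevation Rs rho psi x (v := edist x (sat Rs)) :
  0 < rho -> rho < Rs -> 0 <= psi <= pi / 2 -> enorm x = rho -> 0 < v ->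
  (psi <= elevation x (sat Rs)) = (v <= Rpsi Rs rho psi).
Proof.
move=> rho0 rhoRs /andP[p0 ppi] xr v0; have [-> SI] := sin_elevation rho0 rhoRs xr v0.
rewrite -/v in SI *; set S := _ / _ in SI *.
have pi0 := pi_gt0 R.
have s0 : 0 <= sin psi by apply: sin_ge0_pi; lra.
rewrite leNgt -[X in ~~ X = _](@ltr_sin R); last 2 first.
- by rewrite in_itv/= asin_geNpi2// asin_lepi2.
- by rewrite in_itv/= ppi andbT; lra.
rewrite -leNgt asinK ?in_itv// le_Rpsi// /S ler_pdivlMr ?mulr_gt0//; apply/idP/idP; nra.
Qed.

End geometry.

(** * The Shadowed-Rician law *)

Section special_functions.
Context {R : realType}.
Implicit Types (x u g : R) (z n m k : nat).

Lemma cvg_exprn_expRN n : u ^+ n * expR (- u) @[u --> +oo%R] --> (0 : R).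
Proof.
apply/cvgrPdist_le => e e0; near=> u.
have u0 : 0 < u by near: u; exact: nbhs_pinfty_gt.
rewrite sub0r normrN ger0_norm; last by rewrite mulr_ge0 ?exprn_ge0 ?expR_ge0 ?ltW.
have fact0 : 0 < (n.+1)`!%:R :> R by rewrite ltr0n fact_gt0.
have h := expR_ge1Dxn n (ltW u0).
have h2 : u ^+ n.+1 / n.+1`!%:R <= expR u by rewrite (le_trans _ h)// lerDr.
rewrite expRN ler_pdivrMr ?expR_gt0//.
have ue : n.+1`!%:R / e <= u by near: u; apply: nbhs_pinfty_ge; rewrite num_real.
apply: (@le_trans _ _ (e * (u ^+ n.+1 / n.+1`!%:R))); last by rewrite ler_pM2l.
rewrite exprS (_ : e * _ = (u * e / n.+1`!%:R) * u ^+ n); last by ring.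
rewrite ler_peMl ?exprn_ge0 ?(ltW u0)//.
by rewrite ler_pdivlMr// mul1r -ler_pdivrMr.
Unshelve. all: by end_near. Qed.

Lemma cvg_sumr (I : Type) (s : seq I) (T : Type) (F : set_system T) {FF : Filter F}
    (f : I -> T -> R) (l : I -> R) :
  (forall i, f i t @[t --> F] --> l i) ->
  \sum_(i <- s) f i t @[t --> F] --> \sum_(i <- s) l i.
Proof.
move=> fl; elim: s => [|i s IH].
  by rewrite big_nil; under eq_fun do rewrite big_nil; exact: cvg_cst.
by rewrite big_cons; under eq_fun do rewrite big_cons; exact: cvgD.
Qed.

Lemma is_derive_exprn n u : is_derive u 1 (fun u => u ^+ n) (n%:R * u ^+ n.-1).
Proof.
rewrite (_ : (fun u => u ^+ n) = (id : R -> R) ^+ n); last by rewrite exprfctE.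
apply: (is_derive_eq (@is_deriveX _ _ id n u 1 1 (is_derive_id _ _))).
by change (n%:R * u ^+ n.-1 * 1 = n%:R * u ^+ n.-1); rewrite mulr1.
Qed.

(* z`! times this is the tail integral of t^z e^(-t) beyond u. *)
Definition expR_tail z u : R := \sum_(j < z.+1) (u ^+ j / j`!%:R * expR (- u)).

Lemma expR_tail0 z : expR_tail z 0 = 1.
Proof.
rewrite /expR_tail big_ord_recl/= oppr0 expR0 expr0 fact0 !mul1r invr1 mulr1.
by rewrite big1 ?addr0// => j _; rewrite expr0n/= !mul0r.
Qed.

Lemma cvg_expR_tail z : expR_tail z u @[u --> +oo%R] --> (0 : R).
Proof.
rewrite /expR_tail.
have H (j : 'I_z.+1) : (u ^+ j / j`!%:R * expR (- u)) @[u --> +oo%R] --> (0 : R).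
  rewrite (_ : (fun _ => _) = (fun u => (j`!%:R)^-1 * (u ^+ j * expR (- u)))).
    rewrite -[X in _ --> X](mulr0 (j`!%:R)^-1).
    by apply: cvgM; [exact: cvg_cst|exact: cvg_exprn_expRN].
  by apply/funext => u; rewrite mulrAC mulrC.
have := @cvg_sumr _ (index_enum 'I_z.+1) _ _ _ _ _ H; rewrite big1//; exact.
Qed.

(** Differentiation telescopes: the derivative of each power cancels the preceding term of the
    sum. *)
Lemma is_derive_expR_tail z u :
  is_derive u 1 (expR_tail z) (- (u ^+ z / z`!%:R * expR (- u))).
Proof.
have dN : is_derive u 1 (fun u => expR (- u)) (- expR (- u)).
  have := @is_derive1_comp _ expR (-%R) u _ (-1) (is_derive_expR (- u)) _.
  by rewrite mulrN1; apply; apply: is_deriveN.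
elim: z => [|z IH].
  have -> : expR_tail 0 = (fun u => expR (- u)).
    apply/funext => v; rewrite /expR_tail big_ord_recl big_ord0 addr0.
    by rewrite expr0 fact0 invr1 !mul1r.
  by rewrite expr0 fact0 invr1 !mul1r.
have -> : expR_tail z.+1 = expR_tail z \+ (fun u => (z.+1)`!%:R^-1 * (u ^+ z.+1 * expR (- u))).
  apply/funext => v; rewrite /expR_tail big_ord_recr/=; congr (_ + _); ring.
have dX : is_derive u 1 (fun u => u ^+ z.+1) (z.+1%:R * u ^+ z).
  exact: is_derive_exprn.
have dM := is_deriveM dX dN.
have dZ := is_deriveZ (z.+1)`!%:R^-1 dM.
have := is_deriveD IH dZ.
set A := (X in is_derive _ _ _ X -> _); suff -> : A = - (u ^+ z.+1 / (z.+1)`!%:R * expR (- u)) by [].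
rewrite /A /GRing.scale/= factS natrM; field.
by rewrite pnatr_eq0 -lt0n fact_gt0/= nat1r pnatr_eq0.
Qed.

Lemma continuous_exprM_expRN n g m : continuous (fun x => x ^+ n * expR (- (g * x ^+ m))).
Proof.
move=> x; apply: cvgM; first exact: exprn_continuous.
apply: (@continuous_comp _ _ _ (fun x => - (g * x ^+ m)) expR); last exact: continuous_expR.
by apply: cvgN; apply: cvgM; [exact: cvg_cst|exact: exprn_continuous].
Qed.

Lemma integral_exp_moment z : Gamma (z%:R + 1) = z`!%:R :> R.
Proof.
rewrite /Gamma.
transitivity (\int[@lebesgue_measure R]_(t in `]0%R, +oo[) (t ^+ z * expR (- (1 * t ^+ 1)))).
  apply: eq_Rintegral => t; rewrite inE/= in_itv/= andbT => t0.
  by rewrite addrK powR_mulrn ?(ltW t0)// expr1 mul1r.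
rewrite /Rintegral integral_itv_obnd_cbnd; last first.
  apply/measurable_EFinP; apply: measurable_funTS; apply: continuous_measurable_fun.
  exact: continuous_exprM_expRN.
have dE (t : R) : is_derive t 1 (fun t => - z`!%:R * expR_tail z t) (t ^+ z * expR (- (1 * t ^+ 1))).
  have := is_deriveZ (- z`!%:R) (is_derive_expR_tail z t).
  rewrite /GRing.scale/= mulrNN mulrA [z`!%:R * _]mulrC divfK ?pnatr_eq0 -?lt0n ?fact_gt0//.
  by rewrite expr1 mul1r.
rewrite (@ge0_continuous_FTC2y _ _ (fun t => - z`!%:R * expR_tail z t) 0 0).
- by rewrite expR_tail0 mulr1 sub0e -EFinN opprK.
- by move=> x x0; rewrite mulr_ge0 ?exprn_ge0 ?expR_ge0.
- by apply: continuous_subspaceT; exact: continuous_exprM_expRN.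
- rewrite -[X in _ --> X](mulr0 (- z`!%:R)); apply: cvgM; first exact: cvg_cst.
  exact: cvg_expR_tail.
- by move=> x _; have [] := dE x.
- apply: cvg_at_right_filter.
  by have [/derivable1_diffP/differentiable_continuous + _] := dE 0; exact.
- by move=> x _; rewrite derive1E; have [] := dE x.
Qed.

Lemma integral_gauss_moment z g : 0 < g ->
  (\int[@lebesgue_measure R]_(x in `]0%R, +oo[) (x ^+ z.*2.+1 * expR (- (g * x ^+ 2)))%:E
   = (z`!%:R / (2 * g ^+ z.+1))%:E)%E.
Proof.
move=> g0; rewrite integral_itv_obnd_cbnd; last first.
  apply/measurable_EFinP; apply: measurable_funTS; apply: continuous_measurable_fun.
  exact: continuous_exprM_expRN.
(* The substitution t = g x^2 reduces the integrand to t^z e^(-t), whose primitives involve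
   [expR_tail]. With this C the primitive vanishes at infinity and equals minus the total integral
   at 0. *)
pose C : R := - (z`!%:R / (2 * g ^+ z.+1)).
have f0 : z`!%:R != 0 :> R by rewrite pnatr_eq0 -lt0n fact_gt0.
have dX (t : R) : is_derive t 1 (fun x => g * x ^+ 2) (g * (2 * t)).
  apply: (is_derive_eq (is_deriveZ g (is_derive_exprn 2 t))).
  by change (g * (2 * t ^+ 1) = g * (2 * t)); rewrite expr1.
have dE (t : R) : is_derive t 1 (fun t => C * expR_tail z (g * t ^+ 2)) (t ^+ z.*2.+1 * expR (- (g * t ^+ 2))).
  have dc := @is_derive1_comp _ (expR_tail z) (fun x => g * x ^+ 2) t _ _ (is_derive_expR_tail z _) (dX t).
  have := is_deriveZ C dc.
  set A := (X in is_derive _ _ _ X -> _); suff -> : A = t ^+ z.*2.+1 * expR (- (g * t ^+ 2)) by [].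
  rewrite /A /GRing.scale/= /C exprMn -exprM mul2n; set e := expR _.
  by rewrite !exprS; field; rewrite f0 expf_neq0 gt_eqF.
rewrite (@ge0_continuous_FTC2y _ _ (fun t => C * expR_tail z (g * t ^+ 2)) 0 0).
- by rewrite expr0n/= mulr0 expR_tail0 mulr1 -EFinB sub0r opprK.
- by move=> x x0; rewrite mulr_ge0 ?exprn_ge0 ?expR_ge0.
- by apply: continuous_subspaceT; exact: continuous_exprM_expRN.
- rewrite -[X in _ --> X](mulr0 C); apply: cvgM; first exact: cvg_cst.
  have h : (fun t => g * t ^+ 2) @ +oo%R --> +oo%R.
    apply/cvgryPge => M; near=> t.
    have t1 : 1 <= t by near: t; apply: nbhs_pinfty_ge; rewrite num_real.
    have tM : M / g <= t by near: t; apply: nbhs_pinfty_ge; rewrite num_real.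
    rewrite mulrC -ler_pdivrMr// (le_trans tM)// expr2 ler_peMl// (le_trans _ t1)//.
  exact: (cvg_comp _ _ h (cvg_expR_tail z)).
- by move=> x _; have [] := dE x.
- apply: cvg_at_right_filter.
  by have [/derivable1_diffP/differentiable_continuous + _] := dE 0; exact.
- by move=> x _; rewrite derive1E; have [] := dE x.
Unshelve. all: by end_near. Qed.

Lemma pochhammer_nat k n : pochhammer (k.+1%:R : R) n = ('C(k + n, n) * n`!)%:R.
Proof.
rewrite bin_ffact /pochhammer.
elim: n => [|n IH]; first by rewrite big_ord0 ffactn0.
rewrite big_ord_recr/= IH addnS ffactnS/= natrM mulrC -natrD; congr (_%:R * _).
Qed.

(** The signs cancel against the factors - k + i and leave a falling factorial, zero beyond k. The
    alternating formula for [SR_zeta] thereby becomes a binomial one, visibly positive up to k. *)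
Lemma pochhammerN_nat k n : (-1) ^+ n * pochhammer (1 - k.+1%:R : R) n = ('C(k, n) * n`!)%:R.
Proof.
rewrite bin_ffact /pochhammer.
elim: n => [|n IH]; first by rewrite big_ord0 ffactn0 mul1r.
rewrite big_ord_recr/= ffactnSr natrM -IH exprS.
have [nk|kn] := leqP n k; first by rewrite natrB// -natr1; ring.
have E : (-1) ^+ n * \prod_(i < n) (1 - k.+1%:R + i%:R) = 0 :> R.
  by rewrite IH ffact_small.
rewrite E mul0r.
rewrite (_ : _ * _ = - (1 - k.+1%:R + n%:R) * ((-1) ^+ n * \prod_(i < n) (1 - k.+1%:R + i%:R))); last by ring.
by rewrite E mulr0.
Qed.

(** The first j terms vanish, and C(n, j) / n! = 1 / (j! (n - j)!) makes the others a shifted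
    exponential series. *)
Lemma cvg_binomial_exp j x :
  series (fun n => 'C(n, j)%:R * (x ^+ n / n`!%:R)) @ \oo --> (x ^+ j / j`!%:R * expR x : R).
Proof.
rewrite -(cvg_shiftn j).
have E n : series (fun n => 'C(n, j)%:R * (x ^+ n / n`!%:R)) (n + j)%N =
     x ^+ j / j`!%:R * series (exp_coeff x) n.
  rewrite /series/= addnC big_mkord big_split_ord/= big1 ?add0r; last first.
    by move=> i _; rewrite bin_small// mul0r.
  rewrite mulr_sumr big_mkord; apply: eq_bigr => i _.
  rewrite exp_coeffE.
  have -> : (x ^+ (j + i) / (j + i)`!%:R) = x ^+ j * x ^+ i / (j + i)`!%:R by rewrite exprD.
  have := @bin_fact (j + i) j (leq_addr _ _); rewrite addKn => /(congr1 (fun n => n%:R : R)).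
  rewrite !natrM => <-; field.
  by rewrite !pnatr_eq0 -!lt0n !fact_gt0 bin_gt0 leq_addr.
under eq_fun do rewrite E.
by apply: cvgM; [exact: cvg_cst|exact: is_cvg_series_exp_coeff].
Qed.

(* Kummer's transformation; coefficientwise it is Vandermonde's identity. *)
Lemma hyp1F1_kummer k x :
  hyp1F1 (k.+1%:R : R) 1 x = (\sum_(j < k.+1) 'C(k, j)%:R * (x ^+ j / j`!%:R)) * expR x.
Proof.
rewrite /hyp1F1; apply/cvg_lim => //.
have E n : pochhammer (k.+1%:R : R) n / pochhammer 1 n * (x ^+ n / n`!%:R) =
   \sum_(j < k.+1) 'C(k, j)%:R * ('C(n, j)%:R * (x ^+ n / n`!%:R)).
  rewrite pochhammer_nat (pochhammer_nat 0) binn mul1n natrM mulfK; last first.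
    by rewrite pnatr_eq0 -lt0n fact_gt0.
  under eq_bigr do rewrite mulrA; rewrite -mulr_suml; congr (_ * _).
  rewrite -bin_sub ?leq_addl// addnK addnC -binomial.Vandermonde natr_sum.
  apply: eq_bigr => j _; rewrite natrM mulrC bin_sub//.
  by rewrite -ltnS.
under eq_fun do rewrite E.
rewrite mulr_suml.
rewrite (_ : series _ = (fun N => \sum_(j < k.+1) 'C(k, j)%:R * series (fun n => 'C(n, j)%:R * (x ^+ n / n`!%:R)) N)); last first.
  apply/funext => N; rewrite /series/= exchange_big/=; apply: eq_bigr => j _.
  by rewrite mulr_sumr.
apply: cvg_sumr => j; rewrite -mulrA.
by apply: cvgM; [exact: cvg_cst|exact: cvg_binomial_exp].
Qed.

End special_functions.

(** * Density of the fading amplitude and Laplace transform of its square *)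

Section shadowed_rician.
Context {R : realType} (b Om : R) (k : nat).
Hypotheses (b_gt0 : 0 < b) (Om_gt0 : 0 < Om).

Let K : R := (2 * b * k.+1%:R / (2 * b * k.+1%:R + Om)) ^+ k.+1.
Let beta := SR_beta b.
Let c := SR_c b Om k.+1.
Let zeta := SR_zeta b Om k.+1.

Let den_gt0 : 0 < 2 * b * k.+1%:R + Om.
Proof. by rewrite addr_gt0// !mulr_gt0. Qed.

Let K_gt0 : 0 < K.
Proof. by rewrite exprn_gt0// divr_gt0// !mulr_gt0. Qed.

Let c_gt0 : 0 < c.
Proof. by rewrite /c /SR_c divr_gt0// !mulr_gt0. Qed.

Lemma SR_rate_gt0 : 0 < SR_beta b - SR_c b Om k.+1.
Proof.
rewrite (_ : _ - _ = k.+1%:R / (2 * b * k.+1%:R + Om)); first by rewrite divr_gt0.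
move: den_gt0; rewrite /SR_beta /SR_c; move: (k.+1%:R : R) => n d0; field.
by rewrite !gt_eqF.
Qed.

Let zetaE z : zeta z = K * beta * ('C(k, z)%:R * (c ^+ z / z`!%:R)).
Proof.
have f0 : z`!%:R != 0 :> R by rewrite pnatr_eq0 -lt0n fact_gt0.
rewrite /zeta /SR_zeta -/K -/beta -/c.
transitivity (K * (beta * ((-1) ^+ z * pochhammer (1 - k.+1%:R) z) * c ^+ z / z`!%:R ^+ 2)).
  by rewrite !mulrA.
by rewrite pochhammerN_nat natrM; field.
Qed.

(** The factor exp(c x^2) released by [hyp1F1_kummer] merges with exp(- beta x^2). What remains is a
    finite combination, with positive coefficients, of the integrands of [integral_gauss_moment], so
    it can be integrated term by term. *)
Lemma SR_pdfE x : SR_pdf b Om k.+1 x =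
  \sum_(z < k.+1) 2 * zeta z * (x ^+ z.*2.+1 * expR (- ((beta - c) * x ^+ 2))).
Proof.
rewrite /SR_pdf -/K hyp1F1_kummer.
rewrite (_ : Om * x ^+ 2 / _ = c * x ^+ 2); last by rewrite /c /SR_c mulrAC.
rewrite (_ : - (x ^+ 2 / (2 * b)) = - (beta * x ^+ 2)); last first.
  by rewrite /beta /SR_beta mul1r mulrC.
rewrite (_ : - ((beta - c) * x ^+ 2) = - (beta * x ^+ 2) + c * x ^+ 2); last by ring.
rewrite expRD; set e1 := expR (- _); set e2 := expR _.
rewrite [LHS](_ : _ = (K * (x / b) * e1 * e2) * (\sum_(j < k.+1) 'C(k, j)%:R * ((c * x ^+ 2) ^+ j / j`!%:R))); last by ring.
rewrite mulr_sumr; apply: eq_bigr => z _; rewrite zetaE exprMn -exprM mul2n.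
rewrite exprS /beta /SR_beta.
have f0 : z`!%:R != 0 :> R by rewrite pnatr_eq0 -lt0n fact_gt0.
by field; rewrite f0 gt_eqF.
Qed.

Let zeta_gt0 z : (z <= k)%N -> 0 < zeta z.
Proof.
move=> zk; rewrite zetaE; apply: mulr_gt0; last first.
  by rewrite mulr_gt0 ?divr_gt0 ?exprn_gt0 ?ltr0n ?bin_gt0 ?fact_gt0.
by apply: mulr_gt0 => //; rewrite /beta /SR_beta divr_gt0// mulr_gt0.
Qed.

(** The Laplace transform of the fading power at a. [Gamma] is left unevaluated so that
    [exponent_term] matches it by conversion. *)
Definition SR_laplace (a : R) : R :=
  \sum_(0 <= z < k.+1) SR_zeta b Om k.+1 z * Gamma (z%:R + 1)
    / (SR_beta b - SR_c b Om k.+1 + a) ^+ z.+1.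

(** The hypothesis gives the law of [Num.sqrt H] only, and [Num.sqrt] sends negative numbers to 0;
    hence the square of the root in place of H. *)
Lemma has_SR_root_laplace d (T : measurableType d) (P : probability T R) (H : T -> R) a :
  0 <= a -> measurable_fun setT H -> has_SR_root P b Om k.+1 H ->
  (\int[P]_w (expR (- (a * Num.sqrt (H w) ^+ 2)))%:E = (SR_laplace a)%:E)%E.
Proof.
move=> a0 mH HP.
pose term z x : R := 2 * zeta z * (x ^+ z.*2.+1 * expR (- ((beta - c) * x ^+ 2))).
pose pos : set R := `]0%R, +oo[%classic.
pose W x : R := \1_pos x * \sum_(z < k.+1) term z x.
have mterm z : measurable_fun setT (term z).
  apply: measurable_funM => //; apply: continuous_measurable_fun.
  exact: continuous_exprM_expRN.
have term0 z x : (z <= k)%N -> 0 <= x -> 0 <= term z x.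
  move=> zk x0; rewrite /term; apply: mulr_ge0.
    by apply: mulr_ge0 => //; exact/ltW/zeta_gt0.
  by rewrite mulr_ge0 ?exprn_ge0 ?expR_ge0.
have mW : measurable_fun setT W.
  apply: measurable_funM; last exact: measurable_sum.
  by apply: measurable_indic; exact: measurable_itv.
have W0 x : 0 <= W x.
  rewrite /W indicE; case: (boolP (x \in pos)); last by rewrite mul0r.
  rewrite inE /pos/= in_itv/= andbT => x0; rewrite mul1r sumr_ge0// => z _.
  by rewrite term0// ?(ltW x0)// -ltnS.
have mY : measurable_fun setT (fun w => Num.sqrt (H w)).
  by apply: measurableT_comp => //; exact: measurable_sqrt.
pose nu0 : {measure set R -> \bar R} := pushforward P (fun w => Num.sqrt (H w)).
pose nu := nu0 mY.
have nuE B : measurable B -> nu B = (\int[@lebesgue_measure R]_(x in id @^-1` B) (W x)%:E)%E.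
  move=> mB; transitivity (P [set w | B (Num.sqrt (H w))]); first by [].
  transitivity (\int[@lebesgue_measure R]_(x in B) (W x)%:E)%E; last by [].
  rewrite HP// [LHS]integral_mkcond [RHS]integral_mkcond; apply: eq_integral => x _.
  rewrite !patchE in_setI /W indicE.
  case: (boolP (x \in B)) => xB //=.
  case: ifPn => xp; last by rewrite mul0r.
  by rewrite mul1r SR_pdfE.
have mf : measurable_fun setT (fun x : R => (expR (- (a * x ^+ 2)))%:E).
  apply/measurable_EFinP; apply: continuous_measurable_fun => x.
  have := @continuous_exprM_expRN R 0 a 2 x.
  by rewrite (_ : (fun x => x ^+ 0 * _) = (fun x => expR (- (a * x ^+ 2))))//; apply/funext => y; rewrite expr0 mul1r.
transitivity (\int[nu]_x (expR (- (a * x ^+ 2)))%:E)%E.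
  rewrite /nu /nu0 ge0_integral_pushforward//.
have mid : measurable_fun setT (id : R -> R) by exact: measurable_id.
rewrite (@ge0_integral_transfer _ _ _ _ R (@lebesgue_measure R) nu id W mid mW W0 nuE _ mf)//.
have g0 : 0 < beta - c + a by rewrite ltr_wpDr// SR_rate_gt0.
transitivity (\int[@lebesgue_measure R]_(x in pos)
  (\sum_(z < k.+1) (2 * zeta z)%:E * (x ^+ z.*2.+1 * expR (- ((beta - c + a) * x ^+ 2)))%:E))%E.
  rewrite [RHS]integral_mkcond; apply: eq_integral => x _.
  rewrite patchE /W indicE; case: ifPn => xp; last by rewrite mul0r mule0.
  rewrite mul1r -EFinM mulr_sumr -sumEFin; apply: eq_bigr => z _.
  rewrite -EFinM /term; congr EFin.
  rewrite (_ : - ((beta - c + a) * x ^+ 2) = - ((beta - c) * x ^+ 2) + - (a * x ^+ 2)); last by ring.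
  by rewrite expRD; ring.
have mpos : measurable pos by exact: measurable_itv.
have zeta0 (z : 'I_k.+1) : 0 <= 2 * zeta z.
  by apply: mulr_ge0 => //; apply/ltW/zeta_gt0; rewrite -ltnS.
rewrite ge0_integral_sum; last 3 first.
- exact: measurable_itv.
- move=> z; apply/measurable_EFinP; apply: measurable_funM => //; apply: measurable_funTS.
  by apply: continuous_measurable_fun; exact: continuous_exprM_expRN.
- move=> z x; rewrite /pos/= in_itv/= andbT => x0.
  rewrite -EFinM lee_fin; apply: mulr_ge0 => //.
  by rewrite mulr_ge0 ?exprn_ge0 ?expR_ge0 ?(ltW x0).
rewrite /SR_laplace big_mkord -sumEFin; apply: eq_bigr => z _.
rewrite ge0_integralZl; last 4 first.
- exact: measurable_itv.
- apply/measurable_EFinP; apply: measurable_funTS.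
  by apply: continuous_measurable_fun; exact: continuous_exprM_expRN.
- move=> x; rewrite /pos/= in_itv/= andbT => x0.
  by rewrite lee_fin !mulr_ge0 ?exprn_ge0 ?expR_ge0 ?(ltW x0).
- by rewrite lee_fin.
rewrite integral_gauss_moment// -EFinM; congr EFin.
rewrite integral_exp_moment -/beta -/c -/zeta.
by field; rewrite expf_neq0 ?gt_eqF.
Qed.

(** The law of the root lives on the open half-line, whereas a nonpositive H has root 0. This later
    justifies replacing the squared root by H. *)
Lemma has_SR_root_gt0 d (T : measurableType d) (P : probability T R) (H : T -> R) m :
  has_SR_root P b Om m H -> P [set w | H w <= 0] = 0%E.
Proof.
move=> /(_ [set 0] (measurable_set1 _)) HP.
rewrite (_ : [set w | H w <= 0] = [set w | [set 0] (Num.sqrt (H w))]).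
  rewrite HP (_ : _ `&` _ = set0) ?integral_set0//.
  by apply/seteqP; split => // x [/= ->]; rewrite in_itv/= ltxx.
by apply/seteqP; split => w /=; [move/ler0_sqrtr|move/eqP; rewrite sqrtr_eq0].
Qed.

End shadowed_rician.

(** * Discretization of the distances *)

Section grid.
Context {R : realType} (lo hi : R).
Implicit Types (n j : nat) (y v t : R).

Definition grid n j : R := lo + (hi - lo) * (j%:R / n.+1%:R).

(* The value n.+2 of cell means y > hi, and the value 0 means y <= lo; the
   rounding grid n (cell n y) of y in [lo, hi] is never below y, so that right
   continuity suffices as the mesh tends to 0. *)
Definition cell n y : nat := find (fun j => y <= grid n j) (iota 0 n.+2).

Lemma grid0 n : grid n 0 = lo.
Proof. by rewrite /grid mul0r mulr0 addr0. Qed.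

Lemma gridn n : grid n n.+1 = hi.
Proof. by rewrite /grid divff ?pnatr_eq0// mulr1 addrC subrK. Qed.

Lemma gridS n j : grid n j.+1 = grid n j + (hi - lo) / n.+1%:R.
Proof. by rewrite /grid -(natr1 j); field; rewrite nat1r pnatr_eq0. Qed.

Hypothesis lohi : lo <= hi.

Lemma le_grid n : {homo grid n : i j / (i <= j)%N >-> i <= j}.
Proof.
move=> i j ij; rewrite /grid lerD2l ler_wpM2l ?subr_ge0//.
by rewrite ler_wpM2r ?invr_ge0 ?ler0n// ler_nat.
Qed.

Lemma cell_le n j y : (j < n.+2)%N -> (cell n y <= j)%N = (y <= grid n j).
Proof.
move=> jn; apply/idP/idP => [cj|yj].
  have h : has (fun j => y <= grid n j) (iota 0 n.+2).
    by rewrite has_find size_iota (leq_ltn_trans cj).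
  have := nth_find 0%N h; rewrite nth_iota ?add0n//; last first.
    by rewrite (leq_ltn_trans cj).
  by move=> /le_trans; apply; exact: le_grid.
rewrite leqNgt; apply/negP => cj.
by have := before_find 0%N cj; rewrite nth_iota// add0n yj.
Qed.

Lemma cell_visible n y : (cell n y < n.+2)%N = (y <= hi).
Proof. by rewrite ltnS cell_le// gridn. Qed.

Lemma cell_bound n y : (cell n y <= n.+2)%N.
Proof. by have := find_size (fun j => y <= grid n j) (iota 0 n.+2); rewrite size_iota. Qed.

Lemma le_cell n : {homo cell n : x y / x <= y >-> (x <= y)%N}.
Proof.
move=> x y xy; have [yn|] := ltnP (cell n y) n.+2; last exact/leq_trans/cell_bound.
rewrite cell_le// (le_trans xy)// -(cell_le _ yn)//.
Qed.

Lemma cell_grid_ge n y : y <= hi -> y <= grid n (cell n y).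
Proof. by move=> yhi; rewrite -cell_le ?cell_visible. Qed.

Lemma cell_grid_lt n y : lo <= y -> y <= hi -> grid n (cell n y) <= y + (hi - lo) / n.+1%:R.
Proof.
move=> loy yhi; case E : (cell n y) => [|j].
  by rewrite grid0 (le_trans loy)// lerDl divr_ge0 ?subr_ge0.
rewrite gridS lerD2r ltW// ltNge -cell_le; first by rewrite E ltnn.
by have : (cell n y < n.+2)%N by [rewrite cell_visible]; rewrite E; exact: ltn_trans.
Qed.

Lemma cell_eqS n j y : (j <= n)%N -> (cell n y == j.+1) = (grid n j < y <= grid n j.+1).
Proof.
move=> jn; rewrite ltNge -!cell_le//; last by rewrite ltnS leqW.
by rewrite eqn_leq -ltnNge andbC.
Qed.

Lemma near_grid_lt y e : lo <= y -> y <= hi -> 0 < e ->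
  \forall n \near \oo, grid n (cell n y) < y + e.
Proof.
move=> loy yhi e0; near=> n.
apply: le_lt_trans (cell_grid_lt n loy yhi) _; rewrite ltrD2l.
rewrite ltr_pdivrMr ?ltr0n// mulrC -ltr_pdivrMr//.
have : (hi - lo) / e < n%:R by near: n; exact: nbhs_infty_gtr.
by move/lt_trans; apply; rewrite ltr_nat.
Unshelve. all: by end_near. Qed.

Lemma cvg_grid_right (h : R -> R) y : lo <= y -> y <= hi ->
  h x @[x --> within [set x | y <= x] (nbhs y)] --> h y ->
  h (grid n (cell n y)) @[n --> \oo] --> h y.
Proof.
move=> loy yhi; apply: cvg_trans => A /=; rewrite /nbhs/= /within/= => -[e /= e0 eA].
have := near_grid_lt loy yhi e0; apply: filterS => n ny.
have yn := cell_grid_ge n yhi.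
by apply: eA => //; rewrite /ball/= ltr_distlC; apply/andP; split; lra.
Qed.

(** Rounding may merge two distances but never reverses them, and distinct ones separate once the
    mesh is smaller than their gap. *)
Lemma near_cell_lt y v : lo <= y -> y <= hi ->
  \forall n \near \oo, (cell n y < cell n v)%N = (y < v).
Proof.
move=> loy yhi; have [yv|vy] := ltP y v.
  have e0 : 0 < v - y by rewrite subr_gt0.
  have := near_grid_lt loy yhi e0; apply: filterS => n.
  rewrite addrC subrK => nv; rewrite ltnNge cell_le ?cell_visible//.
  by rewrite -ltNge nv.
by apply: nearW => n; rewrite ltnNge le_cell.
Qed.

Lemma near_le_grid y t : lo <= y -> y <= hi ->
  \forall n \near \oo, (t <= grid n (cell n y)) = (t <= y).
Proof.
move=> loy yhi; have [ty|yt] := leP t y.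
  by apply: nearW => n; rewrite (le_trans ty)// cell_grid_ge.
have e0 : 0 < t - y by rewrite subr_gt0.
have := near_grid_lt loy yhi e0; apply: filterS => n.
by rewrite addrC subrK leNgt => ->.
Qed.

Lemma measurable_cell n k : measurable (cell n @^-1` [set k]).
Proof.
have mle j : (j < n.+2)%N -> measurable [set y | (cell n y <= j)%N].
  move=> jn; rewrite (_ : [set y | _] = `]-oo, (grid n j)]%classic).
    exact: measurable_itv.
  by apply/seteqP; split => y /=; rewrite in_itv/= cell_le.
have mle' j : measurable [set y | (cell n y <= j)%N].
  have [/mle//|nj] := ltnP j n.+2.
  rewrite (_ : [set y | _] = setT)//; apply/seteqP; split => // y _ /=.
  exact: leq_trans (cell_bound _ _) nj.
case: k => [|k].
  rewrite (_ : _ @^-1` _ = [set y | (cell n y <= 0)%N])//.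
  by apply/seteqP; split => y /=; rewrite leqn0 => /eqP.
rewrite (_ : _ @^-1` _ = [set y | (cell n y <= k.+1)%N] `\` [set y | (cell n y <= k)%N]).
  exact: measurableD.
apply/seteqP; split => y /=; first by move=> ->; rewrite ltnn.
by move=> [h1 /negP]; rewrite -ltnNge => h2; apply/eqP; rewrite eqn_leq h1.
Qed.

Lemma measurable_cell_comp n (c : nat -> R) : measurable_fun setT (c \o cell n).
Proof. by apply: measurable_discrete => k; exact: measurable_cell. Qed.

(** The integral of v over the j-th cell. Cell 0 meets [lo, hi] in the point lo only, whence its
    mass 0. *)
Definition cell_mass n j : R :=
  if j is i.+1 then (grid n i.+1 ^+ 2 - grid n i ^+ 2) / 2 else 0.

Lemma integral_idfun a b : a <= b ->
  (\int[@lebesgue_measure R]_(v in `]a, b]) v%:E = ((b ^+ 2 - a ^+ 2) / 2)%:E)%E.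
Proof.
rewrite le_eqVlt => /predU1P[->|ab].
  by rewrite set_itvoc0 integral_set0 subrr mul0r.
rewrite integral_itv_obnd_cbnd; last by apply/measurable_EFinP; apply: measurable_funTS.
pose F : R -> R := fun v => 2^-1 * v ^+ 2.
have cF : continuous F.
  by move=> x; apply: cvgM; [exact: cvg_cst|exact: exprn_continuous].
have dF (x : R) : is_derive x 1 F x.
  have dX : is_derive x 1 (fun u : R => u ^+ 2) (2 * x).
    by apply: (is_derive_eq (is_derive_exprn 2 x)); rewrite expr1.
  apply: (is_derive_eq (is_deriveZ 2^-1 dX)).
  by change (2^-1 * (2 * x) = x); field.
rewrite (@continuous_FTC2 _ _ F)//.
- by rewrite /F -EFinB; congr EFin; ring.
- by apply: continuous_subspaceT => x; exact: cvg_id.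
- split => [x _| |].
  + by have [] := dF x.
  + by apply: cvg_at_right_filter; exact: cF.
  + by apply: cvg_at_left_filter; exact: cF.
- by move=> x _; rewrite derive1E; have [] := dF x.
Qed.

Hypothesis lo_ge0 : 0 <= lo.

Lemma integral_cell n (c : nat -> R) : (forall j, 0 <= c j) ->
  (\int[@lebesgue_measure R]_(v in `[lo, hi]) (c (cell n v) * v)%:E =
   (\sum_(j < n.+2) cell_mass n j * c j)%:E)%E.
Proof.
move=> c0.
rewrite -integral_itv_obnd_cbnd; last first.
  apply/measurable_EFinP; apply: measurable_funTS; apply: measurable_funM => //.
  exact: measurable_cell_comp.
rewrite big_ord_recl/= mul0r add0r.
pose B (j : nat) : set R := `]grid n j, grid n j.+1]%classic.
transitivity (\int[@lebesgue_measure R]_(v in `]lo, hi])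
   \sum_(j < n.+1) ((c j.+1)%:E * (\1_(B j) v * v)%:E))%E.
  apply: eq_integral => v; rewrite inE/= in_itv/= => /andP[lov vhi].
  have cn : (cell n v < n.+2)%N by rewrite cell_visible.
  case E : (cell n v) cn => [|j] jn.
    by have := cell_grid_ge n vhi; rewrite E grid0 leNgt lov.
  rewrite (bigD1 (Ordinal (jn : (j < n.+1)%N)))//= big1 ?adde0.
    have : v \in B j by rewrite inE /B/= in_itv/= -cell_eqS// E.
    by rewrite indicE => ->; rewrite mul1r.
  move=> i ij; rewrite indicE; case: (boolP (v \in B i)); last by rewrite mul0r mule0.
  have iN : (i <= n)%N by rewrite -ltnS.
  rewrite inE /B/= in_itv/= -cell_eqS// E eqSS => /eqP ji.
  by move: ij; rewrite -val_eqE/= ji eqxx.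
have mB j : measurable (B j) by exact: measurable_itv.
rewrite ge0_integral_sum; last 3 first.
- exact: measurable_itv.
- move=> j; apply/measurable_EFinP; apply: measurable_funTS.
  apply: measurable_funM => //; apply: measurable_funM => //.
  by apply: measurable_indic; exact: measurable_itv.
- move=> j v /=; rewrite in_itv/= => /andP[lov _].
  by rewrite -EFinM lee_fin !mulr_ge0// (le_trans lo_ge0)// ltW.
rewrite -sumEFin; apply: eq_bigr => j _.
have gj : 0 <= grid n j by rewrite (le_trans lo_ge0)// -(grid0 n) le_grid.
rewrite ge0_integralZl; last 4 first.
- exact: measurable_itv.
- apply/measurable_EFinP; apply: measurable_funTS; apply: measurable_funM => //.
  by apply: measurable_indic; exact: measurable_itv.
- by move=> v /=; rewrite in_itv/= => /andP[lov _]; rewrite lee_fin mulr_ge0// (le_trans lo_ge0)// ltW.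
- by rewrite lee_fin.
rewrite EFinM muleC; congr (_ * _)%E.
rewrite -integral_idfun; last exact: le_grid.
rewrite [LHS]integral_mkcond [RHS]integral_mkcond; apply: eq_integral => v _.
rewrite !patchE indicE /bump/=.
case: (boolP (v \in B j)) => vB; last by rewrite mul0r; case: ifPn.
rewrite mul1r ifT// inE/=; move: vB; rewrite inE /B/= !in_itv/= => /andP[v1 v2].
rewrite (le_lt_trans _ v1)/=; last by rewrite -(grid0 n) le_grid.
by rewrite (le_trans v2)// -(gridn n) le_grid.
Qed.

(** The sum is the integral of a step function, so dominated convergence applies with bound hi. Only
    pointwise convergence to q is required, which admits jumps at the nearest distance and at the
    gain threshold. *)
Lemma cvg_sum_cell (c : nat -> nat -> R) (q : R -> R) :
  (forall n j, 0 <= c n j <= 1) ->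
  (forall v, lo <= v <= hi -> c n (cell n v) @[n --> \oo] --> q v) ->
  \sum_(j < n.+2) cell_mass n j * c n j @[n --> \oo] -->
  \int[@lebesgue_measure R]_(v in `[lo, hi]) (q v * v).
Proof.
move=> c01 cq.
have mI : measurable (`[lo, hi]%classic : set R) by exact: measurable_itv.
pose f n v : \bar R := (c n (cell n v) * v)%:E.
have mf n : measurable_fun (`[lo, hi]%classic : set R) (f n).
  apply/measurable_EFinP; apply: measurable_funTS; apply: measurable_funM => //.
  exact: measurable_cell_comp.
have fq v : `[lo, hi]%classic v -> f ^~ v @ \oo --> (q v * v)%:E.
  move=> vI; apply: cvg_EFin; first by apply: nearW => n.
  by apply: cvgM; [apply: cq; move: vI; rewrite /= in_itv|exact: cvg_cst].
have mq : measurable_fun (`[lo, hi]%classic : set R) (fun v => (q v * v)%:E).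
  by apply: (emeasurable_fun_cvg f).
have ig : (@lebesgue_measure R).-integrable `[lo, hi] (fun=> hi%:E).
  apply/integrableP; split; first exact: measurable_cst.
  rewrite integral_cst//= lebesgue_measure_itv/=; case: ifPn => _; last by rewrite mule0 ltry.
  by rewrite -EFinD -EFinM ltry.
have fg v n : `[lo, hi]%classic v -> (`|f n v| <= hi%:E)%E.
  rewrite /= in_itv/= => /andP[lov vhi]; have /andP[? ?] := c01 n (cell n v).
  have v0 := le_trans lo_ge0 lov.
  rewrite /f lee_fin ger0_norm ?mulr_ge0//.
  by rewrite (le_trans _ vhi)// ler_piMl.
have fq' : {ae @lebesgue_measure R, forall v, `[lo, hi]%classic v -> f ^~ v @ \oo --> (q v * v)%:E}.
  exact: aeW.
have fg' : {ae @lebesgue_measure R, forall v n, `[lo, hi]%classic v -> (`|f n v| <= hi%:E)%E}.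
  exact: aeW.
have [i1 _ i3] := @dominated_convergence _ _ _ (@lebesgue_measure R) _ mI f _ (fun=> hi%:E) mf mq fq' ig fg'.
have -> : (fun n => \sum_(j < n.+2) cell_mass n j * c n j) =
  fine \o (fun n => \int[@lebesgue_measure R]_(v in `[lo, hi]) f n v)%E.
  by apply/funext => n /=; rewrite integral_cell// => j; case/andP: (c01 n j).
apply: fine_cvg; rewrite /Rintegral fineK//.
exact: integrable_fin_num i1.
Qed.

End grid.

(** * Poisson counts of the cells *)

Section codes.
Context {T : Type} {R : realType} (Phi : T -> seq (point R)).

(* Lists of natural numbers are countable, so conditioning on the code of a
   configuration is a countable sum. *)
Definition sat_code (Rs lo hi : R) n w : seq nat :=
  [seq cell lo hi n (edist x (sat Rs)) | x <- Phi w].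

(** By the default value of [find] this is n.+2 when no cell below n.+2 is occupied, that is, when
    no point is visible. *)
Definition least_cell n (k : seq nat) : nat :=
  find (fun j => j \in k) (iota 0 n.+2).

End codes.

Lemma least_cellP n k j : j \in k -> (j < n.+2)%N ->
  (forall i, i \in k -> (j <= i)%N) -> least_cell n k = j.
Proof.
move=> jk jn min; apply/eqP; rewrite eqn_leq; apply/andP; split.
  rewrite leqNgt; apply/negP => jl.
  by have := before_find 0%N jl; rewrite nth_iota// add0n jk.
have h : has (fun j => j \in k) (iota 0 n.+2).
  by apply/hasP; exists j => //; rewrite mem_iota.
have := nth_find 0%N h; rewrite nth_iota ?add0n; first exact: min.
by move: h; rewrite has_find size_iota.
Qed.

Lemma least_cell_in n k : (least_cell n k < n.+2)%N -> least_cell n k \in k.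
Proof.
move=> ln; have h : has (fun j => j \in k) (iota 0 n.+2) by rewrite has_find size_iota.
by have := nth_find 0%N h; rewrite nth_iota.
Qed.

Lemma least_cell_min n k j : (j < least_cell n k)%N -> (j < n.+2)%N -> j \notin k.
Proof. by move=> jl jn; have := before_find 0%N jl; rewrite nth_iota// add0n => ->. Qed.

Lemma least_cell_out n k : (forall j, j \in k -> (n.+2 <= j)%N) -> (n.+2 <= least_cell n k)%N.
Proof.
move=> h; rewrite leqNgt; apply/negP => ln.
by have := h _ (least_cell_in ln); rewrite leqNgt ln.
Qed.

Lemma prod_count (R : comNzRingType) (N : nat) (phi : nat -> R) (k : seq nat) :
  (forall e, (N <= e)%N -> phi e = 1) ->
  \prod_(e <- k) phi e = \prod_(j < N) phi j ^+ count_mem (val j) k.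
Proof.
move=> phi1; elim: k => [|e k IH]; first by rewrite big_nil big1.
rewrite big_cons IH.
transitivity (\prod_(j < N) phi j ^+ (e == j) * \prod_(j < N) phi j ^+ count_mem (val j) k); last first.
  by rewrite -big_split/=; apply: eq_bigr => j _; rewrite -exprD.
congr (_ * _); have [eN|Ne] := ltnP e N; last first.
  rewrite phi1// big1// => j _; rewrite (_ : (e == j) = false) ?expr0//.
  by apply/eqP => ej; have := ltn_ord j; rewrite -ej ltnNge Ne.
rewrite (bigD1 (Ordinal eN))//= eqxx expr1 big1 ?mulr1// => j je.
rewrite (_ : (e == j) = false) ?expr0//; apply/eqP => ej.
by move: je; rewrite -val_eqE/= ej eqxx.
Qed.

(** Lets the countable decompositions, which are indexed by natural numbers, be applied to codes and
    to pairs of codes. *)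
Lemma pickle_fiber (C : countType) (T : Type) (f : T -> C) m :
  (pickle \o f) @^-1` [set m] = set0 \/
  exists k, m = pickle k /\ (pickle \o f) @^-1` [set m] = f @^-1` [set k].
Proof.
case E : (@pickle_inv C m) => [k|]; [right|left].
  exists k; have mk : m = pickle k by have := @pickle_invK C m; rewrite E.
  split=> //; rewrite mk; apply/seteqP; split => w /=; last by move=> ->.
  exact: (pcan_inj pickleK).
by apply/seteqP; split => // w /= wm; move: E; rewrite -wm pickleK_inv.
Qed.

(** * Measurability of the codes *)

Section measurable_code.
Context {d} {T : measurableType d} {R : realType} (Phi : T -> seq (point R)).
Hypothesis mPhi : forall i B, measurable B -> measurable (point_event Phi i B).
Variables (Rs lo hi : R).
Hypothesis lohi : lo <= hi.

Lemma measurable_sat_cell n j :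
  measurable [set x : point R | cell lo hi n (edist x (sat Rs)) = j].
Proof.
have := @measurable_edist_sat R Rs => /(_ measurableT _ (measurable_cell lohi n j)).
by rewrite setTI.
Qed.

Lemma measurable_sat_code n k : measurable (sat_code Phi Rs lo hi n @^-1` [set k]).
Proof.
(* The last event, [point_event Phi (size k) setT], says that there are more than [size k] points;
   its complement bounds the length of the list. *)
rewrite (_ : _ @^-1` _ =
  (\bigcap_(i in `I_(size k)) point_event Phi i [set x | cell lo hi n (edist x (sat Rs)) = nth 0%N k i])
   `&` ~` point_event Phi (size k) setT).
  apply: measurableI; last by apply: measurableC; exact: mPhi.
  apply: bigcap_measurableType => i _.
  by apply: mPhi; exact: measurable_sat_cell.
apply/seteqP; split => w /=.
  move=> <-; rewrite size_map; split; last by case; rewrite ltnn.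
  by move=> i /= ik; split => //; rewrite (nth_map 0).
move=> [h1 h2']; have h2 : (size (Phi w) <= size k)%N.
  by rewrite leqNgt; apply/negP => h; apply: h2'.
have sE : size (Phi w) = size k.
  apply/eqP; rewrite eqn_leq h2/= leqNgt; apply/negP => h3.
  by have [] := h1 _ h3; rewrite ltnn.
apply: (@eq_from_nth _ 0%N); rewrite size_map// => i iP.
by rewrite (nth_map 0)//; have [|_ ->//] := h1 i; rewrite /= -sE.
Qed.

Lemma measurable_code_fun d' (Y : measurableType d') n (f : seq nat -> Y) :
  measurable_fun setT (fun w => f (sat_code Phi Rs lo hi n w)).
Proof.
have mf m : measurable ((pickle \o sat_code Phi Rs lo hi n) @^-1` [set m]).
  have [->|[k [_ ->]]] := pickle_fiber (sat_code Phi Rs lo hi n) m => //.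
  exact: measurable_sat_code.
apply: (measurable_fibers (N := pickle \o sat_code Phi Rs lo hi n)) => // m.
rewrite setTI.
have [->|[k [_ ->]]] := pickle_fiber (sat_code Phi Rs lo hi n) m.
  exact: measurable_fun_set0.
apply: (eq_measurable_fun (cst (f k))) => [w|]; last exact: measurable_cst.
by rewrite inE /= => ->.
Qed.

End measurable_code.

(** The proof of [measurable_sat_code] is reused with the sigma-algebra generated by the
    configuration as the ambient one. *)
Lemma sigma_config_code {d} {T : measurableType d} {R : realType}
    (Phi : T -> seq (point R)) (Rs lo hi : R) n k : lo <= hi ->
  sigma_config Phi (sat_code Phi Rs lo hi n @^-1` [set k]).
Proof.
move=> lohi.
pose G := [set E | exists i B, measurable B /\ E = point_event Phi i B].
apply: (@measurable_sat_code _ (g_sigma_algebraType G) R) => // i B mB.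
by apply: sub_sigma_algebra; exists i, B.
Qed.

Lemma sigma_config_measurable {d} {T : measurableType d} {R : realType}
    (Phi : T -> seq (point R)) :
  (forall i B, measurable B -> measurable (point_event Phi i B)) ->
  sigma_config Phi `<=` measurable.
Proof.
move=> mPhi; apply: smallest_sub; first exact: sigma_algebra_measurable.
by move=> E [i [B [mB ->]]]; exact: mPhi.
Qed.

Section poisson_counts.
Context {d} {T : measurableType d} {R : realType} (P : probability T R).
Variables (Phi : T -> seq (point R)) (Rs rho lambda hi : R).
Let lo := Rmin Rs rho.
Hypotheses (rho_gt0 : 0 < rho) (rho_lt : rho < Rs).
Hypotheses (lohi : lo <= hi) (hi_le : hi <= Rs + rho).
Hypothesis PhiP : homogeneous_PPP P rho lambda Phi.

Let mPhi : forall i B, measurable B -> measurable (point_event Phi i B).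
Proof. by case: PhiP. Qed.

Let code n := sat_code Phi Rs lo hi n.
(** The constant in front of the integrals of the theorem: the area of a ring is 2 pi rho / Rs times
    its [cell_mass]. *)
Let kappa : R := 2 * pi * (lambda * (rho / Rs)).
Let mean n j : R := kappa * cell_mass lo hi n j.
Let count_cell n (j : nat) w := count_mem j (code n w).

Let area_cell n j : (j < n.+2)%N ->
  lambda * fine (sphere_area rho [set x : point R | cell lo hi n (edist x (sat Rs)) = j])
  = mean n j.
Proof.
case: j => [|j] jn.
  rewrite (_ : [set x | _] = [set x | edist x (sat Rs) <= Rmin Rs rho]).
    by rewrite sphere_area_Rmin// /mean /= !mulr0.
  apply/seteqP; split => x /=; rewrite -[X in _ <= X](grid0 lo hi n) -cell_le//.
    by move=> ->.
  by rewrite leqn0 => /eqP.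
rewrite (_ : [set x | _] = [set x | grid lo hi n j < edist x (sat Rs) <= grid lo hi n j.+1]).
  have lg i : lo <= grid lo hi n i by rewrite -[leLHS](grid0 lo hi n) le_grid.
  have gh i : (i <= n.+1)%N -> grid lo hi n i <= Rs + rho.
    by move=> ni; rewrite (le_trans _ hi_le)// -[leRHS](gridn lo hi n) le_grid.
  rewrite sphere_area_ring//= ?le_grid ?gh//.
  rewrite /mean /kappa /=; field; rewrite gt_eqF//; exact: lt_trans rho_gt0 rho_lt.
by apply/seteqP; split => x /=; rewrite -cell_eqS// => /eqP.
Qed.

Let count_cellE n j w : count_cell n j w =
  nb_points Phi [set x : point R | cell lo hi n (edist x (sat Rs)) = j] w.
Proof.
rewrite /count_cell /code /sat_code count_map /nb_points; apply: eq_count => x /=.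
by apply/eqP/idP; rewrite inE.
Qed.

Let measurable_count n j k : measurable (count_cell n j @^-1` [set k]).
Proof.
have := @measurable_code_fun _ _ _ Phi mPhi Rs lo hi lohi _ _ n (fun k => count_mem j k).
by move=> /(_ measurableT [set k] I); rewrite setTI.
Qed.

Let count_law n (k : 'I_n.+2 -> nat) :
  P [set w | forall j : 'I_n.+2, count_cell n j w = k j] =
  (\prod_(j < n.+2) poisson_weight (mean n j) (k j))%:E.
Proof.
have [_ _ h] := PhiP.
rewrite (_ : [set w | _] = [set w | forall j : 'I_n.+2,
    nb_points Phi [set x : point R | cell lo hi n (edist x (sat Rs)) = j] w = k j]).
  rewrite h; last 2 first.
  - by move=> j; exact: measurable_sat_cell.
  - by apply/trivIsetP => i j _ _ ij; apply/seteqP; split => // x [/= -> /ord_inj ij']; rewrite ij' eqxx in ij.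
  by congr EFin; apply: eq_bigr => j _; rewrite area_cell.
by apply/seteqP; split => w /= H j; have := H j; rewrite count_cellE.
Qed.

Let count_law1 n (j : 'I_n.+2) k :
  P (count_cell n j @^-1` [set k]) = (poisson_weight (mean n j) k)%:E.
Proof.
have [_ _ h] := PhiP.
(* The marginal law is the Poisson hypothesis for a family of one set. *)
rewrite (_ : _ @^-1` _ = [set w | forall i : 'I_1,
    nb_points Phi ((fun _ : 'I_1 => [set x : point R | cell lo hi n (edist x (sat Rs)) = j]) i) w = (fun=> k) i]).
  rewrite h; last 2 first.
  - by move=> _; exact: measurable_sat_cell.
  - by apply/trivIsetP => i i' _ _; rewrite !ord1.
  by rewrite big_ord1 area_cell.
apply/seteqP; split => w /=; first by move=> H _; rewrite -count_cellE.
by move=> /(_ ord0); rewrite -count_cellE.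
Qed.

Let count_pgf n (j : 'I_n.+2) (p : R) : 0 <= p <= 1 ->
  (\int[P]_w (p ^+ count_cell n j w)%:E = (expR (- (mean n j * (1 - p))))%:E)%E.
Proof.
move=> /andP[p0 p1].
have mf : measurable_fun setT (fun w => p ^+ count_cell n j w).
  exact: (measurable_discrete (fun k => p ^+ k) (measurable_count n j)).
rewrite (integral_fibers P (measurable_count n j))//; last by move=> w; exact: exprn_ge0.
have E k : (\int[P]_w (\1_(count_cell n j @^-1` [set k]) w * p ^+ count_cell n j w)%:E
    = (expR (- mean n j) * exp_coeff (mean n j * p) k)%:E)%E.
  transitivity (\int[P]_w ((p ^+ k)%:E * (\1_(count_cell n j @^-1` [set k]) w)%:E))%E.
    apply: eq_integral => w _; rewrite -EFinM indicE.
    by case: (boolP (w \in _)); rewrite ?mul0r ?mulr0 ?mul1r ?mulr1// inE /= => ->.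
  rewrite ge0_integralZl//; last 2 first.
  - by apply/measurable_EFinP; exact: measurable_indic.
  - by rewrite lee_fin exprn_ge0.
  transitivity ((p ^+ k)%:E * P (count_cell n j @^-1` [set k]))%E.
    by rewrite integral_indic// setIT.
  rewrite count_law1 -EFinM /poisson_weight exp_coeffE/=.
  rewrite [X in _ = (_ * (_ * X))%:E]exprMn; congr EFin.
  by move: (p ^+ k) (mean n j ^+ k) => x y; ring.
rewrite (eq_eseriesr (fun k _ => E k)).
apply/cvg_lim => //.
rewrite (_ : (fun n0 => _) = (fun N => (expR (- mean n j) * series (exp_coeff (mean n j * p)) N)%:E)); last first.
  by apply/funext => N; rewrite sumEFin /series/= mulr_sumr.
apply: cvg_EFin; first by apply: nearW.
rewrite (_ : - (mean n j * (1 - p)) = - mean n j + mean n j * p); last by ring.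
rewrite expRD; apply: cvgM; [exact: cvg_cst|exact: is_cvg_series_exp_coeff].
Qed.

Let count_indep n (f : nat -> nat -> R) (e : nat -> R) :
  (forall j m, 0 <= f j m <= 1) ->
  (forall j : 'I_n.+2, \int[P]_w (f j (count_cell n j w))%:E = (e j)%:E)%E ->
  (\int[P]_w (\prod_(j < n.+2) f j (count_cell n j w))%:E = (\prod_(j < n.+2) e j)%:E)%E.
Proof.
move=> f01 fe.
pose A (j : 'I_n.+2) := [set E | exists k, E = count_cell n j @^-1` [set k]].
apply: (@integral_prod_transfers _ _ _ P _ _ A (fun (j : 'I_n.+2) w => f j (count_cell n j w)) (fun j => e (val j))).
- exact: index_enum_uniq.
- by move=> j B [k ->]; exact: measurable_count.
- move=> j; apply: (@transfers_discrete _ _ _ P (count_cell n j) (f j)).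
  + by move=> k; exact: measurable_count.
  + by move=> m; exact: f01.
  + by move=> k; exists k.
- exact: fe.
move=> B AB.
have {}AB j : {k | B j = count_cell n j @^-1` [set k]}.
  by apply: cid; apply: AB; exact: mem_index_enum.
pose k j := sval (AB j).
have Bk j : B j = count_cell n j @^-1` [set k j] by exact: (svalP (AB j)).
rewrite (_ : \bigcap_(i in _) _ = [set w | forall j : 'I_n.+2, count_cell n j w = k j]).
  rewrite count_law -prodEFin; apply: eq_bigr => j _; by rewrite Bk count_law1.
apply/seteqP; split => w /= H j.
  by have := H j (mem_index_enum j); rewrite Bk.
by move=> _; rewrite Bk; exact: H.
Qed.

Lemma PPP_pgf n (phi : nat -> R) :
  (forall j, 0 <= phi j <= 1) -> (forall j, (n.+2 <= j)%N -> phi j = 1) ->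
  (\int[P]_w (\prod_(e <- code n w) phi e)%:E =
   (expR (- (kappa * \sum_(j < n.+2) cell_mass lo hi n j * (1 - phi j))))%:E)%E.
Proof.
move=> phi01 phi1.
under eq_integral do rewrite (prod_count _ phi1).
rewrite (count_indep (f := fun j m => phi j ^+ m) (e := fun j => expR (- (mean n j * (1 - phi j))))).
- rewrite -expR_sum mulr_sumr -sumrN; congr ((expR _)%:E).
  by apply: eq_bigr => j _; rewrite /mean mulrA.
- by move=> j m; case/andP: (phi01 j) => ? ?; rewrite exprn_ge0// exprn_ile1.
- by move=> j; exact: count_pgf.
Qed.

(** Beyond the least cell the product over the points is replaced by its mean. The two sides are two
    instances of one formula, [main]: weights [phi] and factor 1 on the left, weights 1 and factor
    [G] on the right. The bound [e < n.+2] disregards invisible points. *)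
Lemma PPP_nearest_pgf n (psi phi : nat -> R) :
  (forall j, 0 <= psi j <= 1) -> (forall j, (n.+2 <= j)%N -> psi j = 0) ->
  (forall j, 0 <= phi j <= 1) ->
  (\int[P]_w (psi (least_cell n (code n w)) *
     \prod_(e <- code n w) if (least_cell n (code n w) < e < n.+2)%N then phi e else 1)%:E =
   \int[P]_w (psi (least_cell n (code n w)) *
     expR (- (kappa * \sum_(j < n.+2) cell_mass lo hi n j *
       (if (least_cell n (code n w) < j)%N then 1 - phi j else 0))))%:E)%E.
Proof.
move=> psi01 psi0 phi01.
(* [J is the least occupied cell] * prod_(j > J) p j ^+ m_j is a product over
   the cells, as 0 ^+ m is the indicator of m = 0. *)
pose F (p : nat -> R) (J j m : nat) : R :=
  if (j < J)%N then 0 ^+ m else if j == J then 1 - 0 ^+ m else p j ^+ m.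
pose M (p : nat -> R) (J j : nat) : R :=
  if (j < J)%N then expR (- mean n j) else if j == J then 1 - expR (- mean n j)
  else expR (- (mean n j * (1 - p j))).
pose G J := expR (- (kappa * \sum_(j < n.+2) cell_mass lo hi n j *
       (if (J < j)%N then 1 - phi j else 0))).
have F01 p J j m : (forall j, 0 <= p j <= 1) -> 0 <= F p J j m <= 1.
  move=> p01; rewrite /F; case: ifPn => _; first by rewrite expr0n ler0n lern1 leq_b1.
  case: ifPn => _; first by rewrite expr0n; case: eqP; rewrite ?subrr ?subr0 ?ler01 ?lexx.
  by case/andP: (p01 j) => ? ?; rewrite exprn_ge0// exprn_ile1.
have FM p J (j : 'I_n.+2) : (forall j, 0 <= p j <= 1) ->
    (\int[P]_w (F p J j (count_cell n j w))%:E = (M p J j)%:E)%E.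
  move=> p01; have c0 := @count_pgf n j 0 _; rewrite ler01 lexx subr0 mulr1 in c0.
  rewrite /F /M; case: ifPn => _; first exact: c0.
  case: ifPn => _; last exact: count_pgf.
  have m0 : measurable_fun setT (fun w => (0 : R) ^+ count_cell n j w).
    exact: (measurable_discrete (fun k => (0 : R) ^+ k) (measurable_count n j)).
  have b01 k : 0 <= (0 : R) ^+ k <= 1 by rewrite expr0n ler0n lern1 leq_b1.
  have : (\int[P]_w ((1 - 0 ^+ count_cell n j w)%:E + (0 ^+ count_cell n j w)%:E) = 1%:E)%E.
    transitivity (\int[P]_w (cst 1%:E w))%E.
      by apply: eq_integral => w _; rewrite -EFinD subrK.
    by rewrite integral_cst//= mul1e probability_setT.
  rewrite ge0_integralD//; last 3 first.
  - by move=> w _; rewrite lee_fin subr_ge0; case/andP: (b01 (count_cell n j w)).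
  - by apply/measurable_EFinP; apply: measurable_funB.
  - exact/measurable_EFinP.
  rewrite c0//.
  by move=> /(congr1 (fun x => x - (expR (- mean n j))%:E)%E); rewrite addeK// -EFinB.
(* Only the term of the actual least cell survives: a smaller J is empty, so 1 - 0 ^+ 0 = 0 appears,
   and a larger J meets 0 ^+ m with m > 0 at the least cell. If nothing is visible, [psi] vanishes
   on the left and every term on the right. *)
have pt p w : (forall j, 0 <= p j <= 1) -> forall c : nat -> R,
   psi (least_cell n (code n w)) * c (least_cell n (code n w)) *
     (\prod_(e <- code n w) if (least_cell n (code n w) < e < n.+2)%N then p e else 1)
   = \sum_(J < n.+2) psi J * c J * \prod_(j < n.+2) F p J j (count_cell n j w).
  move=> p01 c; set k := code n w; set J0 := least_cell n k.
  have [J0n|nJ0] := ltnP J0 n.+2; last first.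
    rewrite psi0// !mul0r big1// => J _.
    rewrite (bigD1 J)//= /F ltnn eqxx /count_cell -/k.
    have Jk : val J \notin k by apply: (@least_cell_min n); rewrite -/J0 ?(leq_trans (ltn_ord J)).
    by rewrite (count_memPn Jk) expr0 subrr mul0r mulr0.
  rewrite (bigD1 (Ordinal J0n))//= [X in _ + X]big1 ?addr0; last first.
    move=> J JJ0; have [lt|gt|eq] := ltngtP (val J) J0.
    - rewrite (bigD1 J)//= /F ltnn eqxx /count_cell -/k.
      have Jk : val J \notin k by apply: (@least_cell_min n _ _ lt); exact: ltn_ord.
      by rewrite (count_memPn Jk) expr0 subrr mul0r mulr0.
    - rewrite (bigD1 (Ordinal J0n))//= /F gt /count_cell -/k.
      have : J0 \in k by exact: least_cell_in.
      by rewrite -has_pred1 has_count expr0n; case: (count _ _) => //= _ _; rewrite mul0r mulr0.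
    - by move: JJ0; rewrite -val_eqE/= eq eqxx.
  congr (_ * _).
  rewrite (prod_count (N := n.+2)); last by move=> e ne; rewrite [(e < _)%N]ltnNge ne andbF.
  apply: eq_bigr => j _; rewrite ltn_ord andbT /F /count_cell -/k.
  have [lt|gt|eq] := ltngtP (val j) J0.
  - have jk : val j \notin k by apply: (@least_cell_min n _ _ lt); exact: ltn_ord.
    by rewrite (count_memPn jk) !expr0.
  - by [].
  - have : J0 \in k by exact: least_cell_in.
    rewrite -has_pred1 has_count -eq => c0.
    by rewrite expr1n expr0n eqn0Ngt c0 subr0.
have mC p J : measurable_fun setT (fun w => \prod_(j < n.+2) F p J j (count_cell n j w)).
  apply: measurable_prod => j _.
  exact: (measurable_discrete (F p J j) (measurable_count n j)).
have main p (c : nat -> R) : (forall j, 0 <= p j <= 1) -> (forall j, 0 <= c j) ->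
  (\int[P]_w (psi (least_cell n (code n w)) * c (least_cell n (code n w)) *
     (\prod_(e <- code n w) if (least_cell n (code n w) < e < n.+2)%N then p e else 1))%:E
  = (\sum_(J < n.+2) psi J * c J * \prod_(j < n.+2) M p J j)%:E)%E.
  move=> p01 c0.
  transitivity (\int[P]_w (\sum_(J < n.+2) ((psi J * c J)%:E * (\prod_(j < n.+2) F p J j (count_cell n j w))%:E)))%E.
    by apply: eq_integral => w _; rewrite pt// -sumEFin; apply: eq_bigr => J _; rewrite EFinM.
  have pc0 J : 0 <= psi J * c J by rewrite mulr_ge0//; case/andP: (psi01 J).
  have F0 J w : 0 <= \prod_(j < n.+2) F p J j (count_cell n j w).
    by rewrite prodr_ge0// => j _; case/andP: (F01 p J j (count_cell n j w) p01).
  rewrite ge0_integral_sum//; last 2 first.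
  - by move=> J; apply/measurable_EFinP; apply: measurable_funM.
  - by move=> J w _; rewrite -EFinM lee_fin mulr_ge0.
  rewrite -sumEFin; apply: eq_bigr => J _; rewrite ge0_integralZl//; last 3 first.
  - exact/measurable_EFinP.
  - by move=> w _; rewrite lee_fin.
  - by rewrite lee_fin.
  rewrite (count_indep (f := F p J) (e := M p J)) ?EFinM//.
  - by move=> j m; exact: F01.
  - by move=> j; exact: FM.
have one01 (j : nat) : 0 <= (1 : R) <= 1 by rewrite ler01 lexx.
transitivity (\sum_(J < n.+2) psi J * 1 * \prod_(j < n.+2) M phi J j)%:E.
  by rewrite -(main phi (fun=> 1))//; apply: eq_integral => w _; rewrite mulr1.
transitivity (\sum_(J < n.+2) psi J * G J * \prod_(j < n.+2) M (fun=> 1) J j)%:E; last first.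
  rewrite -(main (fun=> 1) G)//; last by move=> j; exact: expR_ge0.
  by apply: eq_integral => w _; rewrite [X in _ * X]big1 ?mulr1// => e _; case: ifP.
congr EFin; apply: eq_bigr => J _; rewrite mulr1 -mulrA; congr (_ * _).
rewrite /G mulr_sumr -sumrN expR_sum -big_split/=; apply: eq_bigr => j _.
rewrite /M; have [lt|gt|eq] := ltngtP (val j) J.
- by rewrite !mulr0 oppr0 expR0 mul1r.
- by rewrite subrr mulr0 oppr0 expR0 mulr1 /mean mulrA.
- by rewrite !mulr0 oppr0 expR0 mul1r.
Qed.

End poisson_counts.

(** * Decoupling the fading from the configurations *)

Section unit_valued.
Context {d} {T : measurableType d} {R : realType} (P : probability T R).

Lemma integral_unit_valued (D : set T) (Y : T -> R) : measurable D ->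
  measurable_fun D Y -> (forall w, 0 <= Y w <= 1) ->
  (0 <= \int[P]_(w in D) (Y w)%:E <= 1)%E.
Proof.
move=> mD mY Y01; rewrite integral_ge0/=; last by move=> w _; rewrite lee_fin; case/andP: (Y01 w).
apply: (@le_trans _ _ (\int[P]_(w in D) cst 1%:E w)%E).
  apply: ge0_le_integral => //.
  - by move=> w _; rewrite lee_fin; case/andP: (Y01 w).
  - exact/measurable_EFinP.
  - by move=> w _; rewrite lee_fin; case/andP: (Y01 w).
by rewrite integral_cst// mul1e probability_le1.
Qed.

Lemma integral_unit_valued_fin (D : set T) (Y : T -> R) : measurable D ->
  measurable_fun D Y -> (forall w, 0 <= Y w <= 1) ->
  (\int[P]_(w in D) (Y w)%:E)%E \is a fin_num.
Proof.
move=> mD mY Y01; have /andP[h0 h1] := integral_unit_valued mD mY Y01.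
by rewrite ge0_fin_numE// (le_lt_trans h1)// ltry.
Qed.

Lemma cvg_integral_unit_valued (f : nat -> T -> R) (g : T -> R) :
  (forall n, measurable_fun setT (f n)) -> (forall n w, 0 <= f n w <= 1) ->
  (forall w, f n w @[n --> \oo] --> g w) ->
  (\int[P]_w (f n w)%:E @[n --> \oo] --> \int[P]_w (g w)%:E)%E.
Proof.
move=> mf f01 fg.
have mg : measurable_fun setT g by apply: (measurable_fun_cvg mf) => w _; exact: fg.
have [] // := @dominated_convergence _ T R P setT measurableT (fun n w => (f n w)%:E)
  (fun w => (g w)%:E) (cst 1%E).
- by move=> n; exact/measurable_EFinP.
- exact/measurable_EFinP.
- by apply: aeW => w _; apply: cvg_EFin; [exact: nearW|exact: fg].
- exact: finite_measure_integrable_cst.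
- by apply: aeW => w n _; rewrite lee_fin ger0_norm; case/andP: (f01 n w).
Qed.

End unit_valued.

Lemma cvg_prodr {R : realType} (I : Type) (s : seq I) (T : Type) (F : set_system T)
    {FF : Filter F} (f : I -> T -> R) (l : I -> R) :
  (forall i, f i t @[t --> F] --> l i) ->
  \prod_(i <- s) f i t @[t --> F] --> \prod_(i <- s) l i.
Proof.
move=> fl; elim: s => [|i s IH].
  by rewrite big_nil; under eq_fun do rewrite big_nil; exact: cvg_cst.
by rewrite big_cons; under eq_fun do rewrite big_cons; exact: cvgM.
Qed.

Section decoupling.
Context {d} {T : measurableType d} {R : realType} (P : probability T R).
Variables (Phi Phi' : T -> seq (point R)) (H H' : nat -> {RV P >-> R}).
Variables (Rs lo hi lo' hi' : R).
Hypotheses (lohi : lo <= hi) (lohi' : lo' <= hi').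
Hypothesis mPhi : forall i B, measurable B -> measurable (point_event Phi i B).
Hypothesis mPhi' : forall i B, measurable B -> measurable (point_event Phi' i B).
Hypothesis indep : mutually_independent P (network_sources Phi Phi' H H').

Let K i w := Num.sqrt (H i w) ^+ 2.
Let K' i w := Num.sqrt (H' i w) ^+ 2.

Variable L : R -> R.
Hypothesis HL : forall i a, 0 <= a ->
  (\int[P]_w (expR (- (a * K i w)))%:E = (L a)%:E)%E.
Hypothesis HL' : forall i a, 0 <= a ->
  (\int[P]_w (expR (- (a * K' i w)))%:E = (L a)%:E)%E.

Let measurable_expK (a : R) :
  measurable_fun setT (fun x : R => expR (- (a * Num.sqrt x ^+ 2))).
Proof.
apply: measurableT_comp => //; apply: measurableT_comp => //.
by apply: measurable_funM => //; apply: measurable_funX; exact: measurable_sqrt.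
Qed.

Let expK_unit (a x : R) : 0 <= a -> 0 <= expR (- (a * Num.sqrt x ^+ 2)) <= 1.
Proof. by move=> a0; rewrite expR_ge0 expR_le1 oppr_le0 mulr_ge0 ?sqr_ge0. Qed.

Lemma laplace_unit a : 0 <= a -> 0 <= L a <= 1.
Proof.
move=> a0; rewrite -!lee_fin -(HL 0 a0).
apply: integral_unit_valued => //; last by move=> w; exact: expK_unit.
exact: (measurableT_comp (measurable_expK a) (measurable_funP (H 0))).
Qed.

Lemma laplace0 : L 0 = 1.
Proof.
apply: EFin_inj; rewrite -(HL 0 (lexx 0)).
transitivity (\int[P]_w cst 1%E w)%E.
  by apply: eq_integral => w _; rewrite mul0r oppr0 expR0.
by rewrite integral_cst// mul1e; exact: probability_setT.
Qed.

Let A := network_sources Phi Phi' H H'.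

Let A_measurable x B : A x B -> measurable B.
Proof.
case: x => [[] [i|]] /=.
- by move=> [C mC <-]; rewrite setTI -[_ @^-1` _]setTI; exact: measurable_funP.
- exact: sigma_config_measurable.
- by move=> [C mC <-]; rewrite setTI -[_ @^-1` _]setTI; exact: measurable_funP.
- exact: sigma_config_measurable.
Qed.

Section fiber.
Variables (U V : T -> R) (a b : nat -> R) (m m' : nat).
Hypothesis trU : transfers P (sigma_config Phi) U.
Hypothesis trV : transfers P (sigma_config Phi') V.
Hypotheses (a0 : forall i, 0 <= a i) (b0 : forall i, 0 <= b i).

(** Mutual independence concerns finite lists of sources, so the numbers m and m' of fading powers
    are frozen here; on a fibre of the codes they are the lengths of the two lists. *)
Lemma integral_independent_sources :
  (\int[P]_w (U w * V w * \prod_(i < m) expR (- (a i * K i w)) *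
              \prod_(j < m') expR (- (b j * K' j w)))%:E
  = (\int[P]_w (U w)%:E) * (\int[P]_w (V w)%:E) *
    (\prod_(i < m) L (a i) * \prod_(j < m') L (b j))%:E)%E.
Proof.
have fU : (\int[P]_w (U w)%:E)%E \is a fin_num.
  by case: trU => ? ? _; exact: integral_unit_valued_fin.
have fV : (\int[P]_w (V w)%:E)%E \is a fin_num.
  by case: trV => ? ? _; exact: integral_unit_valued_fin.
pose Y (x : bool * option nat) : T -> R := match x with
  | (true, None) => U | (false, None) => V
  | (true, Some i) => (fun x => expR (- (a i * Num.sqrt x ^+ 2))) \o H i
  | (false, Some i) => (fun x => expR (- (b i * Num.sqrt x ^+ 2))) \o H' i end.
pose e (x : bool * option nat) : R := match x with
  | (true, None) => fine (\int[P]_w (U w)%:E)%E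
  | (false, None) => fine (\int[P]_w (V w)%:E)%E
  | (true, Some i) => L (a i) | (false, Some i) => L (b i) end.
pose s : seq (bool * option nat) := (true, None) :: (false, None) ::
  [seq (true, Some i) | i <- index_iota 0 m] ++ [seq (false, Some i) | i <- index_iota 0 m'].
have us : uniq s.
  rewrite /s /= !inE/= !mem_cat !negb_or; apply/andP; split.
    by apply/andP; split; apply/mapP => -[].
  apply/andP; split; first by apply/andP; split; apply/mapP => -[].
  rewrite cat_uniq !map_inj_uniq ?iota_uniq//=; try by move=> ? ? [].
  by rewrite andbT; apply/hasPn => x /mapP[i _ ->]; apply/mapP => -[].
have := @integral_prod_transfers _ _ _ P _ s A Y e us A_measurable.
have trY i : transfers P (A i) (Y i).
  case: i => [[] [i|]] //=.
  - apply: transfers_comp => //; first by move=> y; exact: expK_unit.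
    by move=> B mB; exists B => //; rewrite setTI.
  - apply: transfers_comp => //; first by move=> y; exact: expK_unit.
    by move=> B mB; exists B => //; rewrite setTI.
move=> /(_ trY).
have eY i : (\int[P]_w (Y i w)%:E = (e i)%:E)%E.
  by case: i => [[] [i|]] /=; rewrite ?fineK//; [exact: HL|exact: HL'].
move=> /(_ eY (fun B => indep us)).
have split2 (F : bool * option nat -> R) : \prod_(i <- s) F i =
   F (true, None) * F (false, None) * \prod_(i < m) F (true, Some (val i)) *
   \prod_(i < m') F (false, Some (val i)).
  by rewrite /s !big_cons big_cat/= !big_map !big_mkord !mulrA.
rewrite split2 /= => E.
rewrite -(fineK fU) -(fineK fV) -!EFinM mulrA -E.
by apply: eq_integral => w _; rewrite split2.
Qed.

End fiber.

Let code n := sat_code Phi Rs lo hi n.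
Let code' n := sat_code Phi' Rs lo' hi' n.

Let joint n w := (code n w, code' n w).

Let joint_fiber n k k' : joint n @^-1` [set (k, k')] =
  (code n @^-1` [set k]) `&` (code' n @^-1` [set k']).
Proof. by apply/seteqP; split => w /=; [move=> [E1 E2]|move=> [E1 E2]; rewrite /joint E1 E2]. Qed.

Let measurable_joint n m : measurable ((pickle \o joint n) @^-1` [set m]).
Proof.
have [->|[[k k'] [_ ->]]] := pickle_fiber (joint n) m => //.
by rewrite joint_fiber; apply: measurableI; exact: measurable_sat_code.
Qed.

Variables (psi : seq nat -> R) (theta : seq nat -> nat -> R) (theta' : nat -> R).

(** The coefficient theta of a user depends on the whole code, since the least cell decides who
    interferes; that of a base station depends on its own cell only. *)
Definition marked (X X' : nat -> T -> R) n w : R :=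
  psi (code n w) *
  \prod_(i < size (code n w)) expR (- (theta (code n w) (nth 0%N (code n w) i) * X i w)) *
  \prod_(j < size (code' n w)) expR (- (theta' (nth 0%N (code' n w) j) * X' j w)).

Lemma measurable_marked (X X' : nat -> T -> R) n :
  (forall i, measurable_fun setT (X i)) -> (forall i, measurable_fun setT (X' i)) ->
  measurable_fun setT (marked X X' n).
Proof.
move=> mX mX'; apply: (measurable_fibers (N := pickle \o joint n)) => // m.
rewrite setTI; have [->|[[k k'] [_ ->]]] := pickle_fiber (joint n) m.
  exact: measurable_fun_set0.
apply: (eq_measurable_fun (fun w => psi k *
    \prod_(i < size k) expR (- (theta k (nth 0%N k i) * X i w)) *
    \prod_(j < size k') expR (- (theta' (nth 0%N k' j) * X' j w)))).
  by move=> w; rewrite inE /joint/= => -[kE k'E]; rewrite /marked kE k'E.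
apply: measurable_funTS; apply: measurable_funM; first apply: measurable_funM => //.
  apply: measurable_prod => i _; apply: measurableT_comp => //; apply: measurableT_comp => //.
  exact: measurable_funM.
apply: measurable_prod => i _; apply: measurableT_comp => //; apply: measurableT_comp => //.
exact: measurable_funM.
Qed.

Hypotheses (psi01 : forall k, 0 <= psi k <= 1).
Hypotheses (theta0 : forall k e, 0 <= theta k e) (theta'0 : forall e, 0 <= theta' e).

Lemma marked_unit (X X' : nat -> T -> R) n w :
  (forall i, 0 <= X i w) -> (forall i, 0 <= X' i w) -> 0 <= marked X X' n w <= 1.
Proof.
move=> X0 X'0; have /andP[p0 p1] := psi01 (code n w).
rewrite /marked; apply/andP; split.
  by rewrite !mulr_ge0// prodr_ge0// => i _; exact: expR_ge0.
have h (I : finType) (F : I -> R) : (forall i, 0 <= F i) -> 0 <= \prod_i expR (- F i) <= 1.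
  by move=> F0; apply: prod01 => i; rewrite expR_ge0 expR_le1 oppr_le0 F0.
have /andP[h1 h2] := h _ (fun i : 'I_(size (code n w)) => theta (code n w) (nth 0%N (code n w) i) * X i w) (fun i => mulr_ge0 (theta0 _ _) (X0 _)).
have /andP[h3 h4] := h _ (fun i : 'I_(size (code' n w)) => theta' (nth 0%N (code' n w) i) * X' i w) (fun i => mulr_ge0 (theta'0 _) (X'0 _)).
by rewrite mulr_ile1// ?mulr_ge0// mulr_ile1.
Qed.

Let sigma_config_fiber (Psi : T -> seq (point R)) lo1 hi1 n m : lo1 <= hi1 ->
  sigma_config Psi ((pickle \o sat_code Psi Rs lo1 hi1 n) @^-1` [set m]).
Proof.
move=> h; have [->|[k [_ ->]]] := pickle_fiber (sat_code Psi Rs lo1 hi1 n) m.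
  by have [] := @smallest_sigma_algebra _ setT [set E | exists i B, measurable B /\ E = point_event Psi i B].
exact: sigma_config_code.
Qed.

Let transfers_code (Psi : T -> seq (point R)) lo1 hi1 n (f : seq nat -> R) :
  (forall i B, measurable B -> measurable (point_event Psi i B)) -> lo1 <= hi1 ->
  (forall k, 0 <= f k <= 1) ->
  transfers P (sigma_config Psi) (f \o sat_code Psi Rs lo1 hi1 n).
Proof.
move=> mPsi h f01.
pose f' m := if @pickle_inv (seq nat) m is Some k then f k else 0.
rewrite (_ : _ \o _ = f' \o (pickle \o sat_code Psi Rs lo1 hi1 n)); last first.
  by apply/funext => w; rewrite /f' /= pickleK_inv.
apply: transfers_discrete.
- by move=> k; apply: (sigma_config_measurable mPsi); exact: sigma_config_fiber.
- by move=> m; rewrite /f'; case: pickle_inv => [k|]; rewrite ?f01// lexx ler01.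
- by move=> k; exact: sigma_config_fiber.
Qed.

Lemma integral_marked n :
  (\int[P]_w (marked K K' n w)%:E =
   (\int[P]_w (psi (code n w) * \prod_(e <- code n w) L (theta (code n w) e))%:E) *
   (\int[P]_w (\prod_(e <- code' n w) L (theta' e))%:E))%E.
Proof.
have mK i : measurable_fun setT (K i).
  by apply: measurable_funX; apply: measurableT_comp => //; exact: measurable_sqrt.
have mK' i : measurable_fun setT (K' i).
  by apply: measurable_funX; apply: measurableT_comp => //; exact: measurable_sqrt.
have K0 i w : 0 <= K i w by exact: sqr_ge0.
have K'0 i w : 0 <= K' i w by exact: sqr_ge0.
have prodL (k : seq nat) (t : nat -> R) : (forall e, 0 <= t e) -> 0 <= \prod_(e <- k) L (t e) <= 1.
  by move=> t0; apply: prod01 => e; exact: laplace_unit.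
pose f k := psi k * \prod_(e <- k) L (theta k e).
pose f' k := \prod_(e <- k) L (theta' e).
have f01 k : 0 <= f k <= 1.
  have /andP[? ?] := psi01 k; have /andP[? ?] := prodL k _ (theta0 k).
  by rewrite mulr_ge0//= mulr_ile1.
have f'01 k : 0 <= f' k <= 1 by exact: prodL.
have tr1 := transfers_code n mPhi lohi f01.
have tr2 := transfers_code n mPhi' lohi' f'01.
(* Without fading factors this is the independence of the two configurations. It merges the right
   side into one integral, to be split over the same fibres as the left one. *)
have := @integral_independent_sources (f \o code n) (f' \o code' n) (fun=> 0) (fun=> 0) 0 0 tr1 tr2
  (fun=> lexx 0) (fun=> lexx 0).
rewrite !big_ord0 mulr1 mule1 => <-.
under [RHS]eq_integral do rewrite !big_ord0 !mulr1.
have mff : measurable_fun setT (fun w => f (code n w) * f' (code' n w)).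
  by apply: measurable_funM; [case: tr1|case: tr2].
rewrite [LHS](integral_fibers P (measurable_joint n)); last 2 first.
- exact: measurable_marked.
- by move=> w; have /andP[] := @marked_unit K K' n w (fun i => K0 i w) (fun i => K'0 i w).
rewrite [RHS](integral_fibers P (measurable_joint n))//; last first.
  by move=> w; rewrite mulr_ge0//; [case/andP: (f01 (code n w))|case/andP: (f'01 (code' n w))].
apply: eq_eseriesr => m _.
have [->|[[k k'] [_ ->]]] := pickle_fiber (joint n) m.
  by apply: eq_integral => w _; rewrite indic0 !mul0r.
rewrite joint_fiber.
have trk : transfers P (sigma_config Phi) (\1_(code n @^-1` [set k])).
  by apply: transfers_indic; [exact: measurable_sat_code|exact: sigma_config_code].
have trk' : transfers P (sigma_config Phi') (\1_(code' n @^-1` [set k'])).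
  by apply: transfers_indic; [exact: measurable_sat_code|exact: sigma_config_code].
(* On a fiber both sides are the same multiple of the probability of the fiber. *)
have I1 := @integral_independent_sources _ _ (fun i => theta k (nth 0%N k i)) (fun i => theta' (nth 0%N k' i))
  (size k) (size k') trk trk' (fun i => theta0 _ _) (fun i => theta'0 _).
have I2 := @integral_independent_sources _ _ (fun=> 0) (fun=> 0) 0 0 trk trk' (fun=> lexx 0) (fun=> lexx 0).
rewrite !big_ord0 mulr1 mule1 in I2.
have [u1 u2] : unit_valued (\1_(code n @^-1` [set k]) : T -> R) /\ unit_valued (\1_(code' n @^-1` [set k']) : T -> R).
  by split; exact: indic_unit.
have [m1 m2] : measurable_fun setT (\1_(code n @^-1` [set k]) : T -> R) /\ measurable_fun setT (\1_(code' n @^-1` [set k']) : T -> R).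
  by case: trk trk' => ? _ _ [].
transitivity ((psi k)%:E * (\int[P]_x (\1_(code n @^-1` [set k]) x)%:E *
      \int[P]_x (\1_(code' n @^-1` [set k']) x)%:E *
      (\prod_(i < size k) L (theta k (nth 0%N k i)) *
       \prod_(j < size k') L (theta' (nth 0%N k' j)))%:E))%E.
  rewrite -I1 -ge0_integralZl//; last 3 first.
  - apply/measurable_EFinP; apply: measurable_funM; first apply: measurable_funM; first exact: measurable_funM.
      apply: measurable_prod => i _; apply: measurableT_comp => //; apply: measurableT_comp => //.
      exact: measurable_funM.
    apply: measurable_prod => i _; apply: measurableT_comp => //; apply: measurableT_comp => //.
    exact: measurable_funM.
  - move=> w _; have /andP[v1 _] := u1 w; have /andP[v2 _] := u2 w.
    by rewrite lee_fin !mulr_ge0// prodr_ge0// => i _; exact: expR_ge0.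
  - by rewrite lee_fin; case/andP: (psi01 k).
  apply: eq_integral => w _; rewrite -EFinM indicI/= !indicE.
  case: (boolP (w \in code n @^-1` [set k])) => [|_]; last by rewrite !mul0r mulr0.
  case: (boolP (w \in code' n @^-1` [set k'])) => [|_]; last by rewrite mulr0 !mul0r mulr0.
  by rewrite !inE /= => k'E kE; rewrite /marked k'E kE !mul1r mulrA.
transitivity ((f k * f' k')%:E * (\int[P]_x (\1_(code n @^-1` [set k]) x)%:E *
      \int[P]_x (\1_(code' n @^-1` [set k']) x)%:E))%E.
  rewrite muleCA [RHS]muleC -EFinM; congr (_ * _%:E)%E.
  by rewrite /f /f' (big_nth 0%N) big_mkord (big_nth 0%N) big_mkord mulrA.
rewrite -I2 -ge0_integralZl//; last 3 first.
- by apply/measurable_EFinP; under eq_fun do rewrite !big_ord0 !mulr1; exact: measurable_funM.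
- move=> w _; have /andP[v1 _] := u1 w; have /andP[v2 _] := u2 w.
  by rewrite !big_ord0 !mulr1 lee_fin mulr_ge0.
- by rewrite lee_fin mulr_ge0//; [case/andP: (f01 k)|case/andP: (f'01 k')].
apply: eq_integral => w _; rewrite -EFinM !big_ord0 !mulr1 indicI/= !indicE.
case: (boolP (w \in code n @^-1` [set k])) => [|_]; last by rewrite !mul0r mulr0.
case: (boolP (w \in code' n @^-1` [set k'])) => [|_]; last by rewrite mulr0 !mul0r mulr0.
by rewrite !inE /= => -> ->; rewrite !mul1r mulr1.
Qed.

End decoupling.

(** * Passage to the limit *)

Lemma integral_preimage_unique {d} {T : measurableType d} {R : realType}
    (P : probability T R) (D f g : T -> R) :
  measurable_fun setT D -> (forall w, 0 <= D w) ->
  measurable_fun setT f -> (forall w, 0 <= f w <= 1) ->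
  measurable_fun setT g -> (forall w, 0 <= g w <= 1) ->
  (forall t : R, \int[P]_w ((t <= D w)%R%:R * f w)%:E = \int[P]_w ((t <= D w)%R%:R * g w)%:E)%E ->
  forall B, measurable B ->
  (\int[P]_(w in D @^-1` B) (f w)%:E = \int[P]_(w in D @^-1` B) (g w)%:E)%E.
Proof.
move=> mD D0 mf f01 mg g01 fg B mB.
have mDB (C : set R) : measurable C -> measurable (D @^-1` C).
  by move=> mC; rewrite -[X in measurable X]setTI; exact: mD.
have fge0 w : 0 <= f w by case/andP: (f01 w).
have gge0 w : 0 <= g w by case/andP: (g01 w).
have tail (h : T -> R) (t : R) : (\int[P]_(w in D @^-1` `[t, +oo[) (h w)%:E = \int[P]_w ((t <= D w)%R%:R * h w)%:E)%E.
  rewrite integral_mkcond; apply: eq_integral => w _; rewrite patchE.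
  rewrite (_ : (w \in _) = (t <= D w)); last by apply/idP/idP; rewrite inE/= in_itv/= andbT.
  by case: ifP; rewrite ?mul1r ?mul0r.
(* As D is nonnegative, the tail at 0 is the whole space. The total settles the full set and, by
   subtraction of finite integrals, the complements. *)
have eT : (\int[P]_w (f w)%:E = \int[P]_w (g w)%:E)%E.
  have := fg 0; rewrite -!tail (_ : _ @^-1` _ = setT)//.
  by apply/seteqP; split => // w _ /=; rewrite in_itv/= andbT.
have splitT (h : T -> R) (C : set R) : measurable C -> measurable_fun setT h -> (forall w, 0 <= h w) ->
   (\int[P]_w (h w)%:E = \int[P]_(w in D @^-1` C) (h w)%:E + \int[P]_(w in D @^-1` (~` C)) (h w)%:E)%E.
  move=> mC mh h0; rewrite -ge0_integral_setU.
  - by rewrite -preimage_setU setUv preimage_setT.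
  - exact: mDB.
  - by apply: mDB; exact: measurableC.
  - by apply/measurable_EFinP; apply: measurable_funTS.
  - by move=> w _; rewrite lee_fin.
  - by apply/disj_set2P; rewrite -preimage_setI setICr preimage_set0.
have BG' : (@RGenCInfty.G R).-sigma.-measurable B by rewrite -RGenCInfty.measurableE.
have BG : <<s @RGenCInfty.G R >> B := BG'.
move: B BG {mB BG'}; apply: (@dynkin_induction _ (measurableTypeR R) (@RGenCInfty.G R)).
- exact: RGenCInfty.measurableE.
- move=> _ _ [x ->] [y ->]; exists (Num.max x y).
  apply/seteqP; split => z /=; rewrite !in_itv/= !andbT ge_max; first by move=> [-> ->].
  by move/andP.
- by rewrite preimage_setT.
- by move=> _ [t ->]; rewrite !tail.
- move=> S mS eS.
  have := eT; rewrite (splitT f S mS mf fge0) (splitT g S mS mg gge0) eS.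
  move/(congr1 (fun x => x - \int[P]_(w in D @^-1` S) (g w)%:E)%E).
  have fin : (\int[P]_(w in D @^-1` S) (g w)%:E)%E \is a fin_num.
    apply: integral_unit_valued_fin => //; first exact: mDB.
    exact: measurable_funTS.
  by rewrite ![(_ + \int[P]_(w in D @^-1` (~` S)) _)%E]addeC !addeK.
- move=> F mF /trivIsetP tF eF; rewrite preimage_bigcup !ge0_integral_bigcup.
  + by apply: eq_eseriesr => n _; exact: eF.
  + by move=> n; by apply: mDB; exact: mF.
  + by apply/measurable_EFinP; apply: measurable_funTS.
  + by move=> w _; rewrite lee_fin.
  + by apply/trivIsetP => i j _ _ ij; rewrite -preimage_setI tF// preimage_set0.
  + by move=> n; by apply: mDB; exact: mF.
  + by apply/measurable_EFinP; apply: measurable_funTS.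
  + by move=> w _; rewrite lee_fin.
  + by apply/trivIsetP => i j _ _ ij; rewrite -preimage_setI tF// preimage_set0.
Qed.

(** * The limit of the discretized identity for the two configurations *)

Section network.
Context {d} {T : measurableType d} {R : realType} (P : probability T R).
Variables (Phi Phi' : T -> seq (point R)) (H H' : nat -> {RV P >-> R}).
Variables (Rs rho rho' lambda lambda' hi hi' : R).
Let lo := Rmin Rs rho.
Let lo' := Rmin Rs rho'.
Hypotheses (rho_gt0 : 0 < rho) (rho_lt : rho < Rs) (lambda_gt0 : 0 < lambda).
Hypotheses (rho'_gt0 : 0 < rho') (rho'_lt : rho' < Rs) (lambda'_gt0 : 0 < lambda').
Hypotheses (lohi : lo < hi) (hi_le : hi <= Rs + rho).
Hypotheses (lohi' : lo' < hi') (hi'_le : hi' <= Rs + rho').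
Hypothesis PhiP : homogeneous_PPP P rho lambda Phi.
Hypothesis PhiP' : homogeneous_PPP P rho' lambda' Phi'.
Hypothesis indep : mutually_independent P (network_sources Phi Phi' H H').

Let K i w := Num.sqrt (H i w) ^+ 2.
Let K' i w := Num.sqrt (H' i w) ^+ 2.

Variable L : R -> R.
Hypothesis HL : forall i a, 0 <= a ->
  (\int[P]_w (expR (- (a * K i w)))%:E = (L a)%:E)%E.
Hypothesis HL' : forall i a, 0 <= a ->
  (\int[P]_w (expR (- (a * K' i w)))%:E = (L a)%:E)%E.
Hypothesis cL : forall a, 0 <= a -> {for a, continuous L}.

Variables (al be : R -> R).
Hypotheses (al_ge0 : forall v, 0 <= al v) (be_ge0 : forall v, 0 <= be v).
Hypothesis al_right : forall v, lo <= v <= hi ->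
  al x @[x --> within [set x | v <= x] (nbhs v)] --> al v.
Hypothesis be_right : forall v, lo' <= v <= hi' ->
  be x @[x --> within [set x | v <= x] (nbhs v)] --> be v.

Let dist (x : point R) : R := edist x (sat Rs).

Variable u1 : T -> point R.
Let E w : bool := has (fun x => dist x <= hi) (Phi w).
Let D w : R := dist (u1 w).
Hypothesis u1P : forall w, E w -> [/\ u1 w \in Phi w, dist (u1 w) <= hi &
  forall y, y \in Phi w -> dist y <= hi -> dist (u1 w) <= dist y].

Let coef r v : R := if r < v <= hi then al v else 0.
Let coef' v : R := if v <= hi' then be v else 0.

(** Points that do not interfere stay in the products with coefficient 0, which preserves the
    pairing of positions with fading powers. *)
Definition network_weight (X X' : nat -> T -> R) r w : R :=
  \prod_(i < size (Phi w)) expR (- (coef r (dist (nth 0 (Phi w) i)) * X i w)) *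
  \prod_(j < size (Phi' w)) expR (- (coef' (dist (nth 0 (Phi' w) j)) * X' j w)).

Let mPhi : forall i B, measurable B -> measurable (point_event Phi i B).
Proof. by case: PhiP. Qed.

Let mPhi' : forall i B, measurable B -> measurable (point_event Phi' i B).
Proof. by case: PhiP'. Qed.

Let Rs_gt0 : 0 < Rs. Proof. exact: lt_trans rho_gt0 rho_lt. Qed.

Let dist_ge w x : x \in Phi w -> lo <= dist x.
Proof.
by case: PhiP => _ h _ xw; apply: edist_ge_Rmin => //; exact: h xw.
Qed.

Let dist'_ge w x : x \in Phi' w -> lo' <= dist x.
Proof.
by case: PhiP' => _ h _ xw; apply: edist_ge_Rmin => //; exact: h xw.
Qed.

Let lohiW := ltW lohi.
Let lohi'W := ltW lohi'.

Let D_itv w : E w -> lo <= D w <= hi.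
Proof. by move=> /u1P[u1w u1hi _]; rewrite u1hi andbT; exact: dist_ge u1w. Qed.

Let code n := sat_code Phi Rs lo hi n.
Let code' n := sat_code Phi' Rs lo' hi' n.

Let psi t n (k : seq nat) : R :=
  ((least_cell n k < n.+2)%N && (t <= grid lo hi n (least_cell n k)))%:R.
Let theta n (k : seq nat) e : R :=
  if (least_cell n k < e < n.+2)%N then al (grid lo hi n e) else 0.
Let theta' n e : R := if (e < n.+2)%N then be (grid lo' hi' n e) else 0.

(** Rounding is monotone, hence commutes with taking the least distance; invisible points are
    farther than [u1 w] anyway. *)
Let least_cellE n w : E w -> least_cell n (code n w) = cell lo hi n (D w).
Proof.
move=> Ew; have [u1w u1hi u1min] := u1P Ew.
apply: least_cellP; first by apply/mapP; exists (u1 w).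
  by rewrite cell_visible.
move=> i /mapP[y yw ->]; have [yhi|hiy] := leP (dist y) hi.
  by apply: le_cell => //; exact: u1min.
apply: le_cell => //; exact: le_trans u1hi (ltW hiy).
Qed.

Let least_cellN n w : ~~ E w -> (least_cell n (code n w) < n.+2)%N = false.
Proof.
move=> /hasPn NE; apply/negbTE; rewrite -leqNgt; apply: least_cell_out.
by move=> i /mapP[y yw ->]; rewrite leqNgt cell_visible//; exact: NE.
Qed.

Let cvg_theta r v : lo <= r -> r <= hi -> lo <= v ->
  (if (cell lo hi n r < cell lo hi n v < n.+2)%N then al (grid lo hi n (cell lo hi n v)) else 0)
  @[n --> \oo] --> coef r v.
Proof.
move=> lor rhi lov; rewrite /coef; case: (leP v hi) => vhi; last first.
  rewrite andbF; apply: cvg_near_cst; apply: nearW => n.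
  by rewrite cell_visible// leNgt vhi andbF.
rewrite andbT; case: (boolP (r < v)) => rv.
  have h : al (grid lo hi n (cell lo hi n v)) @[n --> \oo] --> al v.
    by apply: cvg_grid_right => //; apply: al_right; rewrite lov.
  apply: cvg_trans h; apply: near_eq_cvg.
  have := near_cell_lt lohiW v lor rhi; apply: filterS => n ->.
  by rewrite cell_visible// vhi rv.
apply: cvg_near_cst.
by have := near_cell_lt lohiW v lor rhi; apply: filterS => n ->; rewrite (negbTE rv).
Qed.

Let cvg_theta' v : lo' <= v ->
  (if (cell lo' hi' n v < n.+2)%N then be (grid lo' hi' n (cell lo' hi' n v)) else 0)
  @[n --> \oo] --> coef' v.
Proof.
move=> lov; rewrite /coef'; under eq_fun do rewrite cell_visible//.
case: ifPn => vhi; last exact: cvg_cst.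
by apply: cvg_grid_right => //; apply: be_right; rewrite lov.
Qed.

Let cvg_psi t w : psi t n (code n w) @[n --> \oo] --> ((E w && (t <= D w))%:R : R).
Proof.
apply: cvg_near_cst; case: (boolP (E w)) => Ew; last first.
  by apply: nearW => n; rewrite /psi least_cellN.
have /andP[loD Dhi] := D_itv Ew.
have := near_le_grid lohiW t loD Dhi; apply: filterS => n h.
by rewrite /psi least_cellE// cell_visible// Dhi h.
Qed.

Let cvg_expRN (f : nat -> R) (l x : R) : f n @[n --> \oo] --> l ->
  expR (- (f n * x)) @[n --> \oo] --> expR (- (l * x)).
Proof.
move=> fl; apply: (@cvg_comp _ _ _ (fun n => - (f n * x)) expR _ (nbhs (- (l * x)))).
  by apply: cvgN; apply: cvgM => //; exact: cvg_cst.
exact: continuous_expR.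
Qed.

Let cvg_marked t (X X' : nat -> T -> R) w :
  marked Phi Phi' Rs lo hi lo' hi' (psi t n) (theta n) (theta' n) X X' n w @[n --> \oo]
  --> (E w && (t <= D w))%:R * network_weight X X' (D w) w.
Proof.
rewrite /network_weight mulrA.
have ME n : marked Phi Phi' Rs lo hi lo' hi' (psi t n) (theta n) (theta' n) X X' n w =
  psi t n (code n w) *
  \prod_(i < size (Phi w)) expR (- (theta n (code n w) (cell lo hi n (dist (nth 0 (Phi w) i))) * X i w)) *
  \prod_(j < size (Phi' w)) expR (- (theta' n (cell lo' hi' n (dist (nth 0 (Phi' w) j))) * X' j w)).
  rewrite /marked !size_map; congr (_ * _ * _).
    by apply: eq_bigr => i _; rewrite (nth_map 0).
  by apply: eq_bigr => i _; rewrite (nth_map 0).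
under eq_fun do rewrite ME.
case: (boolP (E w)) => Ew; last first.
  rewrite !mul0r; apply: cvg_near_cst; apply: nearW => n.
  by rewrite /psi least_cellN// !mul0r.
have /andP[loD Dhi] := D_itv Ew.
apply: cvgM; first apply: cvgM.
- by have := @cvg_psi t w; rewrite Ew.
- apply: cvg_prodr => i; apply: cvg_expRN.
  rewrite /theta; under eq_fun do rewrite least_cellE//.
  by apply: cvg_theta => //; apply: (@dist_ge w); rewrite mem_nth.
- apply: cvg_prodr => i; apply: cvg_expRN.
  by apply: cvg_theta'; apply: (@dist'_ge w); rewrite mem_nth.
Qed.

(** The marks are arbitrary because the result serves both for the fading powers themselves and for
    their squared roots. *)
Lemma measurable_network_weight (X X' : nat -> T -> R) t :
  (forall i, measurable_fun setT (X i)) -> (forall i, measurable_fun setT (X' i)) ->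
  measurable_fun setT (fun w => (E w && (t <= D w))%:R * network_weight X X' (D w) w).
Proof.
move=> mX mX'; apply: (measurable_fun_cvg (h := fun n =>
  marked Phi Phi' Rs lo hi lo' hi' (psi t n) (theta n) (theta' n) X X' n)).
  by move=> n; exact: measurable_marked.
by move=> w _; exact: cvg_marked.
Qed.

(** The condition [r < v] is in the integrand and not in the domain, since the grid subdivides the
    fixed interval [lo, hi]. *)
Definition interferer_exponent r : R :=
  \int[@lebesgue_measure R]_(v in `[lo, hi]) ((if r < v then 1 - L (al v) else 0) * v).

Definition station_exponent : R :=
  \int[@lebesgue_measure R]_(v in `[lo', hi']) ((1 - L (be v)) * v).

Let kappa : R := 2 * pi * (lambda * (rho / Rs)).
Let kappa' : R := 2 * pi * (lambda' * (rho' / Rs)).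

Let lo_ge0 : 0 <= lo. Proof. by rewrite subr_ge0 ltW. Qed.
Let lo'_ge0 : 0 <= lo'. Proof. by rewrite subr_ge0 ltW. Qed.

Let L01 a : 0 <= a -> 0 <= L a <= 1.
Proof. exact: laplace_unit HL a. Qed.

Let L0 : L 0 = 1.
Proof. exact: laplace0 HL. Qed.

Let compl01 (x : R) : 0 <= x <= 1 -> 0 <= 1 - x <= 1.
Proof. by move=> /andP[? ?]; rewrite subr_ge0 gerBl; apply/andP. Qed.

Let cvg_interferer w : E w ->
  \sum_(j < n.+2) cell_mass lo hi n j *
       (if (least_cell n (code n w) < j)%N then 1 - L (al (grid lo hi n j)) else 0)
  @[n --> \oo] --> interferer_exponent (D w).
Proof.
move=> Ew; have /andP[loD Dhi] := D_itv Ew.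
apply: (@cvg_sum_cell R lo hi lohiW lo_ge0 (fun n j =>
   if (least_cell n (code n w) < j)%N then 1 - L (al (grid lo hi n j)) else 0)).
  by move=> n j; case: ifP => _; [exact/compl01/L01|rewrite lexx ler01].
move=> v /andP[lov vhi].
under eq_fun do rewrite least_cellE//.
case: (boolP (D w < v)) => Dv; last first.
  apply: cvg_near_cst.
  by have := near_cell_lt lohiW v loD Dhi; apply: filterS => n ->; rewrite (negbTE Dv).
have h : 1 - L (al (grid lo hi n (cell lo hi n v))) @[n --> \oo] --> 1 - L (al v).
  apply: cvgB; first exact: cvg_cst.
  apply: (@cvg_comp _ _ _ (fun n => al (grid lo hi n (cell lo hi n v))) L _ (nbhs (al v))).
    by apply: cvg_grid_right => //; apply: al_right; rewrite lov.
  exact: cL.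
apply: cvg_trans h; apply: near_eq_cvg.
by have := near_cell_lt lohiW v loD Dhi; apply: filterS => n ->; rewrite Dv.
Qed.

Let cvg_station :
  \sum_(j < n.+2) cell_mass lo' hi' n j *
       (1 - L (theta' n j))
  @[n --> \oo] --> station_exponent.
Proof.
apply: (@cvg_sum_cell R lo' hi' lohi'W lo'_ge0 (fun n j => 1 - L (theta' n j))).
  by move=> n j; apply/compl01/L01; rewrite /theta'; case: ifP.
move=> v /andP[lov vhi]; apply: cvgB; first exact: cvg_cst.
apply: (@cvg_comp _ _ _ (fun n => theta' n (cell lo' hi' n v)) L _ (nbhs (be v))); last exact: cL.
by have := cvg_theta' lov; rewrite /coef' vhi.
Qed.

Let approx_weight t n w : R :=
  psi t n (code n w) * expR (- (kappa * \sum_(j < n.+2) cell_mass lo hi n j *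
       (if (least_cell n (code n w) < j)%N then 1 - L (al (grid lo hi n j)) else 0)))
  * expR (- (kappa' * \sum_(j < n.+2) cell_mass lo' hi' n j * (1 - L (theta' n j)))).

Let kappa_ge0 : 0 <= kappa.
Proof. by rewrite !mulr_ge0 ?pi_ge0 ?invr_ge0 ?ltW. Qed.

Let kappa'_ge0 : 0 <= kappa'.
Proof. by rewrite !mulr_ge0 ?pi_ge0 ?invr_ge0 ?ltW. Qed.

Let mass_ge0 (l h : R) n j : 0 <= l -> l <= h -> 0 <= cell_mass l h n j.
Proof.
move=> l0 lh; case: j => //= j; rewrite divr_ge0// subr_ge0 ler_pXn2r ?nnegrE ?le_grid//.
all: by rewrite (le_trans l0)// -[leLHS](grid0 l h n) le_grid.
Qed.

Let expN01 (x : R) : 0 <= x -> 0 <= expR (- x) <= 1.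
Proof. by move=> x0; rewrite expR_ge0 expR_le1 oppr_le0. Qed.

Let psi01 t n k : 0 <= psi t n k <= 1.
Proof. by rewrite /psi ler0n lern1 leq_b1. Qed.

Let approx01 t n w : 0 <= approx_weight t n w <= 1.
Proof.
have h1 : 0 <= kappa * \sum_(j < n.+2) cell_mass lo hi n j *
       (if (least_cell n (code n w) < j)%N then 1 - L (al (grid lo hi n j)) else 0).
  rewrite mulr_ge0// sumr_ge0// => j _; rewrite mulr_ge0 ?mass_ge0//.
  by case: ifP => // _; have /andP[] := compl01 (L01 (al_ge0 (grid lo hi n j))).
have h2 : 0 <= kappa' * \sum_(j < n.+2) cell_mass lo' hi' n j * (1 - L (theta' n j)).
  rewrite mulr_ge0// sumr_ge0// => j _; rewrite mulr_ge0 ?mass_ge0//.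
  have t0 : 0 <= theta' n j by rewrite /theta'; case: ifP.
  by have /andP[] := compl01 (L01 t0).
have /andP[? ?] := expN01 h1; have /andP[? ?] := expN01 h2.
have /andP[? ?] := psi01 t n (code n w).
by rewrite /approx_weight !mulr_ge0//= mulr_ile1 ?mulr_ge0// mulr_ile1.
Qed.

(** Integrating out the fading leaves one factor per configuration: [PPP_nearest_pgf] handles the
    users, [PPP_pgf] the base stations. *)
Let integral_marked_approx t n :
  (\int[P]_w (marked Phi Phi' Rs lo hi lo' hi' (psi t n) (theta n) (theta' n) K K' n w)%:E
  = \int[P]_w (approx_weight t n w)%:E)%E.
Proof.
rewrite (integral_marked Rs lohiW lohi'W mPhi mPhi' indep HL HL'); last 3 first.
- exact: psi01.
- by move=> k e; rewrite /theta; case: ifP.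
- by move=> e; rewrite /theta'; case: ifP.
have t0 e : 0 <= theta' n e by rewrite /theta'; case: ifP.
rewrite (PPP_pgf rho'_gt0 rho'_lt lohi'W hi'_le PhiP' (phi := fun e => L (theta' n e))); last 2 first.
- by move=> j; exact: L01.
- by move=> j nj; rewrite /theta' ltnNge nj.
pose ps j : R := ((j < n.+2)%N && (t <= grid lo hi n j))%:R.
pose ph j : R := L (al (grid lo hi n j)).
have := @PPP_nearest_pgf _ _ _ P Phi Rs rho lambda hi rho_gt0 rho_lt lohiW hi_le PhiP n ps ph.
have ps01 j : 0 <= ps j <= 1 by rewrite /ps ler0n lern1 leq_b1.
have ps0 j : (n.+2 <= j)%N -> ps j = 0 by move=> nj; rewrite /ps ltnNge nj.
have ph01 j : 0 <= ph j <= 1 by exact: L01.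
move=> /(_ ps01 ps0 ph01) N.
transitivity ((\int[P]_w
  (ps (least_cell n (code n w)) *
   expR
     (-
      (kappa *
       \sum_(j < n.+2)
          cell_mass lo hi n j *
          (if (least_cell n (code n w) < j)%N then 1 - ph j else 0))))%:E) *
  (expR (- (kappa' * \sum_(j < n.+2) cell_mass lo' hi' n j * (1 - L (theta' n j)))))%:E)%E.
  congr (_ * _)%E; rewrite -N; apply: eq_integral => w _; congr (_ * _)%:E.
  by apply: eq_bigr => e _; rewrite /theta; case: ifP => // _; rewrite L0.
rewrite -ge0_integralZr; last 4 first.
- exact: measurableT.
- by apply/measurable_EFinP; exact: (measurable_code_fun mPhi Rs lohiW n (fun k => ps (least_cell n k) *
     expR (- (kappa * \sum_(j < n.+2) cell_mass lo hi n j *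
          (if (least_cell n k < j)%N then 1 - ph j else 0))))).
- by move=> w _; rewrite lee_fin mulr_ge0 ?expR_ge0//; case/andP: (ps01 (least_cell n (code n w))).
- by rewrite lee_fin expR_ge0.
by apply: eq_integral => w _; rewrite -EFinM.
Qed.

Let limit_weight t w : R := (E w && (t <= D w))%:R *
  (expR (- (kappa * interferer_exponent (D w))) * expR (- (kappa' * station_exponent))).

Let cvg_approx t w : approx_weight t n w @[n --> \oo] --> limit_weight t w.
Proof.
rewrite /limit_weight mulrA; apply: cvgM; last first.
  under eq_fun do rewrite mulrC; rewrite [kappa' * _]mulrC.
  by apply: cvg_expRN; exact: cvg_station.
case: (boolP (E w)) => Ew; last first.
  rewrite mul0r; apply: cvg_near_cst; apply: nearW => n.
  by rewrite /psi least_cellN// mul0r.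
apply: cvgM; first by have := @cvg_psi t w; rewrite Ew.
under eq_fun do rewrite mulrC; rewrite [kappa * _]mulrC.
by apply: cvg_expRN; exact: cvg_interferer.
Qed.

Let measurable_approx t n : measurable_fun setT (approx_weight t n).
Proof.
by apply: (measurable_code_fun mPhi Rs lohiW n (fun k => psi t n k * expR (- (kappa * \sum_(j < n.+2) cell_mass lo hi n j *
       (if (least_cell n k < j)%N then 1 - L (al (grid lo hi n j)) else 0)))
  * expR (- (kappa' * \sum_(j < n.+2) cell_mass lo' hi' n j * (1 - L (theta' n j)))))).
Qed.

Lemma measurable_limit_weight t : measurable_fun setT (limit_weight t).
Proof.
apply: (measurable_fun_cvg (h := approx_weight t)); first exact: measurable_approx.
by move=> w _; exact: cvg_approx.
Qed.

Lemma integral_network_weight t :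
  (\int[P]_w ((E w && (t <= D w))%:R * network_weight K K' (D w) w)%:E
  = \int[P]_w (limit_weight t w)%:E)%E.
Proof.
have mK i : measurable_fun setT (K i).
  by apply: measurable_funX; apply: measurableT_comp => //; exact: measurable_sqrt.
have mK' i : measurable_fun setT (K' i).
  by apply: measurable_funX; apply: measurableT_comp => //; exact: measurable_sqrt.
have mu n w : 0 <= marked Phi Phi' Rs lo hi lo' hi' (psi t n) (theta n) (theta' n) K K' n w <= 1.
  apply: marked_unit => //.
  - by move=> k e; rewrite /theta; case: ifP.
  - by move=> e; rewrite /theta'; case: ifP.
  - by move=> i; exact: sqr_ge0.
  - by move=> i; exact: sqr_ge0.
have h1 := @cvg_integral_unit_valued _ _ _ P _ _
  (fun n => measurable_marked Rs lohiW lohi'W mPhi mPhi' (psi t n) (theta n) (theta' n) n mK mK')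
  mu (@cvg_marked t K K').
have h2 := @cvg_integral_unit_valued _ _ _ P (approx_weight t) _ (measurable_approx t) (approx01 t) (@cvg_approx t).
move: h1; under eq_fun do rewrite integral_marked_approx.
by move=> h1; apply: cvg_unique h1 h2.
Qed.

(** Off E the point [u1 w], hence D, is arbitrary. The truncated distance is measurable on the whole
    space, as the limit of the rounded least distances, which are functions of the codes. *)
Let Dt w : R := if E w then D w else 0.

Let DtE w : E w -> Dt w = D w.
Proof. by rewrite /Dt => ->. Qed.

Let D_ge0 w : E w -> 0 <= D w.
Proof. by move=> /D_itv/andP[/(le_trans lo_ge0)]. Qed.

Let measurable_Dt : measurable_fun setT Dt.
Proof.
apply: (measurable_fun_cvg (h := fun n w => if (least_cell n (code n w) < n.+2)%N
    then grid lo hi n (least_cell n (code n w)) else 0)).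
  by move=> n; exact: (measurable_code_fun mPhi Rs lohiW n (fun k =>
    if (least_cell n k < n.+2)%N then grid lo hi n (least_cell n k) else 0)).
move=> w _; case: (boolP (E w)) => Ew; last first.
  apply: cvg_near_cst; apply: nearW => n.
  by rewrite least_cellN// /Dt (negbTE Ew).
have /andP[loD Dhi] := D_itv Ew.
rewrite DtE//; under eq_fun do rewrite least_cellE// cell_visible// Dhi.
apply: (@cvg_grid_right R lo hi lohiW id) => //.
by apply: cvg_within_filter; exact: cvg_id.
Qed.

Lemma measurable_visible : measurable [set w | E w].
Proof.
rewrite (_ : [set w | E w] = (fun w => (least_cell 0 (code 0 w) < 2)%N) @^-1` [set true]).
  rewrite -[X in measurable X]setTI.
  by apply: (measurable_code_fun mPhi Rs lohiW 0 (fun k => (least_cell 0 k < 2)%N)) => //.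
apply/seteqP; split => w /=.
  by move=> Ew; rewrite least_cellE// cell_visible//; case/andP: (D_itv Ew).
by apply: contraPT => /least_cellN ->.
Qed.

Lemma measurable_nearest_dist : measurable_fun [set w | E w] D.
Proof.
apply: (eq_measurable_fun Dt) => [w|]; first by rewrite inE/= => /DtE.
exact: measurable_funTS.
Qed.

Let tail_nearest t (h : T -> R) w :
  ((E w && (t <= D w))%:R * h w = (t <= Dt w)%R%:R * ((E w)%:R * h w))%R.
Proof. by rewrite /Dt; case: (E w); rewrite /= ?mul1r// !mul0r mulr0. Qed.

Let visible_tail w : E w && (0 <= D w) = E w.
Proof. by case: (boolP (E w)) => //= /D_ge0. Qed.

Lemma measurable_network_weightE (X X' : nat -> T -> R) :
  (forall i, measurable_fun setT (X i)) -> (forall i, measurable_fun setT (X' i)) ->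
  measurable_fun setT (fun w => (E w)%:R * network_weight X X' (D w) w).
Proof.
move=> mX mX'; have := measurable_network_weight 0 mX mX'.
by under eq_fun do rewrite visible_tail.
Qed.

Definition network_laplace r : R :=
  expR (- (kappa * interferer_exponent r)) * expR (- (kappa' * station_exponent)).

Lemma measurable_network_laplace :
  measurable_fun setT (fun w => (E w)%:R * network_laplace (D w)).
Proof.
by have := measurable_limit_weight 0; rewrite /limit_weight; under eq_fun do rewrite visible_tail.
Qed.

Let bool01 (c : bool) (x : R) : 0 <= x <= 1 -> 0 <= c%:R * x <= 1.
Proof. by case: c => [|_]; rewrite ?mul1r// mul0r lexx ler01. Qed.

Lemma network_laplace01 r : 0 <= network_laplace r <= 1.
Proof.
have h1 : 0 <= kappa * interferer_exponent r.
  rewrite mulr_ge0// Rintegral_ge0// => v; rewrite /= in_itv/= => /andP[lov _].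
  rewrite mulr_ge0//; last exact: le_trans lo_ge0 lov.
  case: ifP => // _.
  by have /andP[] := compl01 (L01 (al_ge0 v)).
have h2 : 0 <= kappa' * station_exponent.
  rewrite mulr_ge0// Rintegral_ge0// => v; rewrite /= in_itv/= => /andP[lov _].
  rewrite mulr_ge0//; last exact: le_trans lo'_ge0 lov.
  by have /andP[] := compl01 (L01 (be_ge0 v)).
have /andP[a0 a1] := expN01 h1; have /andP[b0 b1] := expN01 h2.
by apply/andP; split; [exact: mulr_ge0 a0 b0|exact: mulr_ile1 a0 b0 a1 b1].
Qed.

Lemma network_weight01 r w : 0 <= network_weight K K' r w <= 1.
Proof.
have h1 : 0 <= \prod_(i < size (Phi w)) expR (- (coef r (dist (nth 0 (Phi w) i)) * K i w)) <= 1.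
  apply: prod01 => i; apply: expN01; rewrite mulr_ge0 ?sqr_ge0// /coef; by case: ifP.
have h2 : 0 <= \prod_(j < size (Phi' w)) expR (- (coef' (dist (nth 0 (Phi' w) j)) * K' j w)) <= 1.
  apply: prod01 => i; apply: expN01; rewrite mulr_ge0 ?sqr_ge0// /coef'; by case: ifP.
case/andP: h1 => ? ?; case/andP: h2 => ? ?.
by rewrite /network_weight mulr_ge0//= mulr_ile1.
Qed.

Lemma integral_network_conditional B : measurable B ->
  (\int[P]_(w in [set w | E w] `&` D @^-1` B) (network_weight K K' (D w) w)%:E
  = \int[P]_(w in [set w | E w] `&` D @^-1` B) (network_laplace (D w))%:E)%E.
Proof.
move=> mB.
(* The indicator of E moves into the integrand, so that the domain is a preimage under the
   everywhere measurable [Dt]. *)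
have restr (h : T -> R) : (\int[P]_(w in [set w | E w] `&` D @^-1` B) (h w)%:E
    = \int[P]_(w in Dt @^-1` B) ((E w)%:R * h w)%:E)%E.
  rewrite [LHS]integral_mkcond [RHS]integral_mkcond; apply: eq_integral => w _.
  rewrite !patchE in_setI; case: (boolP (E w)) => Ew.
    rewrite mul1r (_ : w \in [set w | E w]) ?inE//=; congr (if _ then _ else _).
    by apply/idP/idP; rewrite !inE /= DtE.
  rewrite mul0r (_ : (w \in [set w | E w]) = false) /=; first by case: ifP.
  by apply/negbTE; rewrite notin_setE/= => Ew'; rewrite Ew' in Ew.
rewrite !restr; apply: integral_preimage_unique => //.
- by move=> w; rewrite /Dt; case: ifP => // /D_ge0.
- apply: measurable_network_weightE => i.
    by apply: measurable_funX; apply: measurableT_comp => //; exact: measurable_sqrt.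
  by apply: measurable_funX; apply: measurableT_comp => //; exact: measurable_sqrt.
- by move=> w; apply/bool01/network_weight01.
- exact: measurable_network_laplace.
- by move=> w; apply/bool01/network_laplace01.
move=> t.
under eq_integral do rewrite -tail_nearest.
under [RHS]eq_integral do rewrite -(tail_nearest t (fun w => network_laplace (D w))).
exact: integral_network_weight.
Qed.

(** With weight 0 on the visible cells and 1 beyond, the product over the points is the indicator
    that nothing is visible. On the coarsest grid [PPP_pgf] gives this event the probability exp(-
    kappa (hi^2 - lo^2) / 2), which is less than 1. *)
Lemma visible_gt0 : (0 < P [set w | E w])%E.
Proof.
pose phi (j : nat) : R := (1 < j)%:R.
have phi01 j : 0 <= phi j <= 1 by rewrite /phi ler0n lern1 leq_b1.
have phi1 j : (2 <= j)%N -> phi j = 1 by rewrite /phi => ->.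
have := PPP_pgf rho_gt0 rho_lt lohiW hi_le PhiP (n := 0) phi01 phi1.
have -> : (\int[P]_w (\prod_(e <- sat_code Phi Rs (Rmin Rs rho) hi 0 w) phi e)%:E
    = P (~` [set w | E w]))%E.
  transitivity (\int[P]_w (\1_(~` [set w | E w]) w)%:E)%E; last first.
    by rewrite integral_indic ?setIT//; apply: measurableC; exact: measurable_visible.
  apply: eq_integral => w _; rewrite indicE; congr EFin.
  case: (boolP (E w)) => Ew.
    rewrite memNset/=; last by move=> /(_ Ew).
    have [u1w u1hi _] := u1P Ew.
    have uc : cell lo hi 0 (dist (u1 w)) \in code 0 w by apply/mapP; exists (u1 w).
    rewrite -/lo -/(code 0 w) (big_rem _ uc)/= /phi ltnNge.
    by rewrite -ltnS cell_visible// u1hi mul0r.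
  rewrite mem_set//=; last by move=> Ew'; rewrite Ew' in Ew.
  rewrite big_seq big1// => e /mapP[y yw ->]; rewrite phi1//.
  by rewrite leqNgt cell_visible//; exact: (hasPn Ew).
rewrite -/kappa -/lo big_ord_recl big_ord1/= /phi/= !subr0 mul0r add0r mulr1 gridn grid0.
have kappa_gt0 : 0 < kappa by rewrite !mulr_gt0 ?pi_gt0 ?invr_gt0.
set x := (X in expR (- X)) => PE.
have x0 : 0 < x.
  rewrite mulr_gt0// divr_gt0// subr_gt0 ltr_pXn2r ?nnegrE//.
  exact: le_trans lo_ge0 lohiW.
rewrite lt0e measure_ge0 andbT; apply/eqP => P0.
have := probability_setC P measurable_visible; rewrite P0 sube0 PE => -[] /eqP.
by rewrite lt_eqF// expR_lt1 oppr_lt0.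
Qed.

End network.

(** * Path loss: continuity, and the exponents as integrals over subintervals *)

Section path_loss.
Context {R : realType}.
Implicit Types (q alpha v : R).

Lemma continuous_powR alpha v : 0 < v -> {for v, continuous (fun x => x `^ alpha)}.
Proof.
move=> v0; apply: differentiable_continuous; apply/derivable1_diffP.
by apply: derivable_powR; rewrite in_itv/= andbT.
Qed.

Lemma continuous_SR_laplace (b Om a : R) k : 0 < b -> 0 < Om -> 0 <= a ->
  {for a, continuous (SR_laplace b Om k)}.
Proof.
move=> b0 Om0 a0; rewrite /SR_laplace /prop_for /continuous_at.
apply: cvg_sumr => z; apply: cvgM; first exact: cvg_cst.
have g0 : 0 < SR_beta b - SR_c b Om k.+1 + a by rewrite ltr_wpDr// SR_rate_gt0.
apply: cvgV; first by rewrite expf_neq0// gt_eqF.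
apply: (@continuous_comp _ _ _ (fun x => SR_beta b - SR_c b Om k.+1 + x) (fun x => x ^+ z.+1)).
  by apply: cvgD; [exact: cvg_cst|exact: cvg_id].
exact: exprn_continuous.
Qed.

Variables (b Om : R) (k : nat) (alpha : R).
Hypotheses (b_gt0 : 0 < b) (Om_gt0 : 0 < Om).
Let L := SR_laplace b Om k.

Definition exponent_density q v : R := (1 - L (q * v `^ (- alpha))) * v.

Lemma continuous_exponent_density q v : 0 <= q -> 0 < v ->
  {for v, continuous (exponent_density q)}.
Proof.
move=> q0 v0; apply: cvgM; last exact: cvg_id.
apply: cvgB; first exact: cvg_cst.
apply: (@continuous_comp _ _ _ (fun x => q * x `^ (- alpha)) L).
  by apply: cvgM; [exact: cvg_cst|exact: continuous_powR].
by apply: continuous_SR_laplace => //; rewrite mulr_ge0 ?powR_ge0.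
Qed.

Lemma within_continuous_exponent_density q (lo hi : R) : 0 <= q -> 0 < lo ->
  {within `[lo, hi], continuous (exponent_density q)}.
Proof.
move=> q0 lo0; apply: continuous_in_subspaceT => v; rewrite inE/= in_itv/= => /andP[lov _].
by apply: continuous_exponent_density => //; exact: lt_le_trans lov.
Qed.

Lemma integrable_exponent_density q (lo hi : R) : 0 <= q -> 0 < lo ->
  (@lebesgue_measure R).-integrable `[lo, hi] (EFin \o exponent_density q).
Proof.
move=> q0 lo0; apply: continuous_compact_integrable; first exact: segment_compact.
exact: within_continuous_exponent_density.
Qed.

Lemma exponent_termE s G Ptx lo hi :
  exponent_term b Om k.+1 s G Ptx alpha lo hi =
  \int[@lebesgue_measure R]_(v in `[lo, hi]) exponent_density (s * G * Ptx) v.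
Proof. by []. Qed.

Lemma interferer_exponentE q Rs rho r hi : 0 <= q -> 0 < Rmin Rs rho ->
  Rmin Rs rho <= r -> r <= hi ->
  interferer_exponent Rs rho hi L (fun v => q * v `^ (- alpha)) r =
  \int[@lebesgue_measure R]_(v in `[r, hi]) exponent_density q v.
Proof.
move=> q0 lo0 lor rhi.
have r0 := lt_le_trans lo0 lor.
rewrite -Rintegral_itv_obnd_cbnd; last first.
  apply: (integrableS _ _ _ (integrable_exponent_density hi q0 r0)) => //.
  by apply: subset_itvr; rewrite bnd_simp.
rewrite /interferer_exponent.
rewrite (_ : `]r, hi]%classic = `[Rmin Rs rho, hi] `&` `]r, hi]); last first.
  by rewrite setIidr//; apply: subset_itvr; rewrite bnd_simp.
rewrite Rintegral_mkcondr; apply: eq_Rintegral => v; rewrite inE/= in_itv/= => /andP[lov vhi].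
rewrite patchE (_ : (v \in _) = (r < v)); last by apply/idP/idP; rewrite inE/= in_itv/= vhi andbT.
by case: ifP; rewrite ?mul0r.
Qed.

Lemma station_exponentE qL qH Rs rho m hi : 0 <= qL -> 0 <= qH -> 0 < Rmin Rs rho ->
  Rmin Rs rho <= m -> m <= hi ->
  station_exponent Rs rho hi L (fun v => (if v < m then qL else qH) * v `^ (- alpha)) =
  \int[@lebesgue_measure R]_(v in `[Rmin Rs rho, m]) exponent_density qL v +
  \int[@lebesgue_measure R]_(v in `[m, hi]) exponent_density qH v.
Proof.
move=> qL0 qH0 lo0 lom mhi; set lo := Rmin Rs rho in lo0 lom *.
have m0 := lt_le_trans lo0 lom.
have sL : `[lo, m[ `<=` `[lo, m] by apply: subset_itvl; rewrite bnd_simp.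
have iL : (@lebesgue_measure R).-integrable `[lo, m[ (EFin \o exponent_density qL).
  exact: (integrableS _ _ _ (integrable_exponent_density m qL0 lo0)).
have iH := integrable_exponent_density hi qH0 m0.
rewrite -Rintegral_itv_bndo_bndc// /station_exponent -/lo.
have sLD : `[lo, m[ `<=` `[lo, hi] by apply: subset_itvl; rewrite bnd_simp.
have sHD : `[m, hi] `<=` `[lo, hi] by apply: subset_itvr; rewrite bnd_simp.
rewrite -[in X in _ = X + _](setIidr sLD) -[in X in _ = _ + X](setIidr sHD) !Rintegral_mkcondr -RintegralD//; last 2 first.
- by rewrite -restrict_EFin; apply/integrable_restrict => //=; rewrite (setIidr sLD).
- by rewrite -restrict_EFin; apply/integrable_restrict => //=; rewrite (setIidr sHD).
apply: eq_Rintegral => v; rewrite inE/= in_itv/= => /andP[lov vhi].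
rewrite !patchE (_ : (v \in `[lo, m[%classic) = (v < m)); last first.
  by apply/idP/idP; rewrite inE/= in_itv/= lov.
rewrite (_ : (v \in `[m, hi]%classic) = ~~ (v < m)); last first.
  by apply/idP/idP; rewrite inE/= in_itv/= -leNgt vhi andbT.
by case: ifP => _ /=; rewrite ?addr0 ?add0r.
Qed.

Lemma within_continuous_exponent q (lo hi : R) : 0 <= q -> 0 < lo -> lo <= hi ->
  {within `[lo, hi], continuous (fun r =>
    \int[@lebesgue_measure R]_(v in `[r, hi]) exponent_density q v)}.
Proof.
move=> q0 lo0 lohi.
have int_lo := integrable_exponent_density hi q0 lo0.
(* The variable lower endpoint becomes a variable upper one, for which continuity of the integral is
   available. *)
apply: (@subspace_eq_continuous _ _ _ (fun r =>
  \int[@lebesgue_measure R]_(v in `[lo, hi]) exponent_density q v -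
  \int[@lebesgue_measure R]_(v in `[lo, r]) exponent_density q v)).
  move=> r; rewrite inE/= in_itv/= => /andP[lor rhi].
  rewrite Rintegral_itvB// ?bnd_simp// Rintegral_itv_obnd_cbnd//.
  apply: integrableS int_lo => //.
  by apply: subset_itvr; rewrite bnd_simp.
move=> r; apply: cvgB; first exact: cvg_cst.
exact: (parameterized_integral_continuous lohi int_lo).
Qed.

(** The strict test [x < m] makes the jump at m right continuous, which is what rounding distances
    upwards can exploit. *)
Lemma right_continuous_gain qL qH m v : 0 < v ->
  (if x < m then qL else qH) * x `^ (- alpha) @[x --> within [set x | v <= x] (nbhs v)]
  --> (if v < m then qL else qH) * v `^ (- alpha).
Proof.
move=> v0; apply: cvgM; last first.
  by apply: cvg_within_filter; exact: continuous_powR.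
apply: cvg_near_cst; case: ltP => vm.
  rewrite near_withinE; near=> x => _; rewrite ifT//.
  by near: x; exact: lt_nbhsl.
by rewrite near_withinE; apply: nearW => x vx; rewrite ifF// ltNge (le_trans vm vx).
Unshelve. all: by end_near. Qed.

End path_loss.

(** * The interference network *)

Section interference_weight.
Context {d} {T : measurableType d} {R : realType}.
Variables (Rs rho rho' theta psi1 psi2 GL GH : R).
Hypotheses (rho'_gt0 : 0 < rho') (rho'_lt : rho' < Rs).
Hypotheses (theta_gt0 : 0 < theta) (theta_lt : theta < pi / 2).
Hypothesis theta_rho' : Rs * sin theta <= rho'.
Hypotheses (psi1_lt : psi1 < acos (Rs / rho' * sin theta)).
Hypotheses (psi2_ge : acos (Rs / rho' * sin theta) <= psi2) (psi2_le : psi2 <= pi / 2).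

Let Rs_gt0 : 0 < Rs. Proof. exact: lt_trans rho'_gt0 rho'_lt. Qed.

Let sin_gt0 : 0 < sin theta.
Proof. by rewrite sin_gt0_pihalf// theta_gt0. Qed.

Let cos_gt0 : 0 < cos theta.
Proof.
by rewrite cos_gt0_pihalf// theta_lt andbT (lt_trans _ theta_gt0)// oppr_lt0 divr_gt0 ?pi_gt0.
Qed.

Let ratio_itv : 0 <= Rs / rho' * sin theta <= 1.
Proof.
rewrite mulr_ge0 ?(ltW sin_gt0)// ?divr_ge0 ?(ltW Rs_gt0) ?(ltW rho'_gt0)//=.
by rewrite mulrAC ler_pdivrMr// mul1r.
Qed.

Let acos_itv : 0 <= acos (Rs / rho' * sin theta).
Proof. by case/andP: ratio_itv => r0 r1; rewrite acos_ge0// r1 (le_trans _ r0)// lerN10. Qed.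

(** By [Rpsi_acos] a visible station has elevation at least [acos (Rs / rho' * sin theta)], hence
    above [psi1], so the default gain 0 does not occur. *)
Lemma bs_gainE x : enorm x = rho' -> edist x (sat Rs) <= Rmax Rs theta rho' ->
  bs_gain Rs psi1 psi2 GL GH x =
  if edist x (sat Rs) < Rpsi Rs rho' psi2 then GL else GH.
Proof.
move=> xr xmax.
have v0 : 0 < edist x (sat Rs).
  by apply: lt_le_trans (edist_ge_Rmin Rs_gt0 rho'_lt xr); rewrite subr_gt0.
have p2 : 0 <= psi2 <= pi / 2 by rewrite psi2_le (le_trans acos_itv).
have p1 : 0 <= acos (Rs / rho' * sin theta) <= pi / 2.
  by rewrite acos_itv (le_trans psi2_ge).
rewrite /bs_gain (lt_elevation rho'_gt0 rho'_lt p2 xr v0); case: ifP => // _.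
rewrite ifT// (lt_le_trans psi1_lt)//.
rewrite (le_elevation rho'_gt0 rho'_lt p1 xr v0) Rpsi_acos// ?ltW//.
Qed.

Lemma Rpsi_itv : Rmin Rs rho' <= Rpsi Rs rho' psi2 <= Rmax Rs theta rho'.
Proof.
have pi0 := pi_gt0 R.
have p1 := acos_itv; have p12 := psi2_ge; have p2 := psi2_le.
have s2 : 0 <= sin psi2 by apply: sin_ge0_pi; apply/andP; split; lra.
have s1 : 0 <= sin (acos (Rs / rho' * sin theta)).
  by apply: sin_ge0_pi; apply/andP; split; lra.
rewrite Rmin_le_Rpsi//= -(Rpsi_acos rho'_gt0 Rs_gt0 (ltW cos_gt0) (ltW sin_gt0) theta_rho').
apply: le_Rpsi_sin => //; move: p12; rewrite le_eqVlt => /predU1P[->//|p12].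
rewrite ltW// ltr_sin ?in_itv//=; apply/andP; split; lra.
Qed.

Variables (Phi Phi' : T -> seq (point R)) (X X' : nat -> T -> R).
Variables (G_us P_us P_b sigma2 alpha s : R).
Hypothesis Phi_sphere : forall w x, x \in Phi w -> sphere rho x.
Hypothesis Phi_sphere' : forall w x, x \in Phi' w -> sphere rho' x.

Lemma expR_interference r w :
  expR (- s * interference Rs rho rho' theta G_us P_us
    (bs_gain Rs psi1 psi2 GL GH) P_b sigma2 alpha Phi Phi' X X' r w) =
  expR (- s * sigma2) * network_weight Phi Phi' Rs
    (Rmax Rs theta rho) (Rmax Rs theta rho')
    (fun v => (s * G_us * P_us) * v `^ (- alpha))
    (fun v => (if v < Rpsi Rs rho' psi2 then s * GL * P_b else s * GH * P_b) * v `^ (- alpha))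
    X X' r w.
Proof.
rewrite /interference mulrDr expRD mulrC; congr (_ * _).
rewrite mulrDr expRD /network_weight; congr (_ * _).
  rewrite mulr_sumr expR_sum big_mkcond/=; apply: eq_bigr => i _.
  have xr : enorm (nth 0 (Phi w) i) = rho by apply: (@Phi_sphere w); rewrite mem_nth.
  rewrite (_ : (_ \in _) = (r < edist (nth 0 (Phi w) i) (sat Rs) <= Rmax Rs theta rho)).
    by case: ifP => _; [congr expR; ring|rewrite mul0r oppr0 expR0].
  apply/idP/idP; rewrite !inE /visible_cap /cap /sphere /=.
    move=> [[_ h1] h2]; rewrite h1 andbT ltNge; apply/negP => h3; exact: h2.
  by move=> /andP[h1 h2]; split => // -[_]; rewrite leNgt h1.
rewrite mulr_sumr expR_sum big_mkcond/=; apply: eq_bigr => i _.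
have xr : enorm (nth 0 (Phi' w) i) = rho' by apply: (@Phi_sphere' w); rewrite mem_nth.
rewrite (_ : (_ \in _) = (edist (nth 0 (Phi' w) i) (sat Rs) <= Rmax Rs theta rho')).
  case: ifP => h; last by rewrite mul0r oppr0 expR0.
  by rewrite bs_gainE//; case: ifP => _; congr expR; ring.
apply/idP/idP; rewrite !inE /visible_cap /cap /sphere /=; first by case.
by move=> h; split.
Qed.

End interference_weight.

Lemma within_continuous_expR {R : realType} (S : set R) (f : R -> R) :
  {within S, continuous f} -> {within S, continuous (expR \o f)}.
Proof.
move=> cf r; apply: (@continuous_comp _ _ _ (f : subspace S -> R) expR); first exact: cf.
exact: continuous_expR.
Qed.

Lemma visible_has {R : realType} (T : Type) (Phi : T -> seq (point R)) Rs theta rho w :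
  (forall x, x \in Phi w -> sphere rho x) ->
  (1 <= nb_points Phi (visible_cap Rs theta rho) w)%N =
  has (fun x => edist x (sat Rs) <= Rmax Rs theta rho) (Phi w).
Proof.
move=> h; rewrite has_count /nb_points; congr (_ < _)%N.
apply: eq_in_count => x /h xr.
by apply/idP/idP; rewrite inE /visible_cap /cap /=; [case|move=> ?; split].
Qed.

Theorem lemma3 (R : realType)
    (d : measure_display) (T : measurableType d) (P : probability T R)
    (* geometry *)
    (Rs Rus Rb theta lambda_us lambda_b : R)
    (Rs_gt0 : 0 < Rs) (Rus_ltRs : Rus < Rs) (Rb_ltRs : Rb < Rs)
    (theta_gt0 : 0 < theta) (theta_lt : theta < pi / 2)
    (theta_us : Rs * sin theta <= Rus) (theta_b : Rs * sin theta <= Rb)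
    (lambda_us_gt0 : 0 < lambda_us) (lambda_b_gt0 : 0 < lambda_b)
    (* gains *)
    (fc c0 Gs_side Gus_side GbL_side GbH_side psi1 psi2 : R)
    (fc_gt0 : 0 < fc) (c0_gt0 : 0 < c0)
    (Gs_gt0 : 0 < Gs_side) (Gus_gt0 : 0 < Gus_side)
    (GbL_gt0 : 0 < GbL_side) (GbH_gt0 : 0 < GbH_side)
    (psi1_lt : psi1 < acos (Rs / Rb * sin theta))
    (psi2_ge : acos (Rs / Rb * sin theta) <= psi2) (psi2_le : psi2 <= pi / 2)
    (* fading, powers, noise, path loss *)
    (b Om : R) (ms : nat) (b_gt0 : 0 < b) (Om_gt0 : 0 < Om) (ms_gt0 : (0 < ms)%N)
    (P_us P_b sigma2 alpha : R)
    (P_us_gt0 : 0 < P_us) (P_b_gt0 : 0 < P_b)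
    (sigma2_gt0 : 0 < sigma2) (alpha_gt0 : 0 < alpha)
    (* random objects *)
    (Phi_us Phi_b : T -> seq (point R)) (H_us H_b : nat -> {RV P >-> R})
    (u1 : T -> point R)
    (Phi_usP : homogeneous_PPP P Rus lambda_us Phi_us)
    (Phi_bP : homogeneous_PPP P Rb lambda_b Phi_b)
    (H_usP : forall i, has_SR_root P b Om ms (H_us i))
    (H_bP : forall j, has_SR_root P b Om ms (H_b j))
    (indep : mutually_independent P (network_sources Phi_us Phi_b H_us H_b))
    (u1P : nearest_point Phi_us (visible_cap Rs theta Rus) (sat Rs) u1)
    (s : R) (s_ge0 : 0 <= s) :
  let G_us := link_gain fc c0 Gs_side Gus_side in
  let G_bL := link_gain fc c0 Gs_side GbL_side in
  let G_bH := link_gain fc c0 Gs_side GbH_side in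
  let I := interference Rs Rus Rb theta G_us P_us
             (bs_gain Rs psi1 psi2 G_bL G_bH) P_b sigma2 alpha
             Phi_us Phi_b H_us H_b in
  let D := fun w => edist (u1 w) (sat Rs) in
  let Rpsi' := Rpsi Rs Rb psi2 in
  conditional_expectation P
    (fun w => expR (- s * I (D w) w))
    D
    [set w | (1 <= nb_points Phi_us (visible_cap Rs theta Rus) w)%N]
    `[Rmin Rs Rus, Rmax Rs theta Rus]
    (fun r => expR (- s * sigma2
       - 2 * pi * (lambda_us * (Rus / Rs))
         * exponent_term b Om ms s G_us P_us alpha r (Rmax Rs theta Rus)
       - 2 * pi * (lambda_b * (Rb / Rs))
         * exponent_term b Om ms s G_bL P_b alpha (Rmin Rs Rb) Rpsi'
       - 2 * pi * (lambda_b * (Rb / Rs))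
         * exponent_term b Om ms s G_bH P_b alpha Rpsi' (Rmax Rs theta Rb))).
Proof.
(* The fading lemmas are stated for ms = k.+1, Kummer's polynomial having degree k. *)
case: ms ms_gt0 H_usP H_bP => // k _ H_usP H_bP.
have sin_gt0 : 0 < sin theta by rewrite sin_gt0_pihalf// theta_gt0.
have Rus_gt0 : 0 < Rus by rewrite (lt_le_trans _ theta_us)// mulr_gt0.
have Rb_gt0 : 0 < Rb by rewrite (lt_le_trans _ theta_b)// mulr_gt0.
have gain_ge0 G : 0 < G -> 0 <= link_gain fc c0 Gs_side G.
  by move=> G0; rewrite /link_gain mulr_ge0 ?sqr_ge0// mulr_ge0// ltW.
move=> G_us G_bL G_bH I D Rpsi'.
have th : 0 < theta < pi / 2 by rewrite theta_gt0.
have lohi := Rmin_lt_Rmax Rs_gt0 Rus_ltRs th theta_us.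
have lohi' := Rmin_lt_Rmax Rs_gt0 Rb_ltRs th theta_b.
have hi_le := Rmax_le theta Rs_gt0 Rus_gt0.
have hi'_le := Rmax_le theta Rs_gt0 Rb_gt0.
have lo_gt0 : 0 < Rmin Rs Rus by rewrite subr_gt0.
have lo'_gt0 : 0 < Rmin Rs Rb by rewrite subr_gt0.
have [_ sph _] := Phi_usP; have [_ sph' _] := Phi_bP.
pose q := s * G_us * P_us.
pose qL := s * G_bL * P_b.
pose qH := s * G_bH * P_b.
have q_ge0 : 0 <= q by apply: mulr_ge0; [apply: mulr_ge0 => //; exact: gain_ge0|exact: ltW].
have qL_ge0 : 0 <= qL by apply: mulr_ge0; [apply: mulr_ge0 => //; exact: gain_ge0|exact: ltW].
have qH_ge0 : 0 <= qH by apply: mulr_ge0; [apply: mulr_ge0 => //; exact: gain_ge0|exact: ltW].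
pose al v := q * v `^ (- alpha).
pose be v := (if v < Rpsi' then qL else qH) * v `^ (- alpha).
have al_ge0 v : 0 <= al v by rewrite mulr_ge0 ?powR_ge0.
have be_ge0 v : 0 <= be v by rewrite mulr_ge0 ?powR_ge0//; case: ifP.
pose L := SR_laplace b Om k.
have HL i a : 0 <= a -> (\int[P]_w (expR (- (a * Num.sqrt (H_us i w) ^+ 2)))%:E = (L a)%:E)%E.
  by move=> a0; exact: has_SR_root_laplace.
have HL' i a : 0 <= a -> (\int[P]_w (expR (- (a * Num.sqrt (H_b i w) ^+ 2)))%:E = (L a)%:E)%E.
  by move=> a0; exact: has_SR_root_laplace.
have cL a : 0 <= a -> {for a, continuous L} by exact: continuous_SR_laplace.
have al_right v : Rmin Rs Rus <= v <= Rmax Rs theta Rus ->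
    al x @[x --> within [set x | v <= x] (nbhs v)] --> al v.
  move=> /andP[lov _]; apply: cvg_within_filter; apply: cvgM; first exact: cvg_cst.
  exact/continuous_powR/(lt_le_trans lo_gt0).
have be_right v : Rmin Rs Rb <= v <= Rmax Rs theta Rb ->
    be x @[x --> within [set x | v <= x] (nbhs v)] --> be v.
  move=> /andP[lov _]; exact/right_continuous_gain/(lt_le_trans lo'_gt0).
pose E w := has (fun x => edist x (sat Rs) <= Rmax Rs theta Rus) (Phi_us w).
have EE : [set w | (1 <= nb_points Phi_us (visible_cap Rs theta Rus) w)%N] = [set w | E w].
  by apply/seteqP; split => w /=; rewrite (@visible_has _ _ _ Rs theta Rus w (sph w)).
have u1E w : E w -> [/\ u1 w \in Phi_us w, edist (u1 w) (sat Rs) <= Rmax Rs theta Rus &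
    forall y, y \in Phi_us w -> edist y (sat Rs) <= Rmax Rs theta Rus ->
      edist (u1 w) (sat Rs) <= edist y (sat Rs)].
  rewrite /E -(visible_has _ _ (sph w)) => /u1P[h1 [_ h2] h3]; split => //.
  by move=> y yw yhi; apply: h3 => //; split => //; exact: sph yw.
pose Xw := network_weight Phi_us Phi_b Rs (Rmax Rs theta Rus) (Rmax Rs theta Rb) al be.
pose g0 := expR (- s * sigma2).
have g0_ge0 : 0 <= g0 := expR_ge0 _.
have XE w : expR (- s * I (D w) w) = g0 * Xw H_us H_b (D w) w.
  exact: expR_interference.
pose gl := network_laplace Rs Rus Rb lambda_us lambda_b (Rmax Rs theta Rus) (Rmax Rs theta Rb) L al be.
have gE r : Rmin Rs Rus <= r <= Rmax Rs theta Rus ->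
  expR (- s * sigma2
       - 2 * pi * (lambda_us * (Rus / Rs))
         * exponent_term b Om k.+1 s G_us P_us alpha r (Rmax Rs theta Rus)
       - 2 * pi * (lambda_b * (Rb / Rs))
         * exponent_term b Om k.+1 s G_bL P_b alpha (Rmin Rs Rb) Rpsi'
       - 2 * pi * (lambda_b * (Rb / Rs))
         * exponent_term b Om k.+1 s G_bH P_b alpha Rpsi' (Rmax Rs theta Rb)) = g0 * gl r.
  move=> /andP[lor rhi]; rewrite /gl /network_laplace /g0 -!expRD; congr expR.
  rewrite interferer_exponentE// -/q.
  have /andP[m1 m2] := Rpsi_itv Rb_gt0 Rb_ltRs theta_gt0 theta_lt theta_b psi2_ge psi2_le.
  rewrite station_exponentE// !exponent_termE -/q -/qL -/qH; ring.
have mE : measurable [set w | E w].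
  exact: (measurable_visible Rus_gt0 Rus_ltRs lohi Phi_usP u1E).
have mD : measurable_fun [set w | E w] D.
  exact: (measurable_nearest_dist Rus_gt0 Rus_ltRs lohi Phi_usP u1E).
have DS w : E w -> Rmin Rs Rus <= D w <= Rmax Rs theta Rus.
  move=> /u1E[h1 h2 _]; rewrite h2 andbT; apply: edist_ge_Rmin => //; exact: sph h1.
rewrite EE.
(* On E the nearest distance lies in the prescribed interval automatically. *)
have ESE : [set w | E w] `&` D @^-1` `[Rmin Rs Rus, Rmax Rs theta Rus] = [set w | E w].
  by apply/seteqP; split => w /=; [case|move=> Ew; split => //; rewrite in_itv/= DS].
have mEB B : measurable B -> measurable ([set w | E w] `&` D @^-1` B) by move=> mB; exact: mD.
have onE (h : T -> R) : measurable_fun setT (fun w => (E w)%:R * h w) -> measurable_fun [set w | E w] h.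
  move=> mh; apply: (eq_measurable_fun (fun w => (E w)%:R * h w)) => [w|].
    by rewrite inE/= => ->; rewrite mul1r.
  exact: measurable_funTS.
have mXw (Y Y' : nat -> T -> R) : (forall i, measurable_fun setT (Y i)) ->
    (forall i, measurable_fun setT (Y' i)) ->
    measurable_fun [set w | E w] (fun w => Xw Y Y' (D w) w).
  move=> mY mY'; apply: onE.
  exact: (measurable_network_weightE Rus_gt0 Rus_ltRs Rb_ltRs lohi lohi' Phi_usP Phi_bP al_right be_right u1E mY mY').
pose K i w := Num.sqrt (H_us i w) ^+ 2.
pose K' i w := Num.sqrt (H_b i w) ^+ 2.
have mK i : measurable_fun setT (K i).
  by apply: measurable_funX; apply: measurableT_comp => //; exact: measurable_sqrt.
have mK' i : measurable_fun setT (K' i).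
  by apply: measurable_funX; apply: measurableT_comp => //; exact: measurable_sqrt.
(* Almost sure equality with the version in squared roots would not give measurability, as P need
   not be complete; hence the direct argument with the fading powers themselves. *)
have mX : measurable_fun [set w | E w] (fun w => expR (- s * I (D w) w)).
  apply: (eq_measurable_fun (fun w => g0 * Xw H_us H_b (D w) w)) => [w _|]; first by rewrite XE.
  by apply: measurable_funM => //; apply: mXw => i; exact: measurable_funP.
pose X' w := g0 * Xw K K' (D w) w.
have mX' : measurable_fun [set w | E w] X' by apply: measurable_funM => //; exact: mXw.
have g0_le1 : g0 <= 1 by rewrite expR_le1 mulNr oppr_le0 mulr_ge0// ltW.
have X'01 w : 0 <= X' w <= 1.
  have /andP[x0 x1] := network_weight01 Phi_us Phi_b H_us H_b Rs (Rmax Rs theta Rus) (Rmax Rs theta Rb) al_ge0 be_ge0 (D w) w.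
  by rewrite mulr_ge0//= mulr_ile1.
(* One null set is discarded per fading power, countably many in all; outside them every squared
   root is the fading power. *)
have aeX : {ae P, forall w, expR (- s * I (D w) w) = X' w}.
  have pos (H : nat -> {RV P >-> R}) : (forall i, has_SR_root P b Om k.+1 (H i)) ->
      {ae P, forall w, forall i, 0 <= H i w}.
    move=> HP; apply: ae_foralln => i; exists [set w | H i w <= 0]; split.
    - rewrite -[X in measurable X]setTI.
      rewrite (_ : [set w | H i w <= 0] = H i @^-1` `]-oo, 0]%classic).
        by apply: measurable_funP => //; exact: measurable_itv.
      by apply/seteqP; split => w /=; rewrite in_itv.
    - exact: has_SR_root_gt0 (HP i).
    - by move=> w /= /negP; rewrite -ltNge => /ltW.
  have := pos _ H_bP; have := pos _ H_usP.
  apply: filterS2 => w h1 h2; rewrite XE /X' /Xw /network_weight; congr (_ * (_ * _)).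
    by apply: eq_bigr => i _; rewrite /K sqr_sqrtr.
  by apply: eq_bigr => i _; rewrite /K' sqr_sqrtr.
have intX' B : measurable B -> P.-integrable ([set w | E w] `&` D @^-1` B) (EFin \o X').
  move=> mB; apply: measurable_bounded_integrable.
  - exact: mEB.
  - by rewrite (le_lt_trans (probability_le1 _ _)) ?ltry//; exact: mEB.
  - by apply: measurable_funS mX' => //; exact: subIsetl.
  - exists 1; split; rewrite ?num_real// => M M1 w _ /=.
    by rewrite ger0_norm; case/andP: (X'01 w) => // _ /le_trans; apply; exact: ltW.
have aeEB B : ae_eq P ([set w | E w] `&` D @^-1` B) (EFin \o X') (fun w => (expR (- s * I (D w) w))%:E).
  by apply: filterS aeX => w wE _; rewrite /= wE.
have mS : measurable (`[Rmin Rs Rus, Rmax Rs theta Rus]%classic : set R) by exact: measurable_itv.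
have mXB B : measurable B -> measurable_fun ([set w | E w] `&` D @^-1` B) (fun w => expR (- s * I (D w) w)).
  by move=> mB; apply: measurable_funS mX => //; exact: subIsetl.
have mX'B B : measurable B -> measurable_fun ([set w | E w] `&` D @^-1` B) X'.
  by move=> mB; apply: measurable_funS mX' => //; exact: subIsetl.
have gl01 r : 0 <= gl r <= 1 by exact: (network_laplace01 _ _ Rus_gt0 Rus_ltRs lambda_us_gt0 Rb_gt0 Rb_ltRs lambda_b_gt0 HL al_ge0 be_ge0).
have mgl : measurable_fun [set w | E w] (gl \o D).
  apply: onE; exact: (measurable_network_laplace lambda_b Rus_gt0 Rus_ltRs Rb_ltRs lohi lohi' Phi_usP HL cL al_ge0 be_ge0 al_right be_right u1E).
split.
- exact: (visible_gt0 Rus_gt0 Rus_ltRs lambda_us_gt0 lohi hi_le Phi_usP u1E).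
- apply/integrableP; split; first by apply/measurable_EFinP; exact: mXB.
  have /integrableP[_] := intX' _ mS; rewrite (@ae_eq_integral _ _ _ P _ (fun w => `|(expR (- s * I (D w) w))%:E|)%E)//.
  + exact: mEB.
  + by apply: measurableT_comp => //; apply/measurable_EFinP; exact: mX'B.
  + by apply: measurableT_comp => //; apply/measurable_EFinP; exact: mXB.
  + by apply: filterS (aeEB `[Rmin Rs Rus, Rmax Rs theta Rus]%classic) => w h /h /= -[->].
(* Among the exponents only that of the users varies with r. *)
- have cex := @within_continuous_exponent _ _ _ k alpha b_gt0 Om_gt0 _ _ _ q_ge0 lo_gt0 (ltW lohi).
  have cF : {within `[Rmin Rs Rus, Rmax Rs theta Rus], continuous (fun r => - s * sigma2
       - 2 * pi * (lambda_us * (Rus / Rs))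
         * exponent_term b Om k.+1 s G_us P_us alpha r (Rmax Rs theta Rus)
       - 2 * pi * (lambda_b * (Rb / Rs))
         * exponent_term b Om k.+1 s G_bL P_b alpha (Rmin Rs Rb) Rpsi'
       - 2 * pi * (lambda_b * (Rb / Rs))
         * exponent_term b Om k.+1 s G_bH P_b alpha Rpsi' (Rmax Rs theta Rb))}.
    move=> r; apply: cvgB; last exact: cvg_cst.
    apply: cvgB; last exact: cvg_cst.
    apply: cvgB; first exact: cvg_cst.
    by apply: cvgM; [exact: cvg_cst|exact: cex].
  exact: within_continuous_expR cF.
- rewrite ESE; apply: (@eq_integrable _ _ _ P _ mE (EFin \o (fun w => g0 * gl (D w)))).
    by move=> w; rewrite inE/= => /DS/gE ->.
  apply: measurable_bounded_integrable => //.
  - by rewrite (le_lt_trans (probability_le1 _ _)) ?ltry.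
  - by apply: measurable_funM => //; exact: mgl.
  - exists 1; split; rewrite ?num_real// => M M1 w _ /=.
    case/andP: (gl01 (D w)) => g1 g2.
    by rewrite ger0_norm ?mulr_ge0// (le_trans _ (ltW M1))// mulr_ile1.
- move=> B mB BS.
  transitivity (\int[P]_(w in [set w | E w] `&` D @^-1` B) (EFin \o X') w)%E.
    apply/esym; apply: ae_eq_integral.
    + exact: mEB.
    + by apply/measurable_EFinP; exact: mX'B.
    + by apply/measurable_EFinP; exact: mXB.
    + exact: aeEB.
  transitivity (g0%:E * \int[P]_(w in [set w | E w] `&` D @^-1` B) (Xw K K' (D w) w)%:E)%E.
    rewrite -ge0_integralZl//.
    + exact: mEB.
    + apply/measurable_EFinP; apply: (measurable_funS mE); first exact: subIsetl.
      exact: mXw.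
    + move=> w _; rewrite lee_fin.
      by have /andP[] := network_weight01 Phi_us Phi_b H_us H_b Rs (Rmax Rs theta Rus) (Rmax Rs theta Rb) al_ge0 be_ge0 (D w) w.
  rewrite (integral_network_conditional Rus_gt0 Rus_ltRs lambda_us_gt0 Rb_gt0 Rb_ltRs lambda_b_gt0 lohi hi_le lohi' hi'_le Phi_usP Phi_bP indep HL HL' cL al_ge0 be_ge0 al_right be_right u1E mB).
  rewrite -ge0_integralZl//.
  + by apply: eq_integral => w; rewrite inE/= => -[/DS/gE -> _]; rewrite EFinM.
  + exact: mEB.
  + apply/measurable_EFinP; apply: (measurable_funS mE); first exact: subIsetl.
    exact: mgl.
  + by move=> w _; rewrite lee_fin; case/andP: (gl01 (D w)).
Qed.
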